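(* Let $d\ge1$ and for $1\le k\le d$ let $g^k\in L^2(\mathbb{R}^m)$ and $\Lambda_k$ a countable family of points of $\mathbb{R}^{2m}$ such that $\mathcal{G}(g^k,\Lambda_k)$ is a frame for $L^2(\mathbb{R}^m)$. Let $a_k:\Lambda_1\to\Lambda_k$, $2\le k\le d$, be bijections ($a_1$ the identity) such that $$\mathcal{F}=\{g^1_\lambda\oplus g^2_{a_2(\lambda)}\oplus\cdots\oplus g^d_{a_d(\lambda)}:\lambda\in\Lambda_1\}$$ is a frame for $L^2(\mathbb{R}^m)\oplus\cdots\oplus L^2(\mathbb{R}^m)$. Fix $O\in\mathbb{R}^{2m}$ and assume there are invertible matrices $M^1,\dots,M^d\in\mathbb{R}^{2m\times2m}$ such that for all $k$ $$\lim_n\frac{|a_k^{-1}(\Lambda_k\cap M^kQ_n(O))\cap M^1Q_n(O)|}{|\Lambda_1\cap M^1Q_n(O)|}=\lim_n\frac{|\Lambda_k\cap M^kQ_n(O)|}{|\Lambda_1\cap M^1Q_n(O)|}=1,$$ and a function $r:[0,\infty)\to[0,\infty)$ such that $\|a_k^{-1}(\sigma_1)-a_k^{-1}(\sigma_2)\|\le r(\|\sigma_1-\sigma_2\|)$ for all $k$ and all $\sigma_1,\sigma_2\in\Lambda_k$. Then the ultrafilter frame measure function of $\mathcal{F}$ (indexed by $\Lambda_1$ with $\Lambda_{1,n}=\Lambda_1\cap M^1Q_n(O)$) is $$\mu(\mathcal{F})(p)=\sum_{k=1}^d\frac{1}{D(\Lambda_k;p,M^k)},\qquad p\in\mathbb{N}^*,$$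 and in particular necessarily $\sum_{k=1}^d\frac{1}{D(\Lambda_k;p,M^k)}\le1$ for all $p\in\mathbb{N}^*$.
   Context: For $\lambda=(t,\omega)\in\mathbb{R}^m\times\mathbb{R}^m$ and phase $\varphi_\lambda$, $g_\lambda(x)=e^{i\varphi_\lambda}e^{2\pi i\langle\omega,x\rangle}g(x-t)$ and $\mathcal{G}(g,\Lambda)=\{g_\lambda\}_{\lambda\in\Lambda}$ (arbitrary fixed phases; $\Lambda$ may contain repetitions, counted with multiplicity). $Q_n(c)=\{\lambda\in\mathbb{R}^{2m}:\|\lambda-c\|_\infty\le n/2\}$. $\|\cdot\|$ is a fixed norm on $\mathbb{R}^{2m}$. $\mathbb{N}^*$: free ultrafilters on $\mathbb{N}$; $p\text{-}\lim$: limit of a bounded sequence along $p$. $D(\Lambda;p,M)=p\text{-}\lim_n\frac{|\Lambda\cap MQ_n(O)|}{\mathrm{vol}(MQ_n(O))}$. For a frame $\{h_\lambda\}_{\lambda\in\Lambda_1}$ with canonical dual $\{\tilde h_\lambda\}$, $\mu(\mathcal{F})(p)=p\text{-}\lim_n\frac{1}{|\Lambda_{1,n}|}\sum_{\lambda\in\Lambda_{1,n}}\langle h_\lambda,\tilde h_\lambda\rangle$. *)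

(* Defs.v *)
From HB Require Import structures.
From mathcomp Require Import all_boot all_order all_algebra.
From mathcomp Require Import all_classical all_reals all_analysis.
From Stdlib Require Import ClassicalEpsilon.
Set Implicit Arguments. Unset Strict Implicit. Unset Printing Implicit Defensive.
Import Order.TTheory GRing.Theory Num.Theory numFieldNormedType.Exports.
Local Open Scope classical_set_scope.
Local Open Scope ring_scope.

Section GaborDefs.
Variable R : realType.

Definition cplx := (R * R)%type.
Definition cadd (a b : cplx) : cplx := (a.1 + b.1, a.2 + b.2).
Definition cmul (a b : cplx) : cplx := (a.1 * b.1 - a.2 * b.2, a.1 * b.2 + a.2 * b.1).
Definition cconj (a : cplx) : cplx := (a.1, - a.2).
Definition cabs2 (a : cplx) : R := a.1 ^+ 2 + a.2 ^+ 2.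
Definition cexpi (theta : R) : cplx := (cos theta, sin theta).

(* ---------- Lebesgue integral on R^m (as iterated integrals, Fubini) ---------- *)
Fixpoint iint_m (m : nat) : ('rV[R]_m -> \bar R) -> \bar R :=
  match m return ('rV[R]_m -> \bar R) -> \bar R with
  | 0 => fun f => f 0
  | m'.+1 => fun f =>
      (\int[@lebesgue_measure R]_x
          @iint_m m' (fun y : 'rV[R]_m' => f (row_mx (x%:M : 'rV[R]_1) y)))%E
  end.

(* Borel sigma-algebra of R^m: generated by the coordinate projections *)
Definition coord_sets (m : nat) : set (set 'rV[R]_m) :=
  [set S | exists (i : 'I_m) (A : set R), measurable A /\
             S = (fun v : 'rV[R]_m => v ord0 i) @^-1` A].
Definition rmeasurable (m : nat) (f : 'rV[R]_m -> R) : Prop :=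
  forall B : set R, measurable B -> <<s @coord_sets m >> (f @^-1` B).

Definition CFun (m : nat) := 'rV[R]_m -> cplx.
Definition L2c (m : nat) (f : CFun m) : Prop :=
  [/\ rmeasurable (fun x => (f x).1), rmeasurable (fun x => (f x).2)
    & (iint_m (fun x => (cabs2 (f x))%:E) < +oo)%E].
Definition Rint (m : nat) (f : 'rV[R]_m -> R) : R := fine (iint_m (fun x => (f x)%:E)).
Definition ipL2 (m : nat) (f g : CFun m) : cplx :=
  (Rint (fun x => (cmul (f x) (cconj (g x))).1),
   Rint (fun x => (cmul (f x) (cconj (g x))).2)).

Definition dsum_mem (m d : nat) (F : 'I_d -> CFun m) : Prop := forall k, L2c (F k).
Definition dsum_ip (m d : nat) (F G : 'I_d -> CFun m) : cplx :=
  (\sum_(k < d) (ipL2 (F k) (G k)).1, \sum_(k < d) (ipL2 (F k) (G k)).2).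

Definition rsum_abs (I : choiceType) (u : I -> R) : R :=
  fine (\esum_(i in [set: I]) (Num.max (u i) 0)%:E)
  - fine (\esum_(i in [set: I]) (Num.max (- u i) 0)%:E).
Definition csum_abs (I : choiceType) (u : I -> cplx) : cplx :=
  (rsum_abs (fun i => (u i).1), rsum_abs (fun i => (u i).2)).

Section Frames.
Variables (V : Type) (mem : V -> Prop) (ip : V -> V -> cplx).
Variable I : choiceType.

Definition is_frame (h : I -> V) : Prop :=
  (forall i, mem (h i)) /\
  exists A B : R, [/\ 0 < A, A <= B &
    forall f, mem f ->
      ((A * (ip f f).1)%:E <= \esum_(i in [set: I]) (cabs2 (ip f (h i)))%:E
        <= (B * (ip f f).1)%:E)%E].

(* S g = v, where S f = sum_j <f, h_j> h_j is the frame operator (weak form) *)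
Definition frame_op_maps (h : I -> V) (g v : V) : Prop :=
  forall f, mem f -> ip v f = csum_abs (fun j => cmul (ip g (h j)) (ip (h j) f)).

Definition can_dual (v0 : V) (h : I -> V) (i : I) : V :=
  epsilon (inhabits v0) (fun g => mem g /\ frame_op_maps h g (h i)).

Definition mcount (S : set I) : R := \sum_(i \in S) (1 : R).

End Frames.

Definition free_ultrafilter (p : set (set nat)) : Prop :=
  [/\ ~ p set0 /\ p setT,
      (forall A B, p A -> p B -> p (A `&` B)),
      (forall A B, A `<=` B -> p A -> p B),
      (forall A, p A \/ p (~` A))
    & (forall A, finite_set A -> ~ p A)].

Definition ulim (p : set (set nat)) (u : nat -> R) : R :=
  epsilon (inhabits 0)
    (fun L => forall e : R, 0 < e -> p [set n | `|u n - L| < e]).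

Definition frame_measure (V : Type) (mem : V -> Prop) (ip : V -> V -> cplx)
    (v0 : V) (I : choiceType) (h : I -> V) (sel : nat -> set I)
    (p : set (set nat)) : R :=
  ulim p (fun n => (mcount (sel n))^-1 *
     \sum_(i \in sel n) (ip (h i) (can_dual mem ip v0 h i)).1).

(* points lambda = (t, omega) of R^{2m} = R^{m+m} *)
Definition gabor (m : nat) (g : CFun m) (ph : R) (lam : 'rV[R]_(m + m)) : CFun m :=
  fun x => cmul (cexpi ph)
    (cmul (cexpi (2 * pi * \sum_(j < m) (rsubmx lam) ord0 j * x ord0 j))
          (g (x - lsubmx lam))).

Definition Qn (n : nat) (c : 'rV[R]_n) (k : nat) : set 'rV[R]_n :=
  [set v | forall j, `|v ord0 j - c ord0 j| <= k%:R / 2].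
Definition MQ (n : nat) (M : 'M[R]_n) (c : 'rV[R]_n) (k : nat) : set 'rV[R]_n :=
  [set v | exists w, Qn c k w /\ v = w *m M^T].

Definition volm (n : nat) (S : set 'rV[R]_n) : R :=
  fine (iint_m (fun x => (\1_S x)%:E)).

Definition gdensity (n : nat) (I : choiceType) (lam : I -> 'rV[R]_n)
    (O : 'rV[R]_n) (M : 'M[R]_n) (p : set (set nat)) : R :=
  ulim p (fun k => mcount [set i | MQ M O k (lam i)] / volm (MQ M O k)).

Definition is_normf (n : nat) (nrm : 'rV[R]_n -> R) : Prop :=
  [/\ forall x, nrm x = 0 -> x = 0,
      forall (a : R) x, nrm (a *: x) = `|a| * nrm x
    & forall x y, nrm (x + y) <= nrm x + nrm y].

End GaborDefs.

Definition zero_vec (R : realType) (m d : nat) : 'I_d -> CFun R m :=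
  fun _ _ => (0, 0).
Definition zero_fun (R : realType) (m : nat) : CFun R m := fun _ => (0, 0).
Arguments mcount {R I} S.

(* Main.v *)
Require Import Defs.
From HB Require Import structures.
From mathcomp Require Import all_boot all_order all_algebra.
From mathcomp Require Import all_classical all_reals all_analysis.
From mathcomp Require Import measurable_realfun measurable_fun_approximation.
From mathcomp Require Import ring lra.
From Stdlib Require ClassicalEpsilon.
Set Implicit Arguments. Unset Strict Implicit. Unset Printing Implicit Defensive.
Import Order.TTheory GRing.Theory Num.Theory numFieldNormedType.Exports.
Local Open Scope classical_set_scope.
Local Open Scope ring_scope.

(* Let [e_z] be the time-frequency shifts of the indicator of [[0,1]^m].  They
   form a continuous tight frame (Moyal's identity), so for each component [k],
   with [F_i] the frame and [F~_i] its canonical dual,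
     sum_i T(i, z) = |e_z|^2 = 1   and   int_z T(i, z) dz = Re <F_i^k, F~_i^k>,
   where [T(i, z) = Re <F_i^k, e_z> <e_z, F~_i^k>].  Summing [T] over the indices
   whose point lies in [K = M^k Q_n], or integrating it over [z] in [K], gives
     sum_{pt i in K} Re <F_i^k, F~_i^k> - vol K = int int (1_K(pt i) - 1_K(z)) T(i, z).
   Since [|<F_i^k, e_z>|^2 = W(z - pt i)] with [W] integrable, the right-hand side
   only sees pairs straddling the boundary of [K] and is [o(vol K)].  Hence the
   diagonal terms over [K] add up to [vol K (1 + o(1))]; the counting hypotheses
   replace [K] by the common region [M^1 Q_n], and dividing by the number of
   points gives [1 / D] along [p].  The bound by 1 comes from
   [0 <= <F_i, F~_i> <= 1]. *)

(** * Product measures and Lebesgue measure on row vectors *)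

(** The canonical dual has no Gabor structure and no known decay: its coefficients [<F~_i, e_z>] are
    controlled only in total energy, over [z] by the norm of [F~_i] and over [i] by the dual Bessel
    bound. All localization must come from the other factor, hence the weighted AM-GM splitting of
    [|T|]: the dual energy is paid for by a small multiple [e] of the volume, and only [W(z - pt i)]
    has to see the boundary. The weight [e] is fixed before [n] grows. Placing [e_z] in a single
    summand of the direct sum lets the bounds of the whole frame serve each component. The lower
    bound forces [W] to have positive mass, and together with the upper bound this limits the number
    of points per unit volume. A zero density is excluded only at the end: bounded diagonal terms
    add up to about the volume. Indicator windows make the atoms factor over coordinates, so Moyal's
    identity reduces to dimension one, where Plancherel comes from Abel summation with weight
    exp(-a|w|). Index sets are embedded in the naturals so that every sum is an integral open to
    Tonelli and Fubini. *)

Section product_sigma_finite.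
Context d1 d2 (T1 : measurableType d1) (T2 : measurableType d2) (R : realType).
Variable m1 : {sigma_finite_measure set T1 -> \bar R}.
Variable m2 : {sigma_finite_measure set T2 -> \bar R}.

Lemma product_measure1_sigma_finite : sigma_finite setT (m1 \x m2)%E.
Proof.
have /sigma_finiteP[F [TF ndF Foo]] := sigma_finiteT m1.
have /sigma_finiteP[G [TG ndG Goo]] := sigma_finiteT m2.
exists (fun n => F n `*` G n).
  rewrite -setXTT TF TG predeqE => -[x y]; split => [|[n _ []/= ? ?]].
    move=> [/= [n _ Fnx] [k _ Gky]]; exists (maxn n k) => //; split.
      by move: x Fnx; exact/subsetPset/ndF/leq_maxl.
    by move: y Gky; exact/subsetPset/ndG/leq_maxr.
  by split; exists n.
move=> k; have [? ?] := Foo k; have [? ?] := Goo k.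
split; first exact: measurableX.
by rewrite product_measure1E// lte_mul_pinfty// ge0_fin_numE.
Qed.

(* MathComp-Analysis leaves [m1 \x m2] without a usable sigma-finite structure,
   hence this alias. *)
Definition prodm : set (T1 * T2)%type -> \bar R := (m1 \x m2)%E.
HB.instance Definition _ := Measure.on prodm.
HB.instance Definition _ := Measure_isSigmaFinite.Build _ _ _ prodm
  product_measure1_sigma_finite.

Lemma prodm_tonelli1 (f : T1 * T2 -> \bar R) : measurable_fun setT f ->
  (forall z, 0 <= f z)%E ->
  (\int[prodm]_z f z = \int[m1]_x \int[m2]_y f (x, y))%E.
Proof. exact: fubini_tonelli1. Qed.

Lemma prodm_tonelli2 (f : T1 * T2 -> \bar R) : measurable_fun setT f ->
  (forall z, 0 <= f z)%E ->
  (\int[prodm]_z f z = \int[m2]_y \int[m1]_x f (x, y))%E.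
Proof. exact: fubini_tonelli2. Qed.

Lemma prodm_fubini1 (f : T1 * T2 -> \bar R) : prodm.-integrable setT f ->
  (\int[prodm]_z f z = \int[m1]_x \int[m2]_y f (x, y))%E.
Proof. by move=> fi; rewrite (integral12_prod_meas1 fi). Qed.

Lemma prodm_fubini2 (f : T1 * T2 -> \bar R) : prodm.-integrable setT f ->
  (\int[prodm]_z f z = \int[m2]_y \int[m1]_x f (x, y))%E.
Proof. by move=> fi; rewrite (integral21_prod_meas1 fi). Qed.

End product_sigma_finite.

(** Row vectors under a name that carries the coordinate sigma-algebra, so that [rmeasurable]
    becomes ordinary measurability. *)
Definition rvec (R : realType) m := g_sigma_algebraType (@coord_sets R m).

HB.instance Definition _ (R : realType) m :=
  Measurable.copy (rvec R m) (g_sigma_algebraType (@coord_sets R m)).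

Section vector_measure.
Variable R : realType.
Notation vec m := (rvec R m).
Notation leb := (@lebesgue_measure R).
Notation RR := (measurableTypeR R).

Lemma measurable_coord m (i : 'I_m) :
  measurable_fun [set: vec m] (fun v : vec m => v ord0 i : R).
Proof.
move=> _ A mA; rewrite setTI; apply: sub_sigma_algebra.
by exists i, A.
Qed.

Lemma measurable_rvecP d (T : measurableType d) m (f : T -> vec m) :
  (forall i, measurable_fun setT (fun x => f x ord0 i : R)) ->
  measurable_fun setT f.
Proof.
move=> h; apply: (@measurability _ _ _ (vec m) setT f (@coord_sets R m)) => //.
move=> _ [_ [i [A [mA ->]]] <-].
exact: h.
Qed.

(** The gluing of a first coordinate used by the recursion of [iint_m]; every induction on the
    dimension goes through it. *)
Definition consv m (p : RR * vec m) : vec m.+1 :=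
  row_mx ((p.1 : R)%:M : 'rV[R]_1) p.2.

Lemma consv0 m p (i : 'I_1) : (@consv m p) i ord0 = p.1.
Proof.
rewrite /consv; have -> : (ord0 : 'I_(1 + m)) = lshift m ord0 by exact/val_inj.
by apply: etrans (row_mxEl _ _ _ _) _; rewrite mxE !ord1 eqxx mulr1n.
Qed.

Lemma consvS m p (i : 'I_1) (j : 'I_m) : (@consv m p) i (lift ord0 j) = p.2 i j.
Proof.
rewrite /consv; have -> : (lift ord0 j : 'I_(1 + m)) = rshift 1 j by exact/val_inj.
exact: etrans (row_mxEr _ _ _ _) _.
Qed.

Lemma measurable_consv m : measurable_fun [set: RR * vec m] (@consv m).
Proof.
apply: measurable_rvecP => i.
case: (unliftP ord0 i) => [j|] ->.
  under eq_fun do rewrite consvS.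
  exact: (measurableT_comp (@measurable_coord m j)).
under eq_fun do rewrite consv0.
exact: measurable_fst.
Qed.

Section step.
Variables (m : nat) (nu : {sigma_finite_measure set (vec m) -> \bar R}).

Definition rvec_step : set (vec m.+1) -> \bar R :=
  pushforward (prodm leb nu) (@consv m).

Let step0 : rvec_step set0 = 0%E.
Proof. by rewrite /rvec_step /pushforward preimage_set0 measure0. Qed.

Let step_ge0 A : (0 <= rvec_step A)%E.
Proof. exact: integral_ge0. Qed.

Let step_sigma_additive : semi_sigma_additive rvec_step.
Proof.
pose pm := measure_function_pushforward__canonical__measure_function_Measure
     (prodm leb nu) (@measurable_consv m).
exact: (@measure_semi_sigma_additive _ _ _ pm).
Qed.

HB.instance Definition _ := isMeasure.Build _ _ _ rvec_step
  step0 step_ge0 step_sigma_additive.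

Let step_sigma_finite : sigma_finite setT rvec_step.
Proof.
have [F FT Fk] := sigma_finiteT (prodm leb nu).
pose hd (v : vec m.+1) : RR * vec m := (v ord0 ord0, \row_j v ord0 (lift ord0 j)).
have mhd : measurable_fun setT hd.
  apply: measurable_fun_pair; first exact: measurable_coord.
  apply: measurable_rvecP => j.
  under eq_fun do rewrite mxE.
  exact: measurable_coord.
have cK p : hd (consv p) = p.
  by rewrite /hd consv0; case: p => x v; congr pair; apply/rowP => j; rewrite mxE consvS.
exists (fun k => hd @^-1` F k).
  rewrite -preimage_bigcup -FT preimage_setT//.
move=> k; split; first by rewrite -[X in measurable X]setTI; apply: mhd => //; case: (Fk k).
rewrite /rvec_step /pushforward -comp_preimage.
have -> : (hd \o @consv m) = id by apply/funext => p; rewrite /= cK.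
by case: (Fk k).
Qed.

HB.instance Definition _ := Measure_isSigmaFinite.Build _ _ _ rvec_step
  step_sigma_finite.

End step.

Definition rvec0 : {sigma_finite_measure set (vec 0) -> \bar R} :=
  dirac ((0 : 'rV[R]_0) : vec 0).

(** Lebesgue measure built along the recursion of [iint_m]: a point mass in dimension 0, then a
    push-forward of the product with the line. Iterated integrals thereby become integrals against a
    single sigma-finite measure. *)
Fixpoint rvec_measure m : {sigma_finite_measure set (vec m) -> \bar R} :=
  if m is m'.+1 then rvec_step (rvec_measure m') else rvec0.

Lemma rvec_measureS m (f : vec m.+1 -> \bar R) : measurable_fun setT f ->
  (forall v, 0 <= f v)%E ->
  (\int[rvec_measure m.+1]_v f v =
   \int[prodm leb (rvec_measure m)]_p f (consv p))%E.
Proof.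
move=> mf f0.
have := ge0_integral_pushforward (@measurable_consv m) (prodm leb (rvec_measure m))
  measurableT mf (fun v _ => f0 v).
by rewrite preimage_setT.
Qed.

Lemma integrable_rvecS m (f : vec m.+1 -> \bar R) :
  (rvec_measure m.+1).-integrable setT f ->
  (prodm leb (rvec_measure m)).-integrable setT (f \o @consv m).
Proof.
move=> /integrableP[mf fi]; apply/integrableP; split.
  exact: measurableT_comp mf (@measurable_consv m).
move: fi; rewrite rvec_measureS => [//| |v]; last exact: abse_ge0.
exact: measurableT_comp.
Qed.

Lemma integral_rvecS m (f : vec m.+1 -> \bar R) :
  (rvec_measure m.+1).-integrable setT f ->
  (\int[rvec_measure m.+1]_v f v =
   \int[prodm leb (rvec_measure m)]_p f (consv p))%E.
Proof.
move=> fi.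
have := @integral_pushforward _ _ _ _ _ _ (@measurable_consv m)
  (prodm leb (rvec_measure m)) setT _ (measurable_int _ fi).
by rewrite preimage_setT; apply => //; exact: integrable_rvecS.
Qed.

Lemma iint_ge0 m (f : vec m -> \bar R) : measurable_fun setT f ->
  (forall v, 0 <= f v)%E -> iint_m f = (\int[rvec_measure m]_v f v)%E.
Proof.
elim: m f => [|m IH] f mf f0.
  by rewrite /= integral_dirac//= diracT mul1e.
rewrite rvec_measureS// prodm_tonelli1//; last first.
  exact: measurableT_comp mf (@measurable_consv m).
apply: eq_integral => x _; apply: IH => //.
apply: measurableT_comp mf _.
exact: measurableT_comp (@measurable_consv m) (pair1_measurable x).
Qed.

(** Neither a sign nor integrability is assumed: the positive and negative parts are treated
    separately by Tonelli, so the conclusion holds even where section integrals are infinite. *)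
Lemma measurable_integral2 d1 d2 (X : measurableType d1) (Y : measurableType d2)
    (nu : {sigma_finite_measure set Y -> \bar R}) (f : X * Y -> \bar R) :
  measurable_fun setT f ->
  measurable_fun setT (fun x => \int[nu]_y f (x, y))%E.
Proof.
move=> mf.
have -> : (fun x => \int[nu]_y f (x, y))%E = (fun x =>
    (\int[nu]_y f^\+ (x, y)) - (\int[nu]_y f^\- (x, y)))%E.
  apply/funext => x; rewrite [LHS]integralE; congr (_ - _)%E;
    by apply: eq_integral => y _; rewrite ?funeposE ?funenegE.
by apply: emeasurable_funB; apply: measurable_fun_fubini_tonelli_F => //;
  [exact: measurable_funepos|exact: measurable_funeneg].
Qed.

(** The parameter space [X] is arbitrary so that the induction can move the first coordinate of the
    vector into it. *)
Lemma measurable_iint d (X : measurableType d) m (f : X * vec m -> \bar R) :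
  measurable_fun setT f -> measurable_fun setT (fun x => iint_m (fun y => f (x, y))).
Proof.
elim: m d X f => [|m IH] d X f mf /=.
  exact: measurableT_comp mf (pair2_measurable _).
apply: (@measurable_integral2 _ _ X RR leb
  (fun p => iint_m (fun y => f (p.1, row_mx p.2%:M y)))).
apply: (IH _ (X * RR)%type (fun q => f (q.1.1, consv (q.1.2, q.2)))).
apply: measurableT_comp mf _; apply: measurable_fun_pair.
  exact: (measurableT_comp measurable_fst measurable_fst).
apply: measurableT_comp (@measurable_consv m) _.
apply: measurable_fun_pair => //.
exact: (measurableT_comp measurable_snd measurable_fst).
Qed.

(** For signed functions only almost every section is integrable, so the induction hypothesis is
    available off a null set; [measurable_iint] is what allows the exceptional values of [iint_m] to
    be ignored there. *)
Lemma iint_integrable m (f : vec m -> \bar R) :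
  (rvec_measure m).-integrable setT f ->
  iint_m f = (\int[rvec_measure m]_v f v)%E.
Proof.
elim: m f => [|m IH] f fi.
  by rewrite /= integral_dirac//= ?diracT ?mul1e//; exact: measurable_int fi.
rewrite integral_rvecS// prodm_fubini1; last first.
  exact: integrable_rvecS.
have mfc : measurable_fun setT (f \o @consv m).
  by apply: measurable_int; exact: integrable_rvecS fi.
apply: ae_eq_integral => //.
- exact: (@measurable_iint _ RR m (f \o @consv m)).
- exact: (@measurable_integral2 _ _ RR _ _ (f \o @consv m)).
have := ae_integrable1 (m1 := leb) (m2 := rvec_measure m) (integrable_rvecS fi).
apply: filterS => x xi _; exact: IH.
Qed.

(** * Affine changes of variables and boxes *)

Section affine1.
Variables (s c : R).
Hypothesis s0 : 0 < s.

Let aff (x : RR) : RR := s * x + c.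

Lemma measurable_affine : measurable_fun setT aff.
Proof.
by apply: (@measurable_funD _ RR _ setT); [exact: measurable_funM|exact: measurable_cst].
Qed.

(** The scaled push-forward agrees with Lebesgue measure on half-open intervals, hence everywhere by
    uniqueness. *)
Lemma lebesgue_measure_affine (A : set RR) : measurable A ->
  leb A = (s%:E * leb (aff @^-1` A))%E.
Proof.
move=> mA.
pose pm : {measure set RR -> \bar R} :=
  measure_function_pushforward__canonical__measure_function_Measure leb measurable_affine.
pose sn : {nonneg R} := NngNum (ltW s0).
rewrite (@lebesgue_measure_unique R (mscale sn pm))//.
move=> _ [[a b] _ <-].
change (leb `]a, b]%classic = s%:E * leb (aff @^-1` `]a, b]%classic))%E.
have -> : aff @^-1` `]a, b]%classic = `](a - c) / s, (b - c) / s]%classic.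
  apply/seteqP; split => x /=; rewrite !in_itv/= ltr_pdivrMr// ler_pdivlMr// /aff;
    by rewrite ltrBlDr lerBrDr [x * s]mulrC.
rewrite !lebesgue_measure_itv/= !lte_fin ltr_pM2r ?invr_gt0// ltrD2r.
case: ifPn => ab; last by rewrite mule0.
by rewrite -!EFinB -EFinM; congr EFin; field; rewrite gt_eqF.
Qed.

Lemma ge0_integral_affine1 (f : RR -> \bar R) : measurable_fun setT f ->
  (forall x, 0 <= f x)%E ->
  (\int[leb]_x f x = s%:E * \int[leb]_x f ((s * x + c)%R : RR))%E.
Proof.
move=> mf f0.
pose pm : {measure set RR -> \bar R} :=
  measure_function_pushforward__canonical__measure_function_Measure leb measurable_affine.
pose sn : {nonneg R} := NngNum (ltW s0).
rewrite (@eq_measure_integral _ _ _ _ (mscale sn pm)); last first.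
  by move=> A mA _; exact: lebesgue_measure_affine.
rewrite (ge0_integral_mscale _ _ _ mf)//; congr (_ * _)%E.
have := ge0_integral_pushforward measurable_affine leb
  measurableT mf (fun v _ => f0 v).
by rewrite preimage_setT.
Qed.

End affine1.

Section affine.
Variable s : R.
Hypothesis s0 : 0 < s.

Lemma measurable_rvec_affine m (c : 'rV[R]_m) :
  measurable_fun [set: vec m] (fun v : vec m => (s *: (v : 'rV[R]_m) + c)%R : vec m).
Proof.
apply: measurable_rvecP => i.
under eq_fun do rewrite !mxE.
by apply: measurable_funD => //; apply: measurable_funM => //; exact: measurable_coord.
Qed.

Lemma ge0_integral_affine m (c : 'rV[R]_m) (f : vec m -> \bar R) :
  measurable_fun setT f -> (forall x, 0 <= f x)%E ->
  (\int[rvec_measure m]_x f x =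
   (s ^+ m)%:E * \int[rvec_measure m]_x f ((s *: (x : 'rV[R]_m) + c)%R : vec m))%E.
Proof.
elim: m c f => [|m IH] c f mf f0.
  rewrite expr0 mul1e /=; rewrite !integral_dirac//=.
    by rewrite !diracT !mul1e; congr f; apply/rowP => -[].
  exact: measurableT_comp mf (measurable_rvec_affine c).
have mfc : measurable_fun setT (f \o @consv m).
  exact: measurableT_comp mf (@measurable_consv m).
rewrite rvec_measureS// prodm_tonelli1//.
rewrite (@ge0_integral_affine1 _ (c ord0 ord0) s0); last 2 first.
- exact: (@measurable_integral2 _ _ RR _ _ (f \o @consv m)).
- by move=> x; apply: integral_ge0.
pose c' : 'rV[R]_m := \row_j c ord0 (lift ord0 j).
have mcc : measurable_fun [set: RR * vec m] (fun p : RR * vec m => f (consv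
    ((s * p.1 + c ord0 ord0)%R : RR, (s *: (p.2 : 'rV[R]_m) + c')%R : vec m))).
  apply: measurableT_comp mf _; apply: measurableT_comp (@measurable_consv m) _.
  apply: measurable_fun_pair.
    exact: (measurableT_comp (@measurable_affine s (c ord0 ord0)) measurable_fst).
  exact: (measurableT_comp (measurable_rvec_affine c') measurable_snd).
transitivity (s%:E * \int[leb]_x ((s ^+ m)%:E * \int[rvec_measure m]_y
    f (consv ((s * x + c ord0 ord0)%R : RR, (s *: (y : 'rV[R]_m) + c')%R : vec m))))%E.
  congr (_ * _)%E; apply: eq_integral => x _; apply: IH => //.
  by apply: measurableT_comp mfc _; exact: pair1_measurable.
rewrite ge0_integralZl//; last 3 first.
- exact: (@measurable_integral2 _ _ RR _ _ _ mcc).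
- by move=> x _; apply: integral_ge0.
- by rewrite lee_fin exprn_ge0// ltW.
rewrite rvec_measureS//; last exact: measurableT_comp mf (measurable_rvec_affine c).
rewrite prodm_tonelli1//; last first.
  apply: measurableT_comp (measurableT_comp mf (measurable_rvec_affine c)) _.
  exact: measurable_consv.
apply: (etrans (muleA _ _ _)); rewrite -EFinM -exprS.
apply: (congr1 (fun z => (s ^+ m.+1)%:E * z)%E).
apply: eq_integral => x _; apply: eq_integral => y _ /=; congr f.
apply/rowP => i; case: (unliftP ord0 i) => [j|] ->.
  by rewrite [RHS]mxE [X in _ = X + _]mxE !consvS !mxE.
by rewrite [RHS]mxE [X in _ = X + _]mxE !consv0.
Qed.

End affine.

Definition box m (a b : R) : set (vec m) :=
  [set v | forall j, a <= (v : 'rV[R]_m) ord0 j <= b].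

Lemma measurable_box m a b : measurable (@box m a b).
Proof.
have -> : @box m a b = \bigcap_(j in [set: 'I_m])
    [set v : vec m | `[a, b]%classic ((v : 'rV[R]_m) ord0 j)].
  apply/seteqP; split => [v bv j _ /=|v bv j]; first by rewrite in_itv/= bv.
  by have := bv j Logic.I; rewrite /= in_itv.
apply: fin_bigcap_measurable => // j _.
have := @measurable_coord m j measurableT `[a, b]%classic (measurable_itv _).
by rewrite setTI.
Qed.

Lemma rvec_measure_box m (a b : R) : a <= b ->
  rvec_measure m (@box m a b) = ((b - a) ^+ m)%:E.
Proof.
move=> ab; elim: m => [|m IH].
  rewrite expr0 /= diracE mem_set//.
  by move=> [].
rewrite exprS EFinM -IH.
have -> : rvec_measure m.+1 (@box m.+1 a b) =
  (leb \x rvec_measure m)%E (`[a, b]%classic `*` @box m a b).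
  rewrite /= /rvec_step /pushforward; congr (prodm _ _ _).
  apply/seteqP; split => [p bp|p [/= p1 p2] j].
    split => /=; first by have := bp ord0; rewrite consv0 in_itv.
    by move=> j; have := bp (lift ord0 j); rewrite consvS.
  case: (unliftP ord0 j) => [k|] ->; first by rewrite consvS.
  by move: p1; rewrite consv0 in_itv.
rewrite product_measure1E//; last exact: measurable_box.
congr (_ * _)%E; rewrite [LHS](lebesgue_measure_itv `[a, b])/= lte_fin.
by move: ab; rewrite le_eqVlt => /orP[/eqP ->|->]; rewrite ?ltxx ?subrr ?EFinB.
Qed.

Definition catv m n (p : vec m * vec n) : vec (m + n) :=
  row_mx (p.1 : 'rV[R]_m) (p.2 : 'rV[R]_n).

Lemma measurable_catv m n : measurable_fun setT (@catv m n).
Proof.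
apply: measurable_rvecP => i; rewrite /catv; case: (split_ordP i) => j ->.
  under eq_fun do rewrite row_mxEl.
  exact: (measurableT_comp (@measurable_coord _ j) measurable_fst).
under eq_fun do rewrite row_mxEr.
exact: (measurableT_comp (@measurable_coord _ j) measurable_snd).
Qed.

Lemma catv_consv m n (x : RR) (v : vec m) (w : vec n) :
  catv (consv (x, v), w) = consv (x, catv (v, w)) :> vec (m.+1 + n).
Proof.
rewrite /catv /consv /=.
have /= -> := @row_mxA R 1 1 m n (x : R)%:M v w.
by rewrite (castmx_id).
Qed.

(** Phase space has dimension [m + m]; this separates its time coordinates from its frequency
    coordinates. *)
Lemma integral_catv m n (f : vec (m + n) -> \bar R) : measurable_fun setT f ->
  (forall v, 0 <= f v)%E ->
  (\int[rvec_measure (m + n)]_v f v =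
   \int[rvec_measure m]_x \int[rvec_measure n]_y f (catv (x, y)))%E.
Proof.
elim: m f => [|m IH] f mf f0.
  rewrite [RHS]integral_dirac//=.
    rewrite diracT mul1e; apply: eq_integral => y _; congr f.
    rewrite /catv; apply/rowP => i; case: (split_ordP i) => [[]//|j ->].
    by rewrite row_mxEr; congr (fun_of_matrix y _ _); exact/val_inj.
  apply: (@measurable_integral2 _ _ _ _ _ (f \o @catv 0 n)).
  exact: measurableT_comp mf (@measurable_catv 0 n).
rewrite rvec_measureS//; last first.
- by move=> v; apply: integral_ge0.
- apply: (@measurable_integral2 _ _ _ _ _ (f \o @catv m.+1 n)).
  exact: measurableT_comp mf (@measurable_catv m.+1 n).
have mfc : measurable_fun setT (f \o @consv (m + n)).
  exact: measurableT_comp mf (@measurable_consv (m + n)).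
rewrite [LHS](rvec_measureS mf f0) !prodm_tonelli1//.
- apply: eq_integral => x _.
  have mfx : measurable_fun setT (fun v : vec (m + n) => f (consv (x, v))).
    exact: (measurableT_comp mfc (pair1_measurable x)).
  apply: (etrans (IH _ mfx (fun v => f0 _))).
  by apply: eq_integral => v _; apply: eq_integral => w _; rewrite catv_consv.
- apply: (@measurable_integral2 _ _ _ _ _
    (fun q : (RR * vec m) * vec n => f (catv (consv q.1, q.2)))).
  apply: measurableT_comp mf _; apply: measurableT_comp (@measurable_catv m.+1 n) _.
  apply: measurable_fun_pair => //.
  exact: (measurableT_comp (@measurable_consv m) measurable_fst).
- by move=> z; apply: integral_ge0.
Qed.

End vector_measure.

(** * Square-integrable functions and the Riesz representation *)

Section semi_inner_product.
Variables (R : realType) (V : lmodType R) (mem : V -> Prop) (b : V -> V -> R).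
Hypothesis memD : forall x y, mem x -> mem y -> mem (x + y).
Hypothesis memZ : forall c x, mem x -> mem (c *: x).
Hypothesis bC : forall x y, mem x -> mem y -> b x y = b y x.
Hypothesis bD : forall x y z, mem x -> mem y -> mem z -> b (x + y) z = b x z + b y z.
Hypothesis bZ : forall c x y, mem x -> mem y -> b (c *: x) y = c * b x y.
Hypothesis b0 : forall x, mem x -> 0 <= b x x.

Lemma sip_expand x y (t : R) : mem x -> mem y ->
  b (x + t *: y) (x + t *: y) = b x x + 2 * t * b x y + t ^+ 2 * b y y.
Proof.
move=> mx my; have mty : mem (t *: y) by exact: memZ.
have mxy : mem (x + t *: y) by exact: memD.
rewrite bD// (bC mx)// (bC mty)// !bD// !bZ// (bC mx mty) (bC my mty) !bZ//.
by rewrite (bC my mx); ring.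
Qed.

(** Nonnegativity of [b (x + t *: y) (x + t *: y)] as a quadratic in [t]. Functions equal almost
    everywhere are not identified, so the form may be degenerate and [b y y = 0] is a genuine
    case. *)
Lemma sip_cs x y : mem x -> mem y -> b x y ^+ 2 <= b x x * b y y.
Proof.
move=> mx my.
have q t : 0 <= b x x + 2 * t * b x y + t ^+ 2 * b y y.
  by rewrite -sip_expand//; apply: b0; apply: memD => //; exact: memZ.
have [by0|by0] := eqVneq (b y y) 0.
  rewrite by0 mulr0.
  have [->|bxy0] := eqVneq (b x y) 0; first by rewrite expr0n.
  (* When [b y y = 0] the quadratic is affine in [t], and this [t] gives it the value -1. *)
  have := q (- (b x x + 1) / (2 * b x y)).
  rewrite by0 mulr0 addr0.
  have -> : 2 * (- (b x x + 1) / (2 * b x y)) * b x y = - (b x x + 1) by field.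
  by rewrite opprD addrA subrr sub0r lerNr oppr0 ler10.
have byp : 0 < b y y by rewrite lt_neqAle eq_sym by0 b0.
have := q (- b x y / b y y).
have -> : b x x + 2 * (- b x y / b y y) * b x y + (- b x y / b y y) ^+ 2 * b y y
  = b x x - b x y ^+ 2 / b y y by field.
by rewrite subr_ge0 ler_pdivrMr.
Qed.

Lemma sip_cs_norm x y : mem x -> mem y ->
  `|b x y| <= Num.sqrt (b x x) * Num.sqrt (b y y).
Proof.
move=> mx my; rewrite -sqrtrM ?b0// -(@sqrtr_sqr _ (b x y)).
by apply: ler_wsqrtr; exact: sip_cs.
Qed.

Hypothesis bcomplete : forall u : nat -> V, (forall n, mem (u n)) ->
  (forall e, 0 < e -> exists N, forall m n, (N <= m)%N -> (N <= n)%N ->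
    b (u m - u n) (u m - u n) <= e) ->
  exists2 v, mem v & forall e, 0 < e -> exists N, forall n, (N <= n)%N ->
    b (u n - v) (u n - v) <= e.

Variables (L : V -> R) (C : R).
Hypothesis LD : forall x y, mem x -> mem y -> L (x + y) = L x + L y.
Hypothesis LZ : forall c x, mem x -> L (c *: x) = c * L x.
Hypothesis Lb : forall x, mem x -> L x ^+ 2 <= C * b x x.
Hypothesis mem0 : mem 0.

(* The Riesz vector minimizes [b x x - 2 * L x]; the parallelogram identity
   makes minimizing sequences Cauchy. *)
Lemma riesz_representation : exists2 v, mem v & forall x, mem x -> b v x = L x.
Proof.
have memB x y : mem x -> mem y -> mem (x - y).
  by move=> mx my; rewrite -scaleN1r; apply: memD => //; exact: memZ.
pose Q x := b x x - 2 * L x.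
have QE x y t : mem x -> mem y ->
    Q (x + t *: y) = Q x + 2 * t * (b x y - L y) + t ^+ 2 * b y y.
  move=> mx my; have mty := memZ t my.
  by rewrite /Q sip_expand// LD// LZ//; ring.
have Qlb x : mem x -> - `|C| <= Q x.
  move=> mx; have bx := b0 mx.
  have h1 : L x ^+ 2 <= `|C| * b x x.
    by apply: (le_trans (Lb mx)); apply: ler_wpM2r => //; exact: ler_norm.
  have h2 : 0 <= `|C| by [].
  (* Arithmetic-geometric mean: four times a product is at most the square of the sum. This is what
     bounds [Q] from below. *)
  have h : (2 * L x) ^+ 2 <= (b x x + `|C|) ^+ 2.
    by have := sqr_ge0 (b x x - `|C|); nra.
  have h3 : `|2 * L x| <= b x x + `|C|.
    by rewrite -(@ger0_norm _ (b x x + _)) ?addr_ge0// -ler_sqr ?nnegrE// !real_normK ?num_real.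
  by have := ler_norm (2 * L x); rewrite /Q; lra.
pose S := [set Q x | x in [set x | mem x]].
have S0 : has_inf S.
  split; first by exists (Q 0), 0.
  by exists (- `|C|) => _ [x mx <-]; exact: Qlb.
pose I := inf S.
have Ilb x : mem x -> I <= Q x.
  by move=> mx; apply: (ge_inf S0.2); exists x.
have pick n : exists x, mem x /\ Q x < I + n.+1%:R^-1.
  have [_ [x mx <-] xI] := @inf_adherent _ S n.+1%:R^-1 ltac:(by rewrite invr_gt0) S0.
  by exists x.
have [u uP] := choice pick.
have par x y : mem x -> mem y -> b (x - y) (x - y) <= 2 * Q x + 2 * Q y - 4 * I.
  move=> mx my; have mxy := memB _ _ mx my.
  have hy : y + 2^-1 *: (x - y) = y + 2^-1 *: (x - y) by [].
  have := Ilb (y + 2^-1 *: (x - y)) (memD my (memZ _ mxy)).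
  have := QE y (x - y) 1 my mxy; rewrite scale1r addrC subrK => ->.
  by rewrite QE//; lra.
have nat_small (e : R) : 0 < e -> exists N : nat, forall n, (N <= n)%N -> n.+1%:R^-1 <= e.
  move=> e0; exists (Num.truncn e^-1) => n Nn.
  rewrite invf_ple ?posrE//; apply/ltW/(lt_le_trans (truncnS_gt _)).
  by rewrite ler_nat ltnS.
have [||v mv vP] := @bcomplete u.
- by move=> n; case: (uP n).
- move=> e e0; have [N NP] := nat_small (e / 4) ltac:(by rewrite divr_gt0).
  exists N => m n Nm Nn; have [mm Qm] := uP m; have [mn Qn] := uP n.
  apply: (le_trans (par _ _ mm mn)).
  have Qm' : Q (u m) < I + e / 4 by apply: (lt_le_trans Qm); rewrite lerD2l NP.
  have Qn' : Q (u n) < I + e / 4 by apply: (lt_le_trans Qn); rewrite lerD2l NP.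
  by move: Qm' Qn'; lra.
exists v => //.
(* The infimum is attained at the limit: [Q (u n)] and [Q v] differ by terms that are linear or
   quadratic in [u n - v]. *)
have Qv : Q v <= I.
  apply/ler_addgt0Pr => e e0.
  (* As [K] is at least 1, its square dominates both [b v v] and the absolute value of [C]. With
     [d = e / (8 * K)] the two linear terms are at most [e / 8] each, and they occur with a factor
     2. *)
  pose K := b v v + `|C| + 1.
  have K0 : 0 < K by rewrite /K; have := b0 mv; have := normr_ge0 C; lra.
  have [N1 N1P] := nat_small (e / 2) ltac:(by rewrite divr_gt0).
  pose d := e / (8 * K).
  have d0 : 0 < d by rewrite divr_gt0// mulr_gt0.
  have [N2 N2P] := vP (d ^+ 2) ltac:(by rewrite exprn_gt0).
  pose n := maxn N1 N2.
  have [mn Qn] := uP n.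
  have Qn' : Q (u n) < I + e / 2.
    by apply: (lt_le_trans Qn); rewrite lerD2l N1P// leq_maxl.
  have nN2 := N2P n (leq_maxr _ _).
  set w := u n - v in nN2.
  have mw : mem w by exact: memB.
  have uE : u n = v + 1 *: w by rewrite scale1r addrC subrK.
  have := QE v w 1 mv mw; rewrite -uE => E.
  have bw := b0 mw.
  have csw := sip_cs mv mw.
  have Lw : L w ^+ 2 <= `|C| * b w w.
    by apply: (le_trans (Lb mw)); apply: ler_wpM2r => //; exact: ler_norm.
  have bv := b0 mv.
  have K1 : K <= K ^+ 2.
    by rewrite expr2 ler_peMr ?(ltW K0)// /K; have := normr_ge0 C; lra.
  have Kb : b v v <= K ^+ 2.
    by apply: (le_trans _ K1); rewrite /K; have := normr_ge0 C; lra.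
  have KC : `|C| <= K ^+ 2 by apply: (le_trans _ K1); rewrite /K; lra.
  have h (z : R) : z ^+ 2 <= K ^+ 2 * d ^+ 2 -> `|z| <= K * d.
    move=> hz; have Kd0 : 0 <= K * d by rewrite mulr_ge0 ?ltW.
    by rewrite -ler_sqr ?nnegrE// real_normK ?num_real// exprMn.
  have h1 : `|b v w| <= K * d.
    apply: h; apply: (le_trans csw); apply: ler_pM => //.
  have h2 : `|L w| <= K * d.
    apply: h; apply: (le_trans Lw); apply: ler_pM => //.
  have Kd : K * d = e / 8 by rewrite /d; field; rewrite gt_eqF.
  move: h1 h2; rewrite Kd => /ler_normlP[h1 h1'] /ler_normlP[h2 h2'].
  by lra.
move=> x mx.
pose beta := b v x - L x; pose ga := b x x.
have pos t : 0 <= 2 * t * beta + t ^+ 2 * ga.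
  have := Ilb (v + t *: x) (memD mv (memZ t mx)).
  by rewrite QE// -/beta -/ga; lra.
have ga0 : 0 <= ga by exact: b0.
suff : beta = 0 by move/eqP; rewrite subr_eq0 => /eqP.
(* A step against the slope [beta]; the [+ 1] keeps the denominator positive when [ga] vanishes. The
   variation becomes a negative multiple of [beta ^+ 2], which minimality allows only for
   [beta = 0]. *)
have := pos (- beta / (ga + 1)).
have -> : 2 * (- beta / (ga + 1)) * beta + (- beta / (ga + 1)) ^+ 2 * ga
  = - (beta ^+ 2 * (ga + 2)) / (ga + 1) ^+ 2.
  by field; rewrite gt_eqF// ltr_wpDl.
rewrite mulNr oppr_ge0 pmulr_lle0 ?invr_gt0 ?exprn_gt0 ?ltr_wpDl//.
rewrite pmulr_lle0 ?ltr_wpDl// => h.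
by apply/eqP; rewrite -sqrf_eq0 eq_le h sqr_ge0.
Qed.

End semi_inner_product.

(** * Completeness of the square-integrable functions *)

Section square_integrable.
Context d (T : measurableType d) (R : realType).
Variable mu : {measure set T -> \bar R}.
Implicit Types f g h : T -> R.

Definition sqint f :=
  measurable_fun setT f /\ (\int[mu]_x (f x ^+ 2)%:E < +oo)%E.

Lemma sqr_int_ge0 f : (0 <= \int[mu]_x (f x ^+ 2)%:E)%E.
Proof. by apply: integral_ge0 => x _; rewrite lee_fin sqr_ge0. Qed.

Lemma measurable_sqrE f : measurable_fun setT f ->
  measurable_fun setT (fun x => (f x ^+ 2)%:E : \bar R).
Proof. by move=> mf; apply/measurable_EFinP; exact: measurable_funX. Qed.

Lemma sqint_le_integrable f g h : measurable_fun setT h -> sqint f -> sqint g ->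
  (forall x, `|h x| <= f x ^+ 2 + g x ^+ 2) -> mu.-integrable setT (EFin \o h).
Proof.
move=> mh [mf fi] [mg gi] hfg; apply/integrableP; split; first exact/measurable_EFinP.
apply: (@le_lt_trans _ _ (\int[mu]_x ((f x ^+ 2)%:E + (g x ^+ 2)%:E))%E).
  apply: ge0_le_integral => //.
  - by apply/measurable_EFinP; exact: measurableT_comp.
  - by apply: emeasurable_funD; exact: measurable_sqrE.
  - by move=> x _; rewrite -EFinD lee_fin.
rewrite ge0_integralD//; last 4 first.
- by move=> x _; rewrite lee_fin sqr_ge0.
- exact: measurable_sqrE.
- by move=> x _; rewrite lee_fin sqr_ge0.
- exact: measurable_sqrE.
by rewrite lte_add_pinfty.
Qed.

Lemma sqint_integrable f : sqint f -> mu.-integrable setT (fun x => (f x ^+ 2)%:E).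
Proof.
move=> sf; apply: (sqint_le_integrable (f := f) (g := f) (h := fun x => f x ^+ 2)) => //.
  by apply: measurable_funX; case: sf.
by move=> x; rewrite ger0_norm ?sqr_ge0// lerDl sqr_ge0.
Qed.

Lemma sqint_mul f g : sqint f -> sqint g ->
  mu.-integrable setT (EFin \o (fun x => f x * g x)).
Proof.
move=> sf sg; apply: (sqint_le_integrable _ sf sg).
  by apply: measurable_funM; [case: sf|case: sg].
move=> x; rewrite ler_norml; have := sqr_ge0 (f x + g x); have := sqr_ge0 (f x - g x).
by have := sqr_ge0 (f x); have := sqr_ge0 (g x); rewrite !sqrrB !sqrrD => ? ? ? ?; apply/andP; split; lra.
Qed.

Lemma sqintD f g : sqint f -> sqint g -> sqint (fun x => f x + g x).
Proof.
move=> sf sg; have mfg : measurable_fun setT (fun x => f x + g x).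
  by apply: measurable_funD; [case: sf|case: sg].
split => //.
have /integrableP[_] := sqint_integrable sf.
have /integrableP[_] := sqint_integrable sg => gi fi.
apply: (@le_lt_trans _ _ (\int[mu]_x (2%:E * (f x ^+ 2)%:E + 2%:E * (g x ^+ 2)%:E))%E).
  apply: ge0_le_integral => //.
  - by move=> x _; rewrite lee_fin sqr_ge0.
  - exact: measurable_sqrE.
  - apply: emeasurable_funD; apply: emeasurable_funM => //; apply: measurable_sqrE;
      by [case: sf|case: sg].
  - move=> x _; rewrite -!EFinM -EFinD lee_fin; have := sqr_ge0 (f x - g x).
    by rewrite sqrrB sqrrD; lra.
rewrite ge0_integralD//; last 4 first.
- by move=> x _; rewrite -EFinM lee_fin mulr_ge0 ?sqr_ge0.
- by apply: emeasurable_funM => //; apply: measurable_sqrE; case: sf.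
- by move=> x _; rewrite -EFinM lee_fin mulr_ge0 ?sqr_ge0.
- by apply: emeasurable_funM => //; apply: measurable_sqrE; case: sg.
rewrite !ge0_integralZl//; last 4 first.
- by apply: measurable_sqrE; case: sg.
- by move=> x _; rewrite lee_fin sqr_ge0.
- by apply: measurable_sqrE; case: sf.
- by move=> x _; rewrite lee_fin sqr_ge0.
by rewrite lte_add_pinfty// lte_mul_pinfty//; [case: sf|case: sg].
Qed.

Lemma sqintZ (c : R) f : sqint f -> sqint (fun x => c * f x).
Proof.
move=> [mf fi]; split; first exact: measurable_funM.
under eq_integral do rewrite exprMn EFinM.
rewrite ge0_integralZl ?lee_fin ?sqr_ge0//; first by rewrite lte_mul_pinfty ?lee_fin ?sqr_ge0.
- exact: measurable_sqrE.
- by move=> x _; rewrite lee_fin sqr_ge0.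
Qed.

Lemma sqintB f g : sqint f -> sqint g -> sqint (fun x => f x - g x).
Proof.
move=> sf sg; have := sqintD sf (sqintZ (-1) sg).
by congr sqint; apply/funext => x; rewrite mulN1r.
Qed.

Lemma sqint0 : sqint (fun _ => 0).
Proof.
split; first exact: measurable_cst.
under eq_integral do rewrite expr0n.
by rewrite integral0.
Qed.

Lemma limn_einf_le (u : (\bar R)^nat) (a : \bar R) N :
  (forall n, (N <= n)%N -> u n <= a)%E -> (limn_einf u <= a)%E.
Proof.
move=> ua; rewrite limn_einf_lim; apply: lime_le; first exact: is_cvg_einfs.
near=> n; apply: le_trans (ua n _); last by near: n; exists N.
by rewrite /einfs; apply: ereal_inf_lbound; exists n => /=.
Unshelve. all: by end_near. Qed.

Lemma sum_half_le n : \sum_(0 <= k < n) 2^-1 ^+ k <= 2 :> R.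
Proof.
suff -> : \sum_(0 <= k < n) 2^-1 ^+ k = 2 - 2 * 2^-1 ^+ n :> R.
  by rewrite gerBl mulr_ge0// exprn_ge0// invr_ge0.
elim: n => [|n IH]; first by rewrite big_geq// expr0 mulr1 subrr.
by rewrite big_nat_recr//= IH exprS; field.
Qed.

(* Rapidly Cauchy subsequences converge almost everywhere since
   [|a| <= 2^-k + 2^k a^2] bounds the sum of their increments. *)
Lemma sqint_complete (u : nat -> T -> R) : (forall n, sqint (u n)) ->
  (forall e : R, 0 < e -> exists N, forall m n, (N <= m)%N -> (N <= n)%N ->
     (\int[mu]_x ((u m x - u n x) ^+ 2)%:E <= e%:E)%E) ->
  exists2 v, sqint v & forall e : R, 0 < e -> exists N, forall n, (N <= n)%N ->
     (\int[mu]_x ((u n x - v x) ^+ 2)%:E <= e%:E)%E.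
Proof.
move=> su cu.
have pos8 k : 0 < (4 ^+ k)^-1 :> R by rewrite invr_gt0 exprn_gt0.
have [N0 N0P] := choice (fun k => cu ((4 ^+ k)^-1) (pos8 k)).
(* Partial sums of successors make [phi] increasing, at least [N0 k] and at least [k], so the
   increments [D k] have squared norm at most [4 ^- k]. *)
pose phi k := (\sum_(i < k.+1) (N0 i).+1)%N.
have phi_ge k : (N0 k <= phi k)%N by rewrite /phi big_ord_recr/= (leq_trans _ (leq_addl _ _)).
have phi_le k l : (k <= l)%N -> (phi k <= phi l)%N.
  move=> /subnK <-; elim: (l - k)%N => // i IH.
  by rewrite addSn (leq_trans IH)// /phi [in leqRHS]big_ord_recr leq_addr.
pose D k x := u (phi k.+1) x - u (phi k) x.
have sD k : sqint (D k) by exact: sqintB.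
have Dk k : (\int[mu]_x (D k x ^+ 2)%:E <= ((4 ^+ k)^-1)%:E)%E.
  by apply: N0P => //; apply: leq_trans (phi_ge k) _; apply: phi_le.
have mD k : measurable_fun setT (fun x => (2 ^+ k * D k x ^+ 2)%:E : \bar R).
  by apply/measurable_EFinP; apply: measurable_funM => //; apply: measurable_funX; case: (sD k).
have D0 k x : (0 <= (2 ^+ k * D k x ^+ 2)%:E)%E.
  by rewrite lee_fin mulr_ge0 ?sqr_ge0 ?exprn_ge0.
pose G x := (\sum_(k <oo) (2 ^+ k * D k x ^+ 2)%:E)%E.
have G0 x : (0 <= G x)%E by apply: nneseries_ge0.
(* The weight [2 ^+ k] against squared norms [4 ^- k] leaves a summable series, so [G] is integrable
   and finite almost everywhere, while it is still strong enough to dominate the sum of the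
   increments pointwise. *)
have mG : measurable_fun setT G by apply: ge0_emeasurable_sum.
have GI : (\int[mu]_x G x < +oo)%E.
  rewrite integral_nneseries//.
  apply: (@le_lt_trans _ _ (\sum_(k <oo) (2^-1 ^+ k)%:E)%E).
    apply: lee_nneseries => [k *|k *]; first by apply: integral_ge0 => *; exact: D0.
    under eq_integral do rewrite EFinM.
    have msD := measurable_sqrE (sD k).1.
    have sD0 x : setT x -> (0 <= (D k x ^+ 2)%:E)%E by rewrite lee_fin sqr_ge0.
    have k0 : (0 <= (2 ^+ k : R)%:E)%E by rewrite lee_fin exprn_ge0.
    rewrite (ge0_integralZl _ measurableT msD sD0 k0).
    apply: (@le_trans _ _ ((2 ^+ k)%:E * ((4 ^+ k)^-1)%:E)%E).
      by apply: lee_wpmul2l => //; rewrite lee_fin exprn_ge0.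
    rewrite -EFinM lee_fin -exprVn -exprMn.
    by rewrite (_ : 2 / 4 = 2^-1)//; field.
  apply: (@le_lt_trans _ _ 2%:E); last exact: ltry.
  apply: lime_le.
    by apply: is_cvg_nneseries => n *; rewrite lee_fin exprn_ge0// invr_ge0.
  apply: nearW => n; rewrite /= sumEFin lee_fin.
  exact: sum_half_le.
have Gfin : {ae mu, forall x, G x \is a fin_num}.
  have : mu.-integrable setT G.
    apply/integrableP; split => //.
    by under eq_integral do rewrite gee0_abs//.
  move/(integrable_ae measurableT); apply: filterS => x; exact.
pose A := [set x | G x \is a fin_num].
have mA : measurable A.
  by rewrite -[A]setTI; exact: emeasurable_fin_num.
(* Cutting off by the full-measure set [A] gives convergence at every point, so that the limit is
   measurable. *)
pose w k x := \1_A x * u (phi k) x.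
have cw x : cvgn (fun k => w k x).
  rewrite /w indicE; case: (boolP (x \in A)) => [|_]; last first.
    by rewrite (_ : (fun k => _) = cst 0); [exact: is_cvg_cst|apply/funext => k; rewrite mul0r].
  rewrite inE => Ax.
  have sc : cvgn (series (fun k => D k x)).
    apply: normed_cvg.
    apply: (@nondecreasing_is_cvgn R).
      by apply: nondecreasing_series => *; exact: normr_ge0.
    exists (fine (G x) + 2) => _ [n _ <-].
    rewrite /series/=.
    apply: (@le_trans _ _ (\sum_(0 <= k < n) (2 ^+ k * D k x ^+ 2 + 2^-1 ^+ k))).
      apply: ler_sum => k _.
      have p0 : 0 < 2 ^+ k :> R by rewrite exprn_gt0.
      rewrite exprVn; set q := 2 ^+ k in p0 *.
      have : 0 <= q * (`|D k x| - q^-1) ^+ 2 by rewrite mulr_ge0 ?sqr_ge0 ?ltW.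
      rewrite sqrrB mulrDr mulrBr real_normK ?num_real//.
      have -> : q * q^-1 ^+ 2 = q^-1 by field; rewrite gt_eqF.
      have -> : q * (`|D k x| * q^-1 *+ 2) = 2 * `|D k x| by field; rewrite gt_eqF.
      have : 0 <= q * D k x ^+ 2 by rewrite mulr_ge0 ?sqr_ge0 ?ltW.
      have : 0 < q^-1 by rewrite invr_gt0.
      lra.
    rewrite big_split/= lerD//.
      rewrite -lee_fin fineK// -sumEFin.
      by apply: nneseries_lim_ge.
    exact: sum_half_le.
  have -> : (fun k => 1 * u (phi k) x) =
      (fun k => series (fun k => D k x) k + u (phi 0%N) x).
    apply/funext => k; rewrite mul1r /series/=.
    by rewrite telescope_sumr// subrK.
  by apply: is_cvgD => //; exact: is_cvg_cst.
have mw k : measurable_fun setT (w k).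
  by apply: measurable_funM; [exact: measurable_indic|case: (su (phi k))].
pose v x := limn (fun k => w k x).
have mv : measurable_fun setT v.
  by apply: (@measurable_fun_cvg _ _ _ setT w) => // x _; exact: cw.
(* Fatou's lemma along the subsequence transfers the Cauchy bound to the limit. *)
have key e N n : (forall m n, (N <= m)%N -> (N <= n)%N ->
     (\int[mu]_x ((u m x - u n x) ^+ 2)%:E <= e%:E)%E) -> (N <= n)%N ->
    (\int[mu]_x ((u n x - v x) ^+ 2)%:E <= e%:E)%E.
  move=> hN Nn.
  have E : (\int[mu]_x ((u n x - v x) ^+ 2)%:E =
      \int[mu]_x limn_einf (fun k => ((u n x - w k x) ^+ 2)%:E))%E.
    apply: eq_integral => x _; apply/esym.
    apply: (cvg_limn_einf_sup _).1.
    have wv : w k x @[k --> \oo] --> v x by exact: cw.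
    apply: cvg_EFin; first exact: nearW.
    have : u n x - w k x @[k --> \oo] --> u n x - v x.
      by apply: cvgB => //; exact: cvg_cst.
    by move=> h; rewrite expr2; exact: (cvgM h h).
  rewrite E; apply: (le_trans (fatou mu measurableT _ _)).
  - move=> k; apply: measurable_sqrE; apply: measurable_funB => //.
    by case: (su n).
  - by move=> k x _; rewrite lee_fin sqr_ge0.
  have [K KP] : exists K, forall k, (K <= k)%N -> (N <= phi k)%N.
    exists N => k Nk; apply: (leq_trans Nk).
    rewrite /phi -[X in (X <= _)%N]card_ord -sum1_card big_ord_recr /=.
    by apply: leq_trans (leq_addr _ _); apply: leq_sum.
  apply: (@limn_einf_le _ _ K) => k Kk.
  rewrite (@ge0_ae_eq_integral _ _ _ mu setT _ (fun x => ((u n x - u (phi k) x) ^+ 2)%:E))//.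
  - exact: hN (KP _ Kk).
  - by apply: measurable_sqrE; apply: measurable_funB => //; case: (su n).
  - by apply: measurable_sqrE; apply: measurable_funB => //; [case: (su n)|case: (su (phi k))].
  - by move=> x _; rewrite lee_fin sqr_ge0.
  - by move=> x _; rewrite lee_fin sqr_ge0.
  move: Gfin; apply: filterS => x Gx _.
  by rewrite /w indicE mem_set// mul1r.
have vN e : 0 < e -> exists N, forall n, (N <= n)%N ->
     (\int[mu]_x ((u n x - v x) ^+ 2)%:E <= e%:E)%E.
  by move=> e0; have [N NP] := cu e e0; exists N => n; exact: key NP.
exists v => //.
have [N NP] := vN 1 ltr01.
have s1 : sqint (fun x => u N x - v x).
  split; first by apply: measurable_funB => //; case: (su N).
  by apply: (le_lt_trans (NP N (leqnn N))); exact: ltry.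
(* Square integrability of [v] is read off from [v = u N - (u N - v)]. *)
have := sqintB (su N) s1.
by congr sqint; apply/funext => x; rewrite subKr.
Qed.
End square_integrable.

(** * Canonical dual frames *)

Section hilbert_frame.
Variables (R : realType) (V : lmodType R) (mem : V -> Prop).
Variables (ip : V -> V -> cplx R) (J : V -> V).
Local Notation re x y := (ip x y).1.
Local Notation im x y := (ip x y).2.
Local Notation cnt := (@counting nat R).

(* [J] is multiplication by the imaginary unit. *)
Record complex_hilbert : Prop := ComplexHilbert {
  ch_mem0 : mem 0;
  ch_memD : forall x y, mem x -> mem y -> mem (x + y);
  ch_memZ : forall c x, mem x -> mem (c *: x);
  ch_memJ : forall x, mem x -> mem (J x);
  ch_reD : forall x y z, mem x -> mem y -> mem z -> re (x + y) z = re x z + re y z;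
  ch_reZ : forall c x y, mem x -> mem y -> re (c *: x) y = c * re x y;
  ch_imD : forall x y z, mem x -> mem y -> mem z -> im (x + y) z = im x z + im y z;
  ch_imZ : forall c x y, mem x -> mem y -> im (c *: x) y = c * im x y;
  ch_reC : forall x y, mem x -> mem y -> re x y = re y x;
  ch_imC : forall x y, mem x -> mem y -> im x y = - im y x;
  ch_reJ : forall x y, mem x -> mem y -> re (J x) y = - im x y;
  ch_imJ : forall x y, mem x -> mem y -> im (J x) y = re x y;
  ch_re0 : forall x, mem x -> 0 <= re x x;
  ch_complete : forall u : nat -> V, (forall n, mem (u n)) ->
    (forall e, 0 < e -> exists N, forall m n, (N <= m)%N -> (N <= n)%N ->
      re (u m - u n) (u m - u n) <= e) ->
    exists2 v, mem v & forall e, 0 < e -> exists N, forall n, (N <= n)%N ->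
      re (u n - v) (u n - v) <= e }.

Hypothesis H : complex_hilbert.

Lemma ch_memB x y : mem x -> mem y -> mem (x - y).
Proof.
move=> mx my; rewrite -scaleN1r; apply: (ch_memD H) => //; exact: (ch_memZ H).
Qed.

Lemma ch_re_cs x y : mem x -> mem y -> re x y ^+ 2 <= re x x * re y y.
Proof.
apply: (sip_cs (b := fun x y => re x y) (ch_memD H) (ch_memZ H) (ch_reC H)
  (ch_reD H) (ch_reZ H) (ch_re0 H)).
Qed.

Lemma ch_reJr x y : mem x -> mem y -> re x (J y) = im x y.
Proof.
move=> mx my; have mJ := ch_memJ H my.
by rewrite (ch_reC H)// (ch_reJ H)// (ch_imC H)// opprK.
Qed.

Section nat_frame.
Variables (hs : nat -> V) (A B : R).
Hypothesis hm : forall n, mem (hs n).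
Hypothesis A0 : 0 < A.
Hypothesis frame_lb : forall f, mem f ->
  ((A * re f f)%:E <= \int[cnt]_n (cabs2 (ip f (hs n)))%:E)%E.
Hypothesis frame_ub : forall f, mem f ->
  (\int[cnt]_n (cabs2 (ip f (hs n)))%:E <= (B * re f f)%:E)%E.

Lemma nat_measurable (u : nat -> R) : measurable_fun setT u.
Proof. by []. Qed.

Lemma coef_sqint f : mem f -> sqint cnt (fun n => re f (hs n)) /\
  sqint cnt (fun n => im f (hs n)).
Proof.
move=> mf; split; split; try exact: nat_measurable;
  apply: le_lt_trans (le_lt_trans (frame_ub mf) (ltry _));
  apply: ge0_le_integral => //; try (by move=> n _; rewrite lee_fin ?sqr_ge0// addr_ge0 ?sqr_ge0);
  by move=> n _; rewrite lee_fin /cabs2 ?lerDl ?lerDr sqr_ge0.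
Qed.

(** The real part of [c] times the conjugate of [c']. *)
Definition cdot (c c' : cplx R) : R := c.1 * c'.1 + c.2 * c'.2.

(** This is [Re <S f, g>] for the frame operator [S]. Inverting [S] becomes a Riesz problem for this
    form, so no operator is ever constructed. *)
Definition frame_form f g : R :=
  \int[cnt]_n cdot (ip f (hs n)) (ip g (hs n)).

Lemma cdot_int f g : mem f -> mem g ->
  cnt.-integrable setT (EFin \o (fun n => cdot (ip f (hs n)) (ip g (hs n)))).
Proof.
move=> mf mg; have [f1 f2] := coef_sqint mf; have [g1 g2] := coef_sqint mg.
have := integrableD measurableT (sqint_mul f1 g1) (sqint_mul f2 g2).
by apply: eq_integrable => // n _.
Qed.

Lemma frame_formC f g : frame_form f g = frame_form g f.
Proof. by apply: eq_Rintegral => n _; rewrite /cdot mulrC [X in _ + X]mulrC. Qed.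

Lemma frame_formD f g k : mem f -> mem g -> mem k ->
  frame_form (f + g) k = frame_form f k + frame_form g k.
Proof.
move=> mf mg mk; rewrite /frame_form -RintegralD//; [|exact: cdot_int..].
by apply: eq_Rintegral => n _; rewrite /cdot (ch_reD H)// (ch_imD H)//; ring.
Qed.

Lemma frame_formZ c f k : mem f -> mem k ->
  frame_form (c *: f) k = c * frame_form f k.
Proof.
move=> mf mk; rewrite /frame_form -RintegralZl//; last exact: cdot_int.
by apply: eq_Rintegral => n _; rewrite /cdot (ch_reZ H)// (ch_imZ H)//; ring.
Qed.

Lemma frame_formJ f k : mem f -> mem k ->
  frame_form (J f) k = - frame_form f (J k).
Proof.
move=> mf mk; have mJf := ch_memJ H mf; have mJk := ch_memJ H mk.
rewrite -mulN1r -RintegralZl//; last exact: cdot_int.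
by apply: eq_Rintegral => n _; rewrite /cdot !(ch_reJ H)// !(ch_imJ H)//; ring.
Qed.

Lemma frame_formE f : mem f ->
  (frame_form f f)%:E = (\int[cnt]_n (cabs2 (ip f (hs n)))%:E)%E.
Proof.
move=> mf; rewrite /frame_form fineK; last exact/integrable_fin_num/cdot_int.
by apply: eq_integral => n _; rewrite /cdot /cabs2 !expr2.
Qed.

Lemma frame_form_lb f : mem f -> A * re f f <= frame_form f f.
Proof. by move=> mf; rewrite -lee_fin frame_formE// frame_lb. Qed.

Lemma frame_form_ub f : mem f -> frame_form f f <= B * re f f.
Proof. by move=> mf; rewrite -lee_fin frame_formE// frame_ub. Qed.

Lemma frame_form_ge0 f : mem f -> 0 <= frame_form f f.
Proof.
by move=> mf; apply: le_trans (frame_form_lb mf); rewrite mulr_ge0 ?(ltW A0)// (ch_re0 H).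
Qed.

(** The frame bounds make the form equivalent to the ambient norm, so completeness is inherited. *)
Lemma frame_form_complete (u : nat -> V) : (forall n, mem (u n)) ->
  (forall e, 0 < e -> exists N, forall m n, (N <= m)%N -> (N <= n)%N ->
    frame_form (u m - u n) (u m - u n) <= e) ->
  exists2 v, mem v & forall e, 0 < e -> exists N, forall n, (N <= n)%N ->
    frame_form (u n - v) (u n - v) <= e.
Proof.
move=> mu cu; have [|v mv vP] := @ch_complete H u mu.
  move=> e e0; have [N NP] := cu (A * e) (mulr_gt0 A0 e0).
  exists N => m n Nm Nn; rewrite -(ler_pM2l A0).
  by apply: le_trans (NP m n Nm Nn); apply: frame_form_lb; exact: ch_memB.
exists v => // e e0; pose K := `|B| + 1.
have K0 : 0 < K by rewrite ltr_wpDl.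
have [N NP] := vP (e / K) (divr_gt0 e0 K0); exists N => n Nn.
have mw := ch_memB (mu n) mv.
apply: (le_trans (frame_form_ub mw)).
apply: (@le_trans _ _ (K * re (u n - v) (u n - v))).
  apply: ler_wpM2r; first exact: (ch_re0 H).
  by rewrite /K; have := ler_norm B; lra.
by rewrite -ler_pdivlMl// mulrC NP.
Qed.

(** The Riesz representation is applied to the frame form in place of the inner product. The
    functional [re w x] is bounded for it with constant [re w w / A], by Cauchy-Schwarz and the
    lower frame bound. *)
Lemma frame_operator_onto w : mem w ->
  exists2 g, mem g & forall f, mem f -> frame_form g f = re w f.
Proof.
move=> mw.
have Lb x : mem x -> re w x ^+ 2 <= (re w w / A) * frame_form x x.
  move=> mx; apply: (le_trans (ch_re_cs mw mx)).
  rewrite -mulrA; apply: ler_wpM2l; first exact: (ch_re0 H).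
  by rewrite ler_pdivlMl// frame_form_lb.
apply: (@riesz_representation R V mem frame_form (ch_memD H) (ch_memZ H) _
  frame_formD frame_formZ frame_form_ge0 frame_form_complete (fun x => re w x)
  (re w w / A) _ _ Lb (ch_mem0 H)).
- by move=> x y _ _; exact: frame_formC.
- move=> x y mx my; have mxy := ch_memD H mx my.
  by rewrite (ch_reC H)// (ch_reD H)// ![re _ w](ch_reC H).
- move=> c x mx; have mcx := ch_memZ H c mx.
  by rewrite (ch_reC H)// (ch_reZ H)// [re _ w](ch_reC H).
Qed.

Variable Ds : nat -> V.
Hypothesis Dm : forall n, mem (Ds n).
Hypothesis dualD : forall n f, mem f -> frame_form (Ds n) f = re (hs n) f.

(** The vector [u] is [S^-1 f]: self-adjointness of the frame operator turns coefficients against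
    the dual into coefficients of [u] against the frame. Imaginary parts follow by testing against
    [J]. *)
Lemma dual_coef f : mem f -> exists u, [/\ mem u, frame_form u u = re f u &
  forall n, re f (Ds n) = re u (hs n) /\ im f (Ds n) = im u (hs n)].
Proof.
move=> mf; have [u mu uP] := frame_operator_onto mf.
have mJf := ch_memJ H mf; have mJu := ch_memJ H mu.
exists u; split => //; first exact: uP.
move=> n; have mD := Dm n; have mh := hm n; have mJD := ch_memJ H mD.
split; first by rewrite -uP// frame_formC dualD// (ch_reC H).
rewrite -ch_reJr// -uP// -[LHS]opprK -frame_formJ// frame_formC dualD//.
by rewrite (ch_reC H)// (ch_reJ H)// opprK.
Qed.

Lemma dual_reconstruct f : mem f ->
  \int[cnt]_n cdot (ip f (hs n)) (ip f (Ds n)) = re f f.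
Proof.
move=> mf; have [u [mu uu uP]] := dual_coef mf.
transitivity (frame_form f u).
  by apply: eq_Rintegral => n _; rewrite /cdot; have [-> ->] := uP n.
(* [dual_coef] does not export the equation that defines [u], so a second preimage of [f] is taken;
   both have the same frame coefficients. *)
have [u' mu' u'P] := frame_operator_onto mf.
have E n : ip u (hs n) = ip u' (hs n).
  have mh := hm n; have mD := Dm n.
  have [r1 r2] := uP n.
  apply: injective_projections.
    by rewrite -r1 -u'P// frame_formC dualD// (ch_reC H).
  have mJD := ch_memJ H mD; have mJu' := ch_memJ H mu'.
  rewrite -r2 -ch_reJr// -u'P// -[LHS]opprK -frame_formJ// frame_formC dualD//.
  by rewrite (ch_reC H)// (ch_reJ H)// opprK.
rewrite frame_formC -u'P//.
by apply: eq_Rintegral => n _; rewrite E.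
Qed.

(** With [u = S^-1 f] the sum equals [a = <S u, u> = Re <f, u>]. Cauchy-Schwarz bounds [a ^+ 2] by
    [|f|^2 |u|^2], and the lower frame bound gives [A |u|^2 <= a]; one factor [a] cancels. *)
Lemma dual_bessel f : mem f ->
  (\int[cnt]_n (cabs2 (ip f (Ds n)))%:E <= (re f f / A)%:E)%E.
Proof.
move=> mf; have [u [mu uu uP]] := dual_coef mf.
have -> : (\int[cnt]_n (cabs2 (ip f (Ds n)))%:E = (frame_form u u)%:E)%E.
  rewrite frame_formE//; apply: eq_integral => n _.
  by rewrite /cabs2; have [-> ->] := uP n.
rewrite lee_fin; set a := frame_form u u.
have a0 : 0 <= a by exact: frame_form_ge0.
have h1 : a ^+ 2 <= re f f * re u u by rewrite /a uu; exact: ch_re_cs.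
have h2 : A * re u u <= a by exact: frame_form_lb.
have f0 := ch_re0 H mf.
rewrite ler_pdivlMr//.
have [->|an0] := eqVneq a 0; first by rewrite mul0r.
have ap : 0 < a by rewrite lt_neqAle eq_sym an0.
rewrite -(ler_pM2l ap).
have := ler_wpM2l (ltW A0) h1; have := ler_wpM2l f0 h2; rewrite expr2; lra.
Qed.

(** The diagonal term [x] equals [<S D, D>] for the dual vector [D], which is the sum of all squared
    coefficients of [D]. The n-th of these alone is at least [x ^+ 2], so [x ^+ 2 <= x]. *)
Lemma dual_diag_bounds n : 0 <= re (hs n) (Ds n) <= 1.
Proof.
have mD := Dm n; have mh := hm n.
rewrite -dualD//; set x := frame_form _ _.
have x0 : 0 <= x by exact: frame_form_ge0.
have : ((cabs2 (ip (Ds n) (hs n)))%:E <= x%:E)%E.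
  rewrite frame_formE// ge0_integral_count; last first.
    by move=> k; rewrite lee_fin addr_ge0 ?sqr_ge0.
  rewrite nneseries_esumT; last by move=> k; rewrite lee_fin addr_ge0 ?sqr_ge0.
  by apply: esum_ge; exists [set n]; rewrite ?fsbig_set1.
rewrite lee_fin /cabs2 => h.
have xE : re (Ds n) (hs n) = x by rewrite /x dualD// (ch_reC H).
move: h; rewrite xE => h; have := sqr_ge0 (im (Ds n) (hs n)) => h'.
by rewrite x0 /=; nra.
Qed.

(** The lower frame bound applied to the dual vector, whose frame form is a diagonal term and hence
    at most 1. *)
Lemma dual_norm n : re (Ds n) (Ds n) <= A^-1.
Proof.
have := dual_diag_bounds n; rewrite -dualD// => /andP[_ h].
by rewrite -[A^-1]mul1r ler_pdivlMr// mulrC (le_trans (frame_form_lb _)).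
Qed.

End nat_frame.
End hilbert_frame.

(** * Sums over countable types as integrals over the naturals *)

Section countable_sums.
Variables (R : realType) (I : countType).
Local Notation cnt := (@counting nat R).

(** A family carried to the naturals along [pickle], with a default off its image. For frames the
    default is the zero vector, which contributes nothing to any frame sum. *)
Definition nat_ext (X : Type) (x0 : X) (u : I -> X) (n : nat) : X :=
  oapp u x0 (pickle_inv n).

Lemma nat_ext_pickle (X : Type) (x0 : X) (u : I -> X) i :
  nat_ext x0 u (pickle i) = u i.
Proof. by rewrite /nat_ext pickleK_inv. Qed.

Lemma nat_ext_None (X : Type) (x0 : X) (u : I -> X) n :
  ~ (exists i : I, pickle i = n) -> nat_ext x0 u n = x0.
Proof.
rewrite /nat_ext; have := @pickle_invK I n.
by case: (pickle_inv n) => //= i e []; exists i.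
Qed.

Lemma esum_nat (u : I -> \bar R) : (forall i, 0 <= u i)%E ->
  (\esum_(i in [set: I]) u i = \int[cnt]_n nat_ext 0 u n)%E.
Proof.
move=> u0; have e0 n : (0 <= nat_ext 0 u n)%E.
  by rewrite /nat_ext; case: (pickle_inv n) => /=.
rewrite ge0_integral_count// nneseries_esumT//.
transitivity (\esum_(j in pickle @` [set: I]) nat_ext 0%E u j)%E.
  rewrite esum_image; last by move=> x y _ _; exact: (pcan_inj pickleK).
  by apply: eq_esum => i _; rewrite nat_ext_pickle.
rewrite esum_mkcond; apply: eq_esum => n _.
case: ifPn => //; rewrite notin_setE => h.
by rewrite nat_ext_None// => -[i e]; apply: h; exists i.
Qed.

Lemma rsum_abs_nat (u : I -> R) : rsum_abs u =
  fine (\int[cnt]_n (Num.max (nat_ext 0 u n) 0)%:E)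
  - fine (\int[cnt]_n (Num.max (- nat_ext 0 u n) 0)%:E).
Proof.
rewrite /rsum_abs !esum_nat//; last 2 first.
- by move=> i; rewrite lee_fin le_max lexx orbT.
- by move=> i; rewrite lee_fin le_max lexx orbT.
by congr (fine _ - fine _); apply: eq_integral => n _;
  rewrite /nat_ext; case: (pickle_inv n) => //=; rewrite ?oppr0 maxxx.
Qed.

Lemma rsum_absE (u : I -> R) :
  cnt.-integrable setT (EFin \o nat_ext 0 u) -> rsum_abs u = \int[cnt]_n nat_ext 0 u n.
Proof.
move=> ui; rewrite rsum_abs_nat /Rintegral [in RHS]integralE [RHS]fineB; last 2 first.
- exact: (integrable_pos_fin_num measurableT ui).
- exact: (integrable_neg_fin_num measurableT ui).
congr (fine _ - fine _); apply: eq_integral => n _.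
  by rewrite /= funeposE EFin_max.
by rewrite /= funenegE EFin_max.
Qed.

End countable_sums.

Section canonical_dual.
Variables (R : realType) (V : lmodType R) (mem : V -> Prop).
Variables (ip : V -> V -> cplx R) (J : V -> V).
Hypothesis H : complex_hilbert mem ip J.
Variables (I : countType) (h : I -> V) (v0 : V).
Hypothesis hframe : is_frame mem ip h.
Local Notation cnt := (@counting nat R).
Local Notation re x y := (ip x y).1.
Local Notation im x y := (ip x y).2.
Local Notation hs := (nat_ext 0 h).

Lemma ch_ipr0 f : mem f -> ip f 0 = 0.
Proof.
move=> mf; have m0 := ch_mem0 H.
have re0 : re 0 f = 0 by have := ch_reZ H 0 m0 mf; rewrite scale0r mul0r.
have im0 : im 0 f = 0 by have := ch_imZ H 0 m0 mf; rewrite scale0r mul0r.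
by apply: injective_projections; rewrite /= ?(ch_reC H mf m0) ?(ch_imC H mf m0)// ?re0 ?im0 ?oppr0.
Qed.

Lemma mem_nat_ext n : mem (hs n).
Proof.
rewrite /nat_ext; case: (pickle_inv n) => [i|] /=; last exact: (ch_mem0 H).
by case: hframe.
Qed.

Lemma ip_nat_ext f n : mem f -> ip f (hs n) = nat_ext 0 (fun i => ip f (h i)) n.
Proof.
by move=> mf; rewrite /nat_ext; case: (pickle_inv n) => //=; rewrite ch_ipr0.
Qed.

Lemma nat_frame_bounds : exists A B : R, [/\ 0 < A,
  forall f, mem f -> ((A * re f f)%:E <= \int[cnt]_n (cabs2 (ip f (hs n)))%:E)%E &
  forall f, mem f -> (\int[cnt]_n (cabs2 (ip f (hs n)))%:E <= (B * re f f)%:E)%E].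
Proof.
have [_ [A [B [A0 AB hAB]]]] := hframe.
have E f : mem f -> (\int[cnt]_n (cabs2 (ip f (hs n)))%:E =
    \esum_(i in [set: I]) (cabs2 (ip f (h i)))%:E)%E.
  move=> mf; rewrite esum_nat; last by move=> i; rewrite lee_fin addr_ge0 ?sqr_ge0.
  apply: eq_integral => n _; rewrite ip_nat_ext//.
  rewrite /nat_ext; case: (pickle_inv n) => //=.
  by rewrite /cabs2 expr0n addr0.
by exists A, B; split => // f mf; have /andP[] := hAB f mf; rewrite E.
Qed.

(** Identifies the absolutely convergent sum in [frame_op_maps] with [<S g, f>]; its imaginary part
    is the real part after [f] is replaced by [J f]. *)
Lemma frame_opE g f : mem g -> mem f ->
  csum_abs (fun j => cmul (ip g (h j)) (ip (h j) f)) =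
  (frame_form ip hs g f, frame_form ip hs g (J f)).
Proof.
have [A [B [A0 lb ub]]] := nat_frame_bounds.
move=> mg mf; have mJf := ch_memJ H mf.
have E k : mem k -> (fun n => cdot (ip g (hs n)) (ip k (hs n))) =
    nat_ext 0 (fun j => cdot (ip g (h j)) (ip k (h j))).
  move=> mk; apply/funext => n; rewrite !ip_nat_ext// /nat_ext.
  by case: (pickle_inv n) => //=; rewrite /cdot mulr0 addr0.
have hm j : mem (h j) by case: hframe.
have I1 := cdot_int ub mg mf.
have I2 := cdot_int ub mg mJf.
rewrite /csum_abs /frame_form !E//; congr pair.
  rewrite -rsum_absE -?E//; congr rsum_abs; apply/funext => j.
  by rewrite /cmul /cdot /= (ch_reC H (hm j) mf) (ch_imC H (hm j) mf); ring.
rewrite -rsum_absE -?E//; congr rsum_abs; apply/funext => j.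
rewrite /cmul /cdot /= (ch_reC H (hm j) mf) (ch_imC H (hm j) mf).
by rewrite (ch_reJ H mf (hm j)) (ch_imJ H mf (hm j)); ring.
Qed.

(** Existence comes from the surjectivity of the frame operator, which is what [epsilon] needs. The
    form being degenerate, the chosen vector is determined only up to null functions, so the weak
    equation is all that is retained. *)
Lemma can_dual_spec i : mem (can_dual mem ip v0 h i) /\
  forall f, mem f -> frame_form ip hs (can_dual mem ip v0 h i) f = re (h i) f.
Proof.
have [A [B [A0 lb ub]]] := nat_frame_bounds.
have hm j : mem (h j) by case: hframe.
have [g mg gP] := frame_operator_onto H mem_nat_ext A0 lb ub (hm i).
have ex : exists g, mem g /\ frame_op_maps mem ip h g (h i).
  exists g; split => // f mf; have mJf := ch_memJ H mf.
  rewrite frame_opE// !gP//; apply: injective_projections => //=.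
  by rewrite (ch_reJr H).
have [mD DP] := ClassicalEpsilon.epsilon_spec (inhabits v0) _ ex.
split => // f mf; have := DP f mf; rewrite frame_opE// => /(congr1 fst) /= <-.
by [].
Qed.

End canonical_dual.

(** * The Hilbert space structure of L2 and of its direct sums *)

Section L2_hilbert.
Variables (R : realType) (m : nat).
Notation vec := (rvec R m).
Notation mu := (rvec_measure R m).
Implicit Types f g : CFun R m.

Definition rpart f : vec -> R := fun x => (f x).1.
Definition ipart f : vec -> R := fun x => (f x).2.

Lemma rmeasurableP (u : vec -> R) : rmeasurable u <-> measurable_fun setT u.
Proof.
split=> h; first by move=> _ B mB; rewrite setTI; exact: h.
by move=> B mB; have := h measurableT B mB; rewrite setTI.
Qed.

Lemma L2cP f : L2c f <-> sqint mu (rpart f) /\ sqint mu (ipart f).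
Proof.
have E : measurable_fun setT (rpart f) -> measurable_fun setT (ipart f) ->
    iint_m (fun x => (cabs2 (f x))%:E) =
    (\int[mu]_x (rpart f x ^+ 2)%:E + \int[mu]_x (ipart f x ^+ 2)%:E)%E.
  move=> m1 m2; rewrite -ge0_integralD//; last 4 first.
  - by move=> x _; rewrite lee_fin sqr_ge0.
  - exact: measurable_sqrE.
  - by move=> x _; rewrite lee_fin sqr_ge0.
  - exact: measurable_sqrE.
  apply: iint_ge0; last by move=> x; rewrite lee_fin addr_ge0 ?sqr_ge0.
  by apply/measurable_EFinP; apply: measurable_funD; exact: measurable_funX.
split=> [[/rmeasurableP m1 /rmeasurableP m2]|[[m1 i1] [m2 i2]]].
  rewrite E// => h; split; split => //; apply: le_lt_trans h.
    by rewrite leeDl// sqr_int_ge0.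
  by rewrite leeDr// sqr_int_ge0.
by split; [exact/rmeasurableP|exact/rmeasurableP|rewrite E// lte_add_pinfty].
Qed.

Lemma Rint_integrable (u : vec -> R) : mu.-integrable setT (EFin \o u) ->
  Defs.Rint u = \int[mu]_x u x.
Proof. by move=> ui; rewrite /Defs.Rint iint_integrable. Qed.

Lemma integrable_linc (u v : vec -> R) (c : R) :
  mu.-integrable setT (EFin \o u) -> mu.-integrable setT (EFin \o v) ->
  mu.-integrable setT (EFin \o (fun x => u x + c * v x)).
Proof.
move=> ui vi; have := integrableD measurableT ui (integrableZl measurableT c vi).
by apply: eq_integrable => // x _.
Qed.

Lemma ipL2_re f g : L2c f -> L2c g -> (ipL2 f g).1 =
  \int[mu]_x (rpart f x * rpart g x) + \int[mu]_x (ipart f x * ipart g x).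
Proof.
move=> /L2cP[f1 f2] /L2cP[g1 g2].
rewrite -RintegralD//; [|exact: sqint_mul..].
rewrite /ipL2 /= -Rint_integrable.
  by congr Defs.Rint; apply/funext => x; rewrite /= mulrN opprK.
have := integrable_linc 1 (sqint_mul f1 g1) (sqint_mul f2 g2).
by apply: eq_integrable => // x _ /=; rewrite mul1r.
Qed.

Lemma ipL2_im f g : L2c f -> L2c g -> (ipL2 f g).2 =
  \int[mu]_x (ipart f x * rpart g x) - \int[mu]_x (rpart f x * ipart g x).
Proof.
move=> /L2cP[f1 f2] /L2cP[g1 g2].
rewrite -RintegralB//; [|exact: sqint_mul..].
rewrite /ipL2 /= -Rint_integrable.
  by congr Defs.Rint; apply/funext => x; rewrite /= mulrN addrC.
have := integrable_linc (-1) (sqint_mul f2 g1) (sqint_mul f1 g2).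
by apply: eq_integrable => // x _ /=; rewrite mulN1r.
Qed.

Definition cfunJ f : CFun R m := fun x => (- (f x).2, (f x).1).

Lemma L2c0 : L2c (0 : CFun R m).
Proof. by apply/L2cP; split; exact: sqint0. Qed.

Lemma L2cD f g : L2c f -> L2c g -> L2c (f + g : CFun R m).
Proof. by move=> /L2cP[f1 f2] /L2cP[g1 g2]; apply/L2cP; split; exact: sqintD. Qed.

Lemma L2cZ (c : R) f : L2c f -> L2c (c *: f : CFun R m).
Proof. by move=> /L2cP[f1 f2]; apply/L2cP; split; exact: sqintZ. Qed.

Lemma L2cJ f : L2c f -> L2c (cfunJ f).
Proof.
move=> /L2cP[f1 f2]; apply/L2cP; split => //.
have := sqintZ (-1) f2; congr sqint.
by apply/funext => x; rewrite mulN1r.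
Qed.

Let intD (u v w : vec -> R) : sqint mu u -> sqint mu v -> sqint mu w ->
  \int[mu]_x ((u x + v x) * w x) = \int[mu]_x (u x * w x) + \int[mu]_x (v x * w x).
Proof.
move=> su sv sw; rewrite -RintegralD//; [|exact: sqint_mul..].
by apply: eq_Rintegral => x _; rewrite mulrDl.
Qed.

Let intZ (c : R) (u w : vec -> R) : sqint mu u -> sqint mu w ->
  \int[mu]_x ((c * u x) * w x) = c * \int[mu]_x (u x * w x).
Proof.
move=> su sw; rewrite -RintegralZl//; last exact: sqint_mul.
by apply: eq_Rintegral => x _; rewrite mulrA.
Qed.

Let intC (u w : vec -> R) :
  \int[mu]_x (u x * w x) = \int[mu]_x (w x * u x).
Proof. by apply: eq_Rintegral => x _; rewrite mulrC. Qed.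

Lemma ipL2_reD f g h : L2c f -> L2c g -> L2c h ->
  (ipL2 (f + g : CFun R m) h).1 = (ipL2 f h).1 + (ipL2 g h).1.
Proof.
move=> Lf Lg Lh; rewrite !ipL2_re//; last exact: L2cD.
have /L2cP[f1 f2] := Lf; have /L2cP[g1 g2] := Lg; have /L2cP[h1 h2] := Lh.
by rewrite [X in X + _](intD f1 g1 h1) [X in _ + X](intD f2 g2 h2); ring.
Qed.

Lemma ipL2_imD f g h : L2c f -> L2c g -> L2c h ->
  (ipL2 (f + g : CFun R m) h).2 = (ipL2 f h).2 + (ipL2 g h).2.
Proof.
move=> Lf Lg Lh; rewrite !ipL2_im//; last exact: L2cD.
have /L2cP[f1 f2] := Lf; have /L2cP[g1 g2] := Lg; have /L2cP[h1 h2] := Lh.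
by rewrite [X in X - _](intD f2 g2 h1) [X in _ - X](intD f1 g1 h2); ring.
Qed.

Lemma ipL2_reZ (c : R) f h : L2c f -> L2c h ->
  (ipL2 (c *: f : CFun R m) h).1 = c * (ipL2 f h).1.
Proof.
move=> Lf Lh; rewrite !ipL2_re//; last exact: L2cZ.
have /L2cP[f1 f2] := Lf; have /L2cP[h1 h2] := Lh.
by rewrite [X in X + _](intZ c f1 h1) [X in _ + X](intZ c f2 h2); ring.
Qed.

Lemma ipL2_imZ (c : R) f h : L2c f -> L2c h ->
  (ipL2 (c *: f : CFun R m) h).2 = c * (ipL2 f h).2.
Proof.
move=> Lf Lh; rewrite !ipL2_im//; last exact: L2cZ.
have /L2cP[f1 f2] := Lf; have /L2cP[h1 h2] := Lh.
by rewrite [X in X - _](intZ c f2 h1) [X in _ - X](intZ c f1 h2); ring.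
Qed.

Lemma ipL2_reC f g : L2c f -> L2c g -> (ipL2 f g).1 = (ipL2 g f).1.
Proof. by move=> Lf Lg; rewrite !ipL2_re// intC [X in _ + X]intC. Qed.

Lemma ipL2_imC f g : L2c f -> L2c g -> (ipL2 f g).2 = - (ipL2 g f).2.
Proof.
by move=> Lf Lg; rewrite !ipL2_im// opprB intC [X in _ - X]intC.
Qed.

Lemma ipL2_reJ f g : L2c f -> L2c g -> (ipL2 (cfunJ f) g).1 = - (ipL2 f g).2.
Proof.
move=> Lf Lg; rewrite ipL2_re ?ipL2_im//; last exact: L2cJ.
have /L2cP[f1 f2] := Lf; have /L2cP[g1 g2] := Lg.
have := intZ (-1) f2 g1; rewrite mulN1r => E.
rewrite opprB addrC; congr (_ + _); rewrite -E.
by apply: eq_Rintegral => x _; rewrite mulN1r.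
Qed.

Lemma ipL2_imJ f g : L2c f -> L2c g -> (ipL2 (cfunJ f) g).2 = (ipL2 f g).1.
Proof.
move=> Lf Lg; rewrite ipL2_re ?ipL2_im//; last exact: L2cJ.
have /L2cP[f1 f2] := Lf; have /L2cP[g1 g2] := Lg.
have := intZ (-1) f2 g2; rewrite mulN1r => E.
congr (_ + _); rewrite -[RHS]opprK -E; congr (- _).
by apply: eq_Rintegral => x _; rewrite mulN1r.
Qed.

Lemma ipL2_sqr f : L2c f -> ((ipL2 f f).1)%:E =
  (\int[mu]_x (rpart f x ^+ 2)%:E + \int[mu]_x (ipart f x ^+ 2)%:E)%E.
Proof.
move=> Lf; rewrite ipL2_re//; have /L2cP[f1 f2] := Lf.
rewrite EFinD /Rintegral !fineK; last 2 first.
- exact/integrable_fin_num/sqint_mul.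
- exact/integrable_fin_num/sqint_mul.
by congr (_ + _)%E; apply: eq_integral => x _; rewrite expr2.
Qed.

Lemma ipL2_re_ge0 f : L2c f -> 0 <= (ipL2 f f).1.
Proof. by move=> Lf; rewrite -lee_fin ipL2_sqr// adde_ge0// sqr_int_ge0. Qed.

End L2_hilbert.

Section dsum_hilbert.
Variables (R : realType) (m d : nat).
Notation mu := (rvec_measure R m).
Notation V := ('I_d -> 'rV[R]_m -> R * R).

Definition dsumJ (F : V) : V := fun k => cfunJ (F k).

(** Each real or imaginary part of each summand is dominated by the total norm, so [sqint_complete]
    supplies the scalar limits separately. *)
Lemma dsum_complete (u : nat -> V) : (forall n, dsum_mem (u n)) ->
  (forall e, 0 < e -> exists N, forall i j, (N <= i)%N -> (N <= j)%N ->
    (dsum_ip (u i - u j) (u i - u j)).1 <= e) ->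
  exists2 v : V, dsum_mem v & forall e, 0 < e -> exists N, forall n, (N <= n)%N ->
    (dsum_ip (u n - v) (u n - v)).1 <= e.
Proof.
move=> mu_ cu.
have mB (F G : V) : dsum_mem F -> dsum_mem G -> dsum_mem (F - G).
  move=> mF mG k; have := L2cD (mF k) (L2cZ (-1) (mG k)).
  by congr L2c; rewrite scaleN1r.
pose comp (b : bool) (F : V) k : rvec R m -> R := if b then rpart (F k) else ipart (F k).
have scomp b F k : dsum_mem F -> sqint mu (comp b F k).
  by move=> mF; have /L2cP[] := mF k; case: b.
have ub b (F G : V) k : dsum_mem F -> dsum_mem G ->
    (\int[mu]_x ((comp b F k x - comp b G k x) ^+ 2)%:E <=
     ((dsum_ip (F - G) (F - G)).1)%:E)%E.
  move=> mF mG; have mFG := mB _ _ mF mG.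
  apply: (@le_trans _ _ ((ipL2 ((F - G) k) ((F - G) k)).1)%:E).
    rewrite ipL2_sqr//; case: b.
      by rewrite leeDl// sqr_int_ge0.
    by rewrite leeDr// sqr_int_ge0.
  rewrite lee_fin /dsum_ip /= (bigD1 k)//= lerDl.
  by apply: sumr_ge0 => i _; exact: (ipL2_re_ge0 (mFG i)).
have lim (p : bool * 'I_d) : exists v : rvec R m -> R, sqint mu v /\
    forall e : R, 0 < e -> exists N, forall n, (N <= n)%N ->
     (\int[mu]_x ((comp p.1 (u n) p.2 x - v x) ^+ 2)%:E <= e%:E)%E.
  have [|e e0|v sv vP] := @sqint_complete _ _ _ mu (fun n => comp p.1 (u n) p.2).
  - by move=> n; exact: scomp.
  - have [N NP] := cu e e0; exists N => i j Ni Nj.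
    by apply: le_trans (ub _ _ _ _ (mu_ i) (mu_ j)) _; rewrite lee_fin NP.
  - by exists v.
have [v vP] := choice lim.
pose w : V := fun k x => (v (true, k) x, v (false, k) x).
have mw : dsum_mem w.
  by move=> k; apply/L2cP; split; [exact: (vP (true, k)).1|exact: (vP (false, k)).1].
exists w => // e e0.
(* The [2 * d] scalar parts share [e]; [d.+1] keeps the denominator nonzero when [d] is 0. *)
pose e' := e / (2 * d.+1%:R).
have e'0 : 0 < e' by rewrite divr_gt0// mulr_gt0.
have [N NP] := choice (fun p => (vP p).2 e' e'0).
exists (\max_(p : bool * 'I_d) N p)%N => n Nn.
have Nle p : (N p <= n)%N by apply: leq_trans Nn; exact: leq_bigmax.
have mun := mB _ _ (mu_ n) mw.
rewrite /dsum_ip /=.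
apply: (@le_trans _ _ (\sum_(k < d) 2 * e')).
  apply: ler_sum => k _; rewrite -lee_fin (ipL2_sqr (mun k)).
  rewrite (_ : 2 * e' = e' + e'); last by ring.
  rewrite EFinD; apply: leeD.
    exact: (NP (true, k) n (Nle _)).
  exact: (NP (false, k) n (Nle _)).
rewrite sumr_const card_ord -[X in X <= _]mulr_natr /e'.
have -> : 2 * (e / (2 * d.+1%:R)) * d%:R = e * (d%:R / d.+1%:R) :> R.
  by field; rewrite ?pnatr_eq0.
by rewrite ler_piMr ?(ltW e0)// ler_pdivrMr// mul1r ler_nat.
Qed.

Lemma dsum_hilbert : complex_hilbert (@dsum_mem R m d) (@dsum_ip R m d) dsumJ.
Proof.
split.
- by move=> k; exact: L2c0.
- by move=> F G mF mG k; exact: L2cD.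
- by move=> c F mF k; exact: L2cZ.
- by move=> F mF k; exact: L2cJ.
- move=> F G K mF mG mK; rewrite /dsum_ip /= -big_split.
  by apply: eq_bigr => k _; exact: ipL2_reD.
- move=> c F K mF mK; rewrite /dsum_ip /= mulr_sumr.
  by apply: eq_bigr => k _; exact: ipL2_reZ.
- move=> F G K mF mG mK; rewrite /dsum_ip /= -big_split.
  by apply: eq_bigr => k _; exact: ipL2_imD.
- move=> c F K mF mK; rewrite /dsum_ip /= mulr_sumr.
  by apply: eq_bigr => k _; exact: ipL2_imZ.
- move=> F K mF mK; rewrite /dsum_ip /=.
  by apply: eq_bigr => k _; exact: ipL2_reC.
- move=> F K mF mK; rewrite /dsum_ip /= -sumrN.
  by apply: eq_bigr => k _; exact: ipL2_imC.
- move=> F K mF mK; rewrite /dsum_ip /= -sumrN.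
  by apply: eq_bigr => k _; exact: ipL2_reJ.
- move=> F K mF mK; rewrite /dsum_ip /=.
  by apply: eq_bigr => k _; exact: ipL2_imJ.
- by move=> F mF; apply: sumr_ge0 => k _; exact: (ipL2_re_ge0 (mF k)).
- exact: dsum_complete.
Qed.

End dsum_hilbert.

(** * Plancherel's identity *)

Section Rintegral_fubini.
Context d1 d2 (T1 : measurableType d1) (T2 : measurableType d2) (R : realType).
Variable m1 : {sigma_finite_measure set T1 -> \bar R}.
Variable m2 : {sigma_finite_measure set T2 -> \bar R}.

Lemma measurable_Rintegral2 (F : T1 * T2 -> R) : measurable_fun setT F ->
  measurable_fun setT (fun x => \int[m2]_y F (x, y)).
Proof.
move=> mF; apply: measurableT_comp => //.
apply: (@measurable_integral2 R _ _ T1 T2 m2 (EFin \o F)).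
exact/measurable_EFinP.
Qed.

Lemma prodm_swap (f : T1 * T2 -> R) :
  (prodm m1 m2).-integrable setT (EFin \o f) ->
  (prodm m2 m1).-integrable setT (EFin \o (fun p => f (p.2, p.1))).
Proof.
move=> fi; have mf := measurable_int _ fi.
have mf' : measurable_fun setT (EFin \o (fun p : T2 * T1 => f (p.2, p.1))).
  by apply: measurableT_comp mf _; apply: measurable_fun_pair;
    [exact: measurable_snd|exact: measurable_fst].
have /integrableP[_ h] := fi.
apply/integrableP; split => //; move: h.
rewrite !prodm_tonelli1//; [|exact: measurableT_comp..].
rewrite (@fubini_tonelli _ _ _ _ _ m1 m2 (fun z => `|(f z)%:E|%E))//.
exact: measurableT_comp.
Qed.

(** Real-valued integrals go through [fine], which changes the inner integral wherever it is
    infinite. Both conclusions therefore rest on an equality that holds only almost everywhere. *)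
Lemma Rfubini1 (f : T1 * T2 -> R) : (prodm m1 m2).-integrable setT (EFin \o f) ->
  m1.-integrable setT (EFin \o (fun x => \int[m2]_y f (x, y))) /\
  \int[prodm m1 m2]_z f z = \int[m1]_x \int[m2]_y f (x, y).
Proof.
move=> fi; have mf := measurable_int _ fi.
have ae := ae_integrable1 fi.
have iF := integrable_fubini_F fi.
have mF : measurable_fun setT (EFin \o (fun x => \int[m2]_y f (x, y))).
  by apply/measurable_EFinP; apply: measurable_Rintegral2; exact/measurable_EFinP.
have E : ae_eq m1 setT (fubini_F m2 (EFin \o f))
    (EFin \o (fun x => \int[m2]_y f (x, y))).
  move: ae; apply: filterS => x xi _ /=.
  by rewrite /Rintegral fineK//; exact: integrable_fin_num.
split.
  apply/integrableP; split => //.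
  have /integrableP[mF' h] := iF.
  rewrite (@ae_eq_integral _ _ _ m1 setT (fun x => `|fubini_F m2 (EFin \o f) x|%E))//.
  - exact: measurableT_comp.
  - exact: measurableT_comp.
  - exact/ae_eq_abse/ae_eq_sym.
rewrite /Rintegral prodm_fubini1//; congr fine.
apply: ae_eq_integral => //.
exact: measurable_int iF.
Qed.

End Rintegral_fubini.

Section Rintegral_fubini2.
Context d1 d2 (T1 : measurableType d1) (T2 : measurableType d2) (R : realType).
Variable m1 : {sigma_finite_measure set T1 -> \bar R}.
Variable m2 : {sigma_finite_measure set T2 -> \bar R}.

Lemma Rfubini (f : T1 * T2 -> R) : (prodm m1 m2).-integrable setT (EFin \o f) ->
  \int[m1]_x \int[m2]_y f (x, y) = \int[m2]_y \int[m1]_x f (x, y).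
Proof.
move=> fi; rewrite -(Rfubini1 fi).2 -(Rfubini1 (prodm_swap fi)).2.
by rewrite /Rintegral prodm_fubini1// prodm_fubini2//; exact: prodm_swap.
Qed.

(** By Tonelli the double integral of the absolute value is at most [M] times the product of the two
    L1 norms. *)
Lemma integrable_kernel (f : T1 -> R) (g : T2 -> R) (k : T1 * T2 -> R) (M : R) :
  m1.-integrable setT (EFin \o f) -> m2.-integrable setT (EFin \o g) ->
  measurable_fun setT k -> (forall z, `|k z| <= M) ->
  (prodm m1 m2).-integrable setT (EFin \o (fun z => f z.1 * g z.2 * k z)).
Proof.
move=> fi gi mk kM.
have mf := measurable_int _ fi; have mg := measurable_int _ gi.
move/measurable_EFinP in mf; move/measurable_EFinP in mg.
have mF : measurable_fun setT (fun z : T1 * T2 => f z.1 * g z.2 * k z).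
  apply: measurable_funM => //; apply: measurable_funM.
    exact: (measurableT_comp mf measurable_fst).
  exact: (measurableT_comp mg measurable_snd).
have M0 : 0 <= M by apply: le_trans (kM (point, point)).
apply/integrableP; split; first exact/measurable_EFinP.
rewrite prodm_tonelli1//; last by apply: measurableT_comp => //; exact/measurable_EFinP.
have /integrableP[_ fl] := fi; have /integrableP[_ gl] := gi.
set G := (\int[m2]_y `|(EFin \o g) y|)%E in gl.
have mag : measurable_fun setT (fun y => `|(EFin \o g) y|%E).
  by apply: measurableT_comp => //; exact/measurable_EFinP.
have maf : measurable_fun setT (fun y => `|(EFin \o f) y|%E).
  by apply: measurableT_comp => //; exact/measurable_EFinP.
have G0 : (0 <= G)%E by exact: integral_ge0.
apply: (@le_lt_trans _ _ (\int[m1]_x (`|(EFin \o f) x| * (M%:E * G)))%E).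
  apply: ge0_le_integral => //.
  - by move=> x _; exact: integral_ge0.
  - apply: (@measurable_integral2 _ _ _ T1 T2 m2 (fun z => `|(f z.1 * g z.2 * k z)%:E|%E)).
    by apply: measurableT_comp => //; exact/measurable_EFinP.
  - exact: emeasurable_funM.
  move=> x _.
  have mMg : measurable_fun setT (fun y => (M%:E * `|(EFin \o g) y|)%E) by exact: emeasurable_funM.
  have -> : (`|(EFin \o f) x| * (M%:E * G) =
      \int[m2]_y (`|(EFin \o f) x| * (M%:E * `|(EFin \o g) y|)))%E.
    rewrite ge0_integralZl//; last by move=> y _; rewrite mule_ge0.
    by rewrite ge0_integralZl.
  apply: ge0_le_integral => //.
  - apply: measurableT_comp => //; apply/measurable_EFinP.
    exact: (measurableT_comp mF (pair1_measurable x)).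
  - exact: emeasurable_funM.
  move=> y _ /=; rewrite -!EFinM lee_fin !normrM -mulrA.
  by apply: ler_wpM2l => //; rewrite mulrC; apply: ler_wpM2r.
rewrite ge0_integralZr//; last by rewrite mule_ge0.
by rewrite lte_mul_pinfty// ?ge0_fin_numE ?integral_ge0// lte_mul_pinfty.
Qed.

Lemma Rfubini_kernel (f : T1 -> R) (g : T2 -> R) (k : T1 * T2 -> R) (M : R) :
  m1.-integrable setT (EFin \o f) -> m2.-integrable setT (EFin \o g) ->
  measurable_fun setT k -> (forall z, `|k z| <= M) ->
  \int[m1]_x (f x * \int[m2]_y (g y * k (x, y))) =
  \int[m2]_y (g y * \int[m1]_x (f x * k (x, y))).
Proof.
move=> fi gi mk kM.
have M0 : 0 <= M by apply: le_trans (kM (point, point)).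
have bk1 x : [bounded k (x, y) | y in [set: T2]].
  by exists M; split; [exact: num_real|move=> z Mz y _ /=; apply: le_trans (ltW Mz)].
have bk2 y : [bounded k (x, y) | x in [set: T1]].
  by exists M; split; [exact: num_real|move=> z Mz x _ /=; apply: le_trans (ltW Mz)].
have := Rfubini (integrable_kernel fi gi mk kM) => /=.
have -> : \int[m1]_x \int[m2]_y (f x * g y * k (x, y)) =
    \int[m1]_x (f x * \int[m2]_y (g y * k (x, y))).
  apply: eq_Rintegral => x _; rewrite -RintegralZl//.
    by apply: eq_Rintegral => y _; rewrite mulrA.
  apply: (integrableMl _ gi) => //.
  exact: measurableT_comp mk (pair1_measurable x).
move=> ->; apply: eq_Rintegral => y _; rewrite -RintegralZl//.
  by apply: eq_Rintegral => x _; rewrite mulrA [f x * _]mulrC.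
apply: (integrableMl _ fi) => //.
exact: measurableT_comp mk (pair2_measurable y).
Qed.

End Rintegral_fubini2.

(** * The Fourier transform of the two-sided exponential *)

Section cauchy_kernel.
Variable R : realType.
Notation leb := (@lebesgue_measure R).
Notation RR := (measurableTypeR R).

Lemma is_derive_expRM (c x : R) :
  is_derive x 1 (fun w => expR (c * w)) (c * expR (c * x)).
Proof.
have h : is_derive x 1 (fun w : R => c * w) c.
  have -> : (fun w : R => c * w) = c \*: (@id R) by [].
  by apply: is_derive_eq; rewrite /GRing.scale/= mulr1.
have := @is_derive1_comp R expR (fun w => c * w) x _ _ (is_derive_expR _) h.
by move=> k; apply: is_derive_eq; rewrite mulrC.
Qed.

Lemma is_derive_sinM (b x : R) :
  is_derive x 1 (fun w => sin (b * w)) (b * cos (b * x)).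
Proof.
have h : is_derive x 1 (fun w : R => b * w) b.
  have -> : (fun w : R => b * w) = b \*: (@id R) by [].
  by apply: is_derive_eq; rewrite /GRing.scale/= mulr1.
have := @is_derive1_comp R sin (fun w => b * w) x _ _ (is_derive_sin _) h.
by move=> k; apply: is_derive_eq; rewrite mulrC.
Qed.

Lemma is_derive_cosM (b x : R) :
  is_derive x 1 (fun w => cos (b * w)) (- b * sin (b * x)).
Proof.
have h : is_derive x 1 (fun w : R => b * w) b.
  have -> : (fun w : R => b * w) = b \*: (@id R) by [].
  by apply: is_derive_eq; rewrite /GRing.scale/= mulr1.
have := @is_derive1_comp R cos (fun w => b * w) x _ _ (is_derive_cos _) h.
by move=> k; apply: is_derive_eq; rewrite mulrC mulrN mulNr.
Qed.

Variables (a b : R).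
Hypothesis a0 : 0 < a.

Let D := a ^+ 2 + b ^+ 2.
Let D0 : 0 < D. Proof. by rewrite ltr_pwDl ?exprn_gt0 ?sqr_ge0. Qed.

(** The primitive of [expR (- a * w) * (1 + cos (b * w))] that vanishes at infinity. *)
Let F (w : R) : R := expR (- a * w) *
  (- a^-1 + (b / D) * sin (b * w) - (a / D) * cos (b * w)).

Let derF (x : R) : is_derive x 1 F (expR (- a * x) * (1 + cos (b * x))).
Proof.
pose G (w : R) := - a^-1 + (b / D) * sin (b * w) - (a / D) * cos (b * w).
have dG : is_derive x 1 G ((b / D) * (b * cos (b * x)) - (a / D) * (- b * sin (b * x))).
  have -> : G = cst (- a^-1) + (b / D) \*: (fun w => sin (b * w)) -
      (a / D) \*: (fun w => cos (b * w)) by [].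
  have := is_derive_sinM b x; have := is_derive_cosM b x => h1 h2.
  by apply: is_derive_eq; rewrite add0r.
have -> : F = (fun w => expR (- a * w)) * G by [].
have := is_derive_expRM (- a) x => h1.
apply: is_derive_eq; rewrite /GRing.scale/= /G /D; field.
by rewrite (gt_eqF a0) gt_eqF.
Qed.

Let cvgF : F x @[x --> +oo] --> 0.
Proof.
pose C := a^-1 + `|b / D| + `|a / D|.
have e0 : expR (- a * x) @[x --> +oo] --> 0.
  have : expR (- (a * x)) @[x --> +oo] --> 0.
    apply: (@cvg_comp _ _ _ (fun x => a * x) (fun y => expR (- y)) _ +oo); last exact: cvgr_expR.
    by apply: gt0_cvgMry => //; exact: cvg_id.
  by under eq_fun do rewrite -mulNr.
have u0 : C * expR (- a * x) @[x --> +oo] --> 0.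
  by rewrite -[X in _ --> X](mulr0 C); apply: cvgM => //; exact: cvg_cst.
have l0 : - (C * expR (- a * x)) @[x --> +oo] --> 0.
  by rewrite -[X in _ --> X]oppr0; apply: cvgN.
apply: (squeeze_cvgr _ l0 u0); apply: nearW => x.
rewrite -ler_norml /F normrM ger0_norm ?expR_ge0// mulrC ler_wpM2r ?expR_ge0//.
apply: (le_trans (ler_normB _ _)); apply: lerD.
  apply: (le_trans (ler_normD _ _)); apply: lerD.
    by rewrite normrN ger0_norm// invr_ge0 ltW.
  by rewrite normrM ler_piMr// ler_norml sin_geN1 sin_le1.
by rewrite normrM ler_piMr// ler_norml cos_geN1 cos_le1.
Qed.

(** The summand 1 keeps the integrand nonnegative, so the fundamental theorem of calculus on a
    half-line applies without prior integrability. The cosine transform alone is recovered later by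
    subtracting the case [b = 0]. *)
Lemma integral_exp_cos1 : (\int[leb]_w (expR (- a * `|w|) * (1 + cos (b * w)))%:E =
  (2 * (a^-1 + a / (a ^+ 2 + b ^+ 2)))%:E)%E.
Proof.
have f0 x : 0 <= expR (- a * x) * (1 + cos (b * x)).
  by rewrite mulr_ge0 ?expR_ge0//; have := cos_geN1 (b * x); lra.
have cf : continuous (fun w : R => expR (- a * w) * (1 + cos (b * w))).
  move=> x; apply: cvgM.
    apply: continuous_comp; last exact: continuous_expR.
    by apply: cvgM; [exact: cvg_cst|exact: cvg_id].
  apply: cvgD; first exact: cvg_cst.
  apply: continuous_comp; last exact: continuous_cos.
  by apply: cvgM; [exact: cvg_cst|exact: cvg_id].
rewrite ge0_symfun_integralT; last 3 first.
- by move=> x; rewrite mulr_ge0 ?expR_ge0//; have := cos_geN1 (b * x); lra.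
- move=> x; apply: cvgM.
    apply: continuous_comp; last exact: continuous_expR.
    by apply: cvgM; [exact: cvg_cst|exact: norm_continuous].
  apply: cvgD; first exact: cvg_cst.
  apply: continuous_comp; last exact: continuous_cos.
  by apply: cvgM; [exact: cvg_cst|exact: cvg_id].
- by move=> x /=; rewrite normrN mulrN cosN.
rewrite EFinM; congr (_ * _)%E.
rewrite -set_itvcy.
transitivity (\int[leb]_(x in `[0%R, +oo[) (expR (- a * x) * (1 + cos (b * x)))%:E)%E.
  by apply: eq_integral => x; rewrite inE/= in_itv/= andbT => x0; rewrite ger0_norm.
rewrite (@ge0_continuous_FTC2y _ _ F 0 0)//.
- rewrite sub0e -EFinN; congr EFin.
  by rewrite /F !mulr0 expR0 sin0 cos0 /D; ring.
- exact: continuous_subspaceT.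
- apply: cvg_at_right_filter.
  by apply: differentiable_continuous; apply/derivable1_diffP; have [] := derF 0.
- move=> x _; rewrite derive1E; exact: derive_val.
Qed.

End cauchy_kernel.

Section cauchy_transform.
Variables (R : realType) (a : R).
Hypothesis a0 : 0 < a.
Notation leb := (@lebesgue_measure R).
Notation RR := (measurableTypeR R).

(** The Fourier transform of exp(-a|w|), a Cauchy density of scale [a]: it has mass one and
    concentrates at 0 as [a] decreases to 0. *)
Definition cauchyK (u : R) : R := 2 * a / (a ^+ 2 + (2 * pi * u) ^+ 2).

Let E (w : RR) : R := expR (- a * `|w|).

Lemma measurable_cosM d (T : measurableType d) (f : T -> R) :
  measurable_fun setT f -> measurable_fun setT (fun x => cos (f x)).
Proof.
by move=> mf; apply: measurableT_comp mf; apply: continuous_measurable_fun;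
  exact: continuous_cos.
Qed.

Lemma measurable_sinM d (T : measurableType d) (f : T -> R) :
  measurable_fun setT f -> measurable_fun setT (fun x => sin (f x)).
Proof.
by move=> mf; apply: measurableT_comp mf; apply: continuous_measurable_fun;
  exact: continuous_sin.
Qed.

Lemma measurable_expabs : measurable_fun setT E.
Proof.
by apply: measurableT_comp => //; apply: measurable_funM => //.
Qed.

Lemma integral_expabs : (\int[leb]_w (E w)%:E = (2 / a)%:E)%E.
Proof.
have := integral_exp_cos1 0 a0.
under eq_integral do rewrite mul0r cos0 mulrC EFinM.
have mE : measurable_fun setT (EFin \o E).
  by apply/measurable_EFinP; exact: measurable_expabs.
have E0 x : setT x -> (0 <= (EFin \o E) x)%E by rewrite lee_fin expR_ge0.
rewrite (ge0_integralZl_EFin _ measurableT E0 mE)//.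
rewrite expr0n addr0 (_ : a / a ^+ 2 = a^-1); last by field; rewrite gt_eqF.
rewrite [X in (_ * X)%E = _ -> _](_ : _ = \int[leb]_w (E w)%:E)%E//.
case: (\int[leb]_w (E w)%:E)%E => [r| |] h.
- by case: h => h; congr EFin; lra.
- by move: h; rewrite gt0_muley ?lte_fin.
- by move: h; rewrite gt0_muleNy ?lte_fin.
Qed.

Lemma integrable_expabs : leb.-integrable setT (EFin \o E).
Proof.
apply/integrableP; split; first by apply/measurable_EFinP; exact: measurable_expabs.
under eq_integral do rewrite /= ger0_norm ?expR_ge0//.
by rewrite integral_expabs ltry.
Qed.

Lemma integral_exp_cos (u : R) :
  \int[leb]_w (E w * cos (2 * pi * w * u)) = cauchyK u.
Proof.
have mc : measurable_fun setT (fun w : RR => cos (2 * pi * w * u)).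
  by apply: measurable_cosM; apply: measurable_funM => //; apply: measurable_funM.
have bc : [bounded cos (2 * pi * w * u) | w in [set: RR]].
  exists 1; split; [exact: num_real|move=> z z1 w _ /=; apply: le_trans (ltW z1)].
  by rewrite ler_norml cos_geN1 cos_le1.
have i1 := integrable_expabs.
have i2 : leb.-integrable setT (EFin \o (fun w => E w * cos (2 * pi * w * u))).
  exact: (integrableMl measurableT i1 mc bc).
have h := integral_exp_cos1 (2 * pi * u) a0.
have : \int[leb]_w (E w + E w * cos (2 * pi * w * u)) =
    2 * (a^-1 + a / (a ^+ 2 + (2 * pi * u) ^+ 2)).
  rewrite /Rintegral; transitivity (fine (2 * (a^-1 + a / (a ^+ 2 + (2 * pi * u) ^+ 2)))%:E) => //.
  rewrite -h; congr fine; apply: eq_integral => w _.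
  by congr EFin; rewrite /E (_ : 2 * pi * w * u = 2 * pi * u * w); ring.
rewrite RintegralD//.
have -> : \int[leb]_w E w = 2 / a by rewrite /Rintegral integral_expabs.
by move=> /(canRL (addKr _)) ->; rewrite /cauchyK; ring.
Qed.

Lemma cauchyK_ge0 u : 0 <= cauchyK u.
Proof. by rewrite divr_ge0 ?addr_ge0 ?sqr_ge0// mulr_ge0 ?ltW. Qed.

Lemma continuous_cauchyK : continuous cauchyK.
Proof.
move=> u; apply: cvgM; first exact: cvg_cst.
apply: cvgV; first by rewrite gt_eqF// ltr_pwDl ?exprn_gt0 ?sqr_ge0.
apply: cvgD; first exact: cvg_cst.
have h : 2 * pi * x @[x --> u] --> 2 * pi * u.
  by apply: cvgM; [exact: cvg_cst|exact: cvg_id].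
by rewrite expr2; exact: (cvgM h h).
Qed.

Lemma measurable_cauchyK : measurable_fun setT (cauchyK : RR -> R).
Proof. exact: continuous_measurable_fun continuous_cauchyK. Qed.

(** An arctangent is a primitive, and its limit at infinity gives mass one half on the positive
    axis. *)
Lemma integral_cauchyK : (\int[leb]_u (cauchyK u)%:E = 1%:E)%E.
Proof.
rewrite ge0_symfun_integralT; last 3 first.
- exact: cauchyK_ge0.
- exact: continuous_cauchyK.
- by move=> x; rewrite /cauchyK /= mulrN sqrrN.
pose F (u : R) : R := pi^-1 * atan ((2 * pi / a) * u).
have pi0 := pi_gt0 R.
have c0 : 0 < 2 * pi / a by rewrite divr_gt0 ?mulr_gt0.
have derF (x : R) : is_derive x 1 F (cauchyK x).
  have h : is_derive x 1 (fun w : R => (2 * pi / a) * w) (2 * pi / a).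
    have -> : (fun w : R => (2 * pi / a) * w) = (2 * pi / a) \*: (@id R) by [].
    by apply: is_derive_eq; rewrite /GRing.scale/= mulr1.
  have k := @is_derive1_comp R atan (fun w => (2 * pi / a) * w) x _ _ (is_derive1_atan _) h.
  have -> : F = pi^-1 \*: (atan \o (fun w => (2 * pi / a) * w)) by [].
  apply: is_derive_eq; rewrite /GRing.scale/= /cauchyK.
  move: (pi_gt0 R); generalize (pi : R) => p p0; field.
  by rewrite !gt_eqF// ?ltr_pwDl ?exprn_gt0 ?sqr_ge0.
have cF : F x @[x --> +oo] --> (2^-1 : R).
  have -> : 2^-1 = pi^-1 * (pi / 2) :> R by rewrite mulrA mulVf ?mul1r// gt_eqF.
  apply: cvgM; first exact: cvg_cst.
  apply: (@cvg_comp _ _ _ (fun x => (2 * pi / a) * x) atan _ +oo); last exact: cvgy_atan.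
  by apply: gt0_cvgMry => //; exact: cvg_id.
rewrite -set_itvcy (@ge0_continuous_FTC2y _ _ F 0 2^-1)//.
- rewrite /F mulr0 atan0 mulr0 sube0 -EFinM; congr EFin; lra.
- by move=> x _; exact: cauchyK_ge0.
- apply: continuous_subspaceT; exact: continuous_cauchyK.
- apply: cvg_at_right_filter.
  by apply: differentiable_continuous; apply/derivable1_diffP; have [] := derF 0.
- move=> x _; rewrite derive1E; exact: derive_val.
Qed.

Lemma integrable_cauchyK : leb.-integrable setT (EFin \o cauchyK).
Proof.
apply/integrableP; split; first by apply/measurable_EFinP; exact: measurable_cauchyK.
under eq_integral do rewrite /= ger0_norm ?cauchyK_ge0//.
by rewrite integral_cauchyK ltry.
Qed.

End cauchy_transform.

Lemma ecvg0_le (R : realType) (u : nat -> \bar R) (e : R) : 0 < e ->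
  u n @[n --> \oo] --> 0%E -> \forall n \near \oo, (u n <= e%:E)%E.
Proof.
move=> e0 /fine_cvgP[fu /cvgr_lt/(_ _ e0) lu].
near=> n; have fn : u n \is a fin_num by near: n.
by rewrite -(fineK fn) lee_fin ltW//; near: n.
Unshelve. all: by end_near. Qed.

Lemma Rintegral_dominated_cvg d (T : measurableType d) (R : realType)
    (mu : {measure set T -> \bar R}) (f_ : nat -> T -> R) (f g : T -> R) :
  (forall n, measurable_fun setT (f_ n)) ->
  (forall x, f_ n x @[n --> \oo] --> f x) ->
  mu.-integrable setT (EFin \o g) -> (forall n x, `|f_ n x| <= g x) ->
  \int[mu]_x f_ n x @[n --> \oo] --> \int[mu]_x f x.
Proof.
move=> mf_ f_f ig fg.
have mf : measurable_fun setT f by apply: (measurable_fun_cvg mf_) => x _.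
have ifi : mu.-integrable setT (EFin \o f).
  apply: (le_integrable measurableT _ _ ig); first exact/measurable_EFinP.
  move=> x _ /=; rewrite lee_fin [leRHS]ger0_norm; last exact: le_trans (fg 0%N x).
  apply/ler_addgt0Pr => e e0.
  have /cvgrPdist_le/(_ _ e0)[n _ /(_ n (leqnn n)) /= h] := f_f x.
  rewrite -[f x](subrK (f_ n x)) (le_trans (ler_normD _ _))// addrC lerD//.
have := @dominated_cvg _ T R mu setT measurableT (fun n => EFin \o f_ n) (EFin \o f)
  (EFin \o g).
move=> /(_ (fun n => (measurable_EFinP _ _).2 (mf_ n))).
have h x : setT x -> (fun n => (EFin \o f_ n) x) n @[n --> \oo] --> (EFin \o f) x.
  by move=> _; apply: cvg_EFin; [exact: nearW|exact: f_f].
move=> /(_ h) /(_ (fun _ _ => isT)) /(_ ig).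
have h2 n x : setT x -> (`|(EFin \o f_ n) x| <= (EFin \o g) x)%E by rewrite lee_fin.
move=> /(_ h2) k.
have : (\int[mu]_x (EFin \o f_ n) x)%E @[n --> \oo] --> (\int[mu]_x f x)%:E.
  by rewrite /Rintegral fineK//; exact: integrable_fin_num.
by move=> /fine_cvgP[].
Qed.

Section sqint_cauchy_schwarz.
Context d (T : measurableType d) (R : realType).
Variable mu : {measure set T -> \bar R}.

Lemma sqint_cs (f g : T -> R) : sqint mu f -> sqint mu g ->
  `|\int[mu]_x (f x * g x)| <=
  Num.sqrt (\int[mu]_x (f x * f x)) * Num.sqrt (\int[mu]_x (g x * g x)).
Proof.
move=> sf sg.
apply: (@sip_cs_norm R (T -> R) (sqint mu) (fun f g => \int[mu]_x (f x * g x))) => //.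
- by move=> *; exact: sqintD.
- by move=> *; exact: sqintZ.
- by move=> u v _ _; apply: eq_Rintegral => x _; rewrite mulrC.
- move=> u v w su sv sw; rewrite -RintegralD//; [|exact: sqint_mul..].
  by apply: eq_Rintegral => x _; rewrite mulrDl.
- move=> c u v su sv; rewrite -RintegralZl//; last exact: sqint_mul.
  by apply: eq_Rintegral => x _; rewrite mulrA.
- by move=> u su; apply: Rintegral_ge0 => x _; rewrite -expr2 sqr_ge0.
Qed.

Lemma sqint_normE (f : T -> R) : sqint mu f ->
  (\int[mu]_x (f x * f x))%:E = (\int[mu]_x (f x ^+ 2)%:E)%E.
Proof.
move=> sf; rewrite /Rintegral fineK; last exact/integrable_fin_num/sqint_mul.
by apply: eq_integral => x _; rewrite expr2.
Qed.

End sqint_cauchy_schwarz.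

(** * Continuity of the autocorrelation at 0 *)

Section autocorrelation.
Variable R : realType.
Notation leb := (@lebesgue_measure R).
Notation RR := (measurableTypeR R).
Implicit Types f h : RR -> R.

Lemma measurable_shift (c : R) : measurable_fun setT (fun x : RR => (x + c : R) : RR).
Proof. by apply: (@measurable_funD _ RR _ setT); [exact: measurable_id|exact: measurable_cst]. Qed.

Lemma ge0_integral_shift (f : RR -> \bar R) (c : R) : measurable_fun setT f ->
  (forall x, 0 <= f x)%E -> (\int[leb]_x f ((x + c)%R : RR) = \int[leb]_x f x)%E.
Proof.
move=> mf f0; rewrite [RHS](ge0_integral_affine1 c (@ltr01 R))//.
by rewrite mul1e; apply: eq_integral => x _; rewrite mul1r.
Qed.

Lemma integrable_shift (f : RR -> R) (c : R) : leb.-integrable setT (EFin \o f) ->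
  leb.-integrable setT (EFin \o (fun x => f ((x + c)%R : RR))).
Proof.
move=> /integrableP[mf fi]; apply/integrableP; split.
  exact: measurableT_comp mf (measurable_shift c).
rewrite (ge0_integral_shift (f := fun x => `|(EFin \o f) x|%E))//.
exact: measurableT_comp.
Qed.

Lemma Rintegral_shift (f : RR -> R) (c : R) : measurable_fun setT f ->
  \int[leb]_x f ((x + c)%R : RR) = \int[leb]_x f x.
Proof.
move=> mf; have mEf : measurable_fun setT (EFin \o f) by exact/measurable_EFinP.
have mp := measurable_funepos mEf; have mn := measurable_funeneg mEf.
rewrite /Rintegral integralE [in RHS]integralE; congr (fine (_ - _)).
  rewrite -[RHS](ge0_integral_shift c mp)//.
  by apply: eq_integral => x _; rewrite !funeposE.
rewrite -[RHS](ge0_integral_shift c mn)//.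
by apply: eq_integral => x _; rewrite !funenegE.
Qed.

Lemma sqint_shift h (c : R) : sqint leb h -> sqint leb (fun x => h ((x + c)%R : RR)).
Proof.
move=> [mh hi]; split; first exact: measurableT_comp mh (measurable_shift c).
rewrite (ge0_integral_shift c (f := fun x => (h x ^+ 2)%:E))//.
- exact: measurable_sqrE.
- by move=> x; rewrite lee_fin sqr_ge0.
Qed.

Definition autocorr h (u : R) : R := \int[leb]_x (h x * h ((x + u)%R : RR)).

Lemma autocorr_bound h u : sqint leb h -> `|autocorr h u| <= \int[leb]_x (h x * h x).
Proof.
move=> sh; apply: (le_trans (sqint_cs sh (sqint_shift u sh))).
rewrite (Rintegral_shift u (f := fun x => h x * h x)); last first.
  by apply: measurable_funM; case: sh.
by rewrite -expr2 sqr_sqrtr// Rintegral_ge0// => x _; rewrite -expr2 sqr_ge0.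
Qed.

(** Bilinear splitting into a term with [h - k] in the first factor and one with the shifted [h - k]
    in the second, then Cauchy-Schwarz. The bound is uniform in the shift [u]. *)
Lemma autocorrB h k u : sqint leb h -> sqint leb k ->
  `|autocorr h u - autocorr k u| <=
  Num.sqrt (\int[leb]_x ((h x - k x) * (h x - k x))) *
  (Num.sqrt (\int[leb]_x (h x * h x)) + Num.sqrt (\int[leb]_x (k x * k x))).
Proof.
move=> sh sk.
have sB := sqintB sh sk.
have s1 := sqint_shift u sh; have s2 := sqint_shift u sk.
have s3 := sqint_shift u sB.
have -> : autocorr h u - autocorr k u =
   \int[leb]_x ((h x - k x) * h ((x + u)%R : RR)) +
   \int[leb]_x (k x * (h ((x + u)%R : RR) - k ((x + u)%R : RR))).
  rewrite /autocorr -RintegralB//; [|exact: sqint_mul..].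
  rewrite -RintegralD//; [|exact: sqint_mul..].
  by apply: eq_Rintegral => x _; ring.
apply: (le_trans (ler_normD _ _)); rewrite mulrDr; apply: lerD.
  apply: (le_trans (sqint_cs sB s1)).
  rewrite (Rintegral_shift u (f := fun x => h x * h x))//.
  by apply: measurable_funM; case: sh.
apply: (le_trans (sqint_cs sk s3)); rewrite mulrC.
rewrite (Rintegral_shift u (f := fun x => (h x - k x) * (h x - k x)))//.
by apply: measurable_funM; case: sB.
Qed.

(** Both the argument and the value are truncated, so the result is bounded with bounded support, in
    particular integrable, and it tends to [h] in L2. *)
Definition trunc h (k : nat) : RR -> R :=
  fun x => if (`|x| <= k%:R) && (`|h x| <= k%:R) then h x else 0.

Lemma measurable_trunc h k : measurable_fun setT h -> measurable_fun setT (trunc h k).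
Proof.
move=> mh; apply: measurable_fun_ifT => //.
apply: measurable_and; apply: measurable_fun_ler => //.
by apply: measurableT_comp mh; exact: normr_measurable.
Qed.

Lemma trunc_le h k x : `|trunc h k x| <= `|h x|.
Proof. by rewrite /trunc; case: ifP => // _; rewrite normr0. Qed.

Lemma trunc_bound h k x : `|trunc h k x| <= k%:R.
Proof. by rewrite /trunc; case: ifP => [/andP[]|_]//; rewrite normr0. Qed.

Lemma trunc_supp h k (x : R) : k%:R < `|x| -> trunc h k x = 0.
Proof. by move=> kx; rewrite /trunc leNgt kx. Qed.

Lemma sqint_trunc h k : sqint leb h -> sqint leb (trunc h k).
Proof.
move=> [mh hi]; have mt := measurable_trunc k mh; split => //.
apply: le_lt_trans hi; apply: ge0_le_integral => //.
- by move=> x _; rewrite lee_fin sqr_ge0.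
- exact: measurable_sqrE.
- exact: measurable_sqrE.
- move=> x _; rewrite lee_fin -[leLHS]real_normK ?num_real// -[leRHS]real_normK ?num_real//.
  by rewrite ler_sqr ?nnegrE// trunc_le.
Qed.

Lemma trunc_cvg h : sqint leb h ->
  (\int[leb]_x ((h x - trunc h k x) ^+ 2)%:E)%E @[k --> \oo] --> 0%E.
Proof.
move=> sh; have [mh hi] := sh.
have -> : (0 = \int[leb]_x (cst 0 x : \bar R))%E by rewrite integral0.
apply: (@dominated_cvg _ RR R leb setT measurableT _ _ (fun x => (h x ^+ 2)%:E)) => //.
- move=> k; apply: measurable_sqrE; apply: measurable_funB => //.
  exact: measurable_trunc.
- move=> x _; apply: cvg_near_cst.
  near=> k; rewrite /trunc.
  have -> : `|x| <= k%:R by near: k; exact: nbhs_infty_ger.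
  have -> : `|h x| <= k%:R by near: k; exact: nbhs_infty_ger.
  by rewrite /= subrr expr0n.
- exact: sqint_integrable.
- move=> k x _; rewrite gee0_abs ?lee_fin ?sqr_ge0// /trunc; case: ifP => _.
    by rewrite subrr expr0n sqr_ge0.
  by rewrite subr0.
Unshelve. all: by end_near. Qed.

Lemma integrable_trunc h k : measurable_fun setT h ->
  leb.-integrable setT (EFin \o trunc h k).
Proof.
move=> mh; have mt := measurable_trunc k mh.
apply/integrableP; split; first exact/measurable_EFinP.
apply: (@le_lt_trans _ _ (\int[leb]_(x in `[(- k%:R)%R, k%:R]) k%:R%:E)%E); last first.
  rewrite integral_cst//= lebesgue_measure_itv/=; case: ifP => _.
    by rewrite -EFinB -EFinM ltry.
  by rewrite mule0.
rewrite [leRHS]integral_mkcond; apply: ge0_le_integral => //.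
- by apply: measurableT_comp => //; exact/measurable_EFinP.
- by apply/(measurable_restrictT _ _).1 => //.
move=> x _ /=; rewrite patchE; case: ifPn.
  by move=> _; rewrite lee_fin trunc_bound.
rewrite notin_setE /= in_itv/= => /negP; rewrite -ler_norml -ltNge => kx.
by rewrite trunc_supp// normr0.
Qed.

(** In one factor the truncation is replaced by an L1-close continuous function cut to an interval.
    The error is uniform in the shift because the other factor is bounded by [k], and for the
    continuous factor dominated convergence applies. *)
Lemma autocorr_trunc_cvg h k (u : nat -> R) : measurable_fun setT h ->
  u n @[n --> \oo] --> (0 : R) ->
  autocorr (trunc h k) (u n) @[n --> \oo] --> autocorr (trunc h k) 0.
Proof.
move=> mh u0; set t := trunc h k.
have mt : measurable_fun setT t by exact: measurable_trunc.
have it : leb.-integrable setT (EFin \o t) by exact: integrable_trunc.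
have tk x : `|t x| <= k%:R by exact: trunc_bound.
(* The margin 1 keeps [x + u n] inside [E] for [x] in the support of [t] once [u n] is below 1 in
   absolute value; there [G] coincides with the continuous [gJ]. Also [k <= c] turns an L1 error
   [e / (3 * c)] into at most [e / 3]. *)
pose c : R := k%:R + 1.
pose E : set RR := `[- c, c]%classic.
have mE : measurable E by exact: measurable_itv.
have c0 : - c <= c by rewrite /c; have : 0 <= k%:R :> R by []; lra.
have Eoo : (leb E < +oo)%E.
  rewrite [X in (X < _)%E](lebesgue_measure_itv `[- c, c])/=.
  by case: ifP => _; rewrite -?EFinB ltry.
have itE : leb.-integrable E (EFin \o t).
  exact: (integrableS measurableT).
have [g [cg ig gt]] := approximation_continuous_integrable mE Eoo itE.
have bt : [bounded t x | x in [set: RR]].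
  by exists k%:R; split; [exact: num_real|move=> z kz x _ /=; apply: le_trans (ltW kz)].
apply/cvgrPdist_le => e e0.
have cp : 0 < c by rewrite /c ltr_wpDl.
have eta0 : 0 < e / (3 * c) by rewrite divr_gt0// mulr_gt0.
have [J _ JP] := ecvg0_le eta0 gt.
pose gJ : RR -> R := g J.
have tg : (\int[leb]_(z in E) `|(t z - gJ z)%:E| <= (e / (3 * c))%:E)%E.
  exact: JP (leqnn J).
pose G : RR -> R := gJ \_ E.
have mg : measurable_fun setT gJ := continuous_measurable_fun (cg J).
have mG : measurable_fun setT G.
  by apply/(measurable_restrictT _ _).1 => //; exact: measurable_funTS.
have [Mg Mg0 MgP] : exists2 Mg, 0 <= Mg & forall x, `|G x| <= Mg.
  have cn : {within `[- c, c], continuous (fun x => `|gJ x|)}.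
    apply: continuous_subspaceT => x.
    by apply: continuous_comp; [exact: cg|exact: norm_continuous].
  have [x0 _ x0P] := EVT_max c0 cn.
  exists `|gJ x0| => // x; rewrite /G patchE; case: ifPn => [|_].
    by rewrite inE => xE; exact: x0P.
  by rewrite normr0.
have iG : leb.-integrable setT (EFin \o G).
  have := (integrable_mkcond (EFin \o gJ) mE).1 (ig J).
  by rewrite restrict_EFin.
have itG : leb.-integrable setT (EFin \o (fun x => t x - G x)).
  by have := integrableB measurableT it iG.
have tGe : \int[leb]_x `|t x - G x| <= e / (3 * c).
  rewrite -lee_fin /Rintegral fineK; last first.
    by apply: integrable_fin_num => //; exact: (integrable_norm itG).
  apply: le_trans tg; rewrite [leRHS]integral_mkcond le_eqVlt; apply/orP; left.
  apply/eqP; apply: eq_integral => x _; rewrite patchE /G patchE; case: ifPn => // xE.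
  rewrite subr0 /t trunc_supp ?normr0//.
  move: xE; rewrite notin_setE /E /= in_itv/= => /negP; rewrite -ler_norml -ltNge.
  by apply: le_lt_trans; rewrite /c lerDl.
pose B (v : R) : R := \int[leb]_x (t x * G ((x + v)%R : RR)).
have bnd v : `|autocorr t v - B v| <= e / 3.
  have i1 : leb.-integrable setT (EFin \o (fun x => t x * t ((x + v)%R : RR))).
    exact: (integrableMr measurableT mt bt (integrable_shift v it)).
  have i2 : leb.-integrable setT (EFin \o (fun x => t x * G ((x + v)%R : RR))).
    exact: (integrableMr measurableT mt bt (integrable_shift v iG)).
  have i3 := integrable_norm (integrable_shift v itG).
  rewrite /autocorr /B -RintegralB//.
  apply: (le_trans (le_normr_Rintegral _ _)) => //.
    by have := integrableB measurableT i1 i2.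
  apply: (@le_trans _ _ (\int[leb]_x (k%:R * `|t ((x + v)%R : RR) - G ((x + v)%R : RR)|))).
    apply: le_Rintegral => //.
    - by apply: integrable_norm; have := integrableB measurableT i1 i2.
    - by have := integrableZl measurableT k%:R i3.
    - by move=> x _; rewrite -mulrBr normrM ler_wpM2r.
  rewrite RintegralZl//.
  rewrite (Rintegral_shift v (f := fun x => `|t x - G x|)); last first.
    by apply: measurableT_comp => //; exact: measurable_funB.
  apply: (@le_trans _ _ (c * (e / (3 * c)))).
    apply: ler_pM => //; first by apply: Rintegral_ge0.
    by rewrite /c lerDl.
  by rewrite le_eqVlt; apply/orP; left; apply/eqP; field; rewrite gt_eqF.
have cB : B (u n) @[n --> \oo] --> B 0.
  apply: (@Rintegral_dominated_cvg _ _ _ leb _ _ (fun x => `|t x| * Mg)).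
  - move=> n; apply: measurable_funM => //.
    exact: measurableT_comp mG (measurable_shift _).
  - move=> x; have [kx|xk] := ltP k%:R `|x|.
      by rewrite /t trunc_supp// mul0r; under eq_fun do rewrite mul0r; exact: cvg_cst.
    apply: cvgM; first exact: cvg_cst.
    have xE (y : R) : `|y| < 1 -> (x + y)%R \in E.
      move=> y1; rewrite inE /E /= in_itv/= -ler_norml.
      by apply: (le_trans (ler_normD _ _)); rewrite /c lerD// ltW.
    have -> : G ((x + 0)%R : RR) = gJ (x + 0).
      by rewrite /G patchE xE// normr0.
    have lim : gJ (x + u n) @[n --> \oo] --> gJ (x + 0).
      have h0 : (x + u n : R) @[n --> \oo] --> (x + 0 : R).
        by apply: cvgD => //; exact: cvg_cst.
      have lim0 : (g J (x + u n) : R) @[n --> \oo] --> (g J (x + 0) : R).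
        by apply: continuous_cvg => //; exact: cg.
      exact: lim0.
    apply: cvg_trans lim; apply: near_eq_cvg.
    near=> n; rewrite /G patchE xE//.
    by near: n; apply: (cvgr0_norm_lt u u0); exact: ltr01.
  - have := integrableZr measurableT Mg (integrable_norm it).
    by apply: eq_integrable => // x _.
  - by move=> n x; rewrite normrM ler_wpM2l.
near=> n.
have Bn : `|B 0 - B (u n)| <= e / 3.
  near: n; have /cvgrPdist_le := cB; apply; by rewrite divr_gt0.
have := bnd 0; have := bnd (u n); move: Bn.
rewrite !ler_norml => /andP[? ?] /andP[? ?] /andP[? ?]; apply/andP; split; lra.
Unshelve. all: by end_near. Qed.

(** A three-term estimate: truncation in L2 moves the autocorrelation by little, uniformly in the
    shift, and the truncated one converges. *)
Lemma autocorr_cvg h (u : nat -> R) : sqint leb h ->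
  u n @[n --> \oo] --> (0 : R) ->
  autocorr h (u n) @[n --> \oo] --> autocorr h 0.
Proof.
move=> sh u0; apply/cvgrPdist_le => e e0.
pose N := \int[leb]_x (h x * h x).
have N0 : 0 <= N by apply: Rintegral_ge0 => x _; rewrite -expr2 sqr_ge0.
pose S := Num.sqrt N + 1.
have S0 : 0 < S by rewrite ltr_wpDl// sqrtr_ge0.
(* [autocorrB] costs at most [dl * (S + S)], which is [e / 3]. *)
pose dl := e / (6 * S).
have dl0 : 0 < dl by rewrite divr_gt0// mulr_gt0.
have [k _ kP] := ecvg0_le (exprn_gt0 2 dl0) (trunc_cvg sh).
have {kP} hk := kP _ (leqnn k).
have st := sqint_trunc k sh; have sB := sqintB sh st.
have d1 : Num.sqrt (\int[leb]_x ((h x - trunc h k x) * (h x - trunc h k x))) <= dl.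
  have E : dl = Num.sqrt (dl ^+ 2) by rewrite sqrtr_sqr ger0_norm ?ltW.
  rewrite [leRHS]E; apply: ler_wsqrtr.
  by rewrite -lee_fin (sqint_normE sB).
have d2 : Num.sqrt (\int[leb]_x (trunc h k x * trunc h k x)) <= S.
  apply: (@le_trans _ _ (Num.sqrt N)); last by rewrite /S lerDl.
  apply: ler_wsqrtr; apply: le_Rintegral => //; [exact: sqint_mul|exact: sqint_mul|].
  move=> x _; rewrite -!expr2 -[leLHS]real_normK ?num_real// -[leRHS]real_normK ?num_real//.
  by rewrite ler_sqr ?nnegrE// trunc_le.
have bnd v : `|autocorr h v - autocorr (trunc h k) v| <= e / 3.
  apply: (le_trans (autocorrB v sh st)).
  apply: (@le_trans _ _ (dl * (S + S))).
    apply: (ler_pM _ _ d1); rewrite ?addr_ge0 ?sqrtr_ge0//.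
    by apply: lerD => //; rewrite /S lerDl.
  by rewrite /dl le_eqVlt; apply/orP; left; apply/eqP; field; rewrite gt_eqF.
have cB := autocorr_trunc_cvg (k := k) sh.1 u0.
near=> n.
have Bn : `|autocorr (trunc h k) 0 - autocorr (trunc h k) (u n)| <= e / 3.
  near: n; have /cvgrPdist_le := cB; apply; by rewrite divr_gt0.
have := bnd 0; have := bnd (u n); move: Bn.
rewrite !ler_norml => /andP[? ?] /andP[? ?] /andP[? ?]; apply/andP; split; lra.
Unshelve. all: by end_near. Qed.

End autocorrelation.

(** * Plancherel by Abel summation *)

Section plancherel.
Variable R : realType.
Notation leb := (@lebesgue_measure R).
Notation RR := (measurableTypeR R).
Notation E a := (fun w : RR => expR (- a * `|w|)).

Lemma Rintegral_scale (s : R) (f : RR -> R) : 0 < s ->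
  leb.-integrable setT (EFin \o f) ->
  \int[leb]_x f x = s * \int[leb]_x f ((s * x)%R : RR).
Proof.
move=> s0 fi; have mEf := measurable_int _ fi.
have mp := measurable_funepos mEf; have mn := measurable_funeneg mEf.
have ms : measurable_fun setT (fun x : RR => (s * x)%R : RR).
  by have := measurable_affine s (0 : R); under eq_fun do rewrite addr0.
have hs (g : RR -> \bar R) : measurable_fun setT g -> (forall x, 0 <= g x)%E ->
    (\int[leb]_x g x = s%:E * \int[leb]_x g ((s * x)%R : RR))%E.
  move=> mg g0; rewrite (ge0_integral_affine1 0 s0)//; congr (_ * _)%E.
  by apply: eq_integral => x _; rewrite addr0.
have fin_s (g : RR -> \bar R) : measurable_fun setT g -> (forall x, 0 <= g x)%E ->
    (\int[leb]_x g x)%E \is a fin_num ->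
    (\int[leb]_x g ((s * x)%R : RR))%E \is a fin_num.
  move=> mg g0; rewrite hs//; case: (\int[leb]_x _)%E => [//| |].
    by rewrite gt0_muley ?lte_fin.
  by rewrite gt0_muleNy ?lte_fin.
have fp := fin_s _ mp (fun x => funepos_ge0 _ x) (integrable_pos_fin_num measurableT fi).
have fn := fin_s _ mn (fun x => funeneg_ge0 _ x) (integrable_neg_fin_num measurableT fi).
rewrite /Rintegral integralE [in RHS]integralE.
rewrite (hs _ mp)// (hs _ mn)//.
have -> : (\int[leb]_x (fun x : RR => (f ((s * x)%R : RR))%:E)^\+ x)%E =
    (\int[leb]_x (EFin \o f)^\+%E ((s * x)%R : RR))%E.
  by apply: eq_integral => x _; rewrite !funeposE.
have -> : (\int[leb]_x (fun x : RR => (f ((s * x)%R : RR))%:E)^\- x)%E =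
    (\int[leb]_x (EFin \o f)^\-%E ((s * x)%R : RR))%E.
  by apply: eq_integral => x _; rewrite !funenegE.
by rewrite -(fineK fp) -(fineK fn) -!EFinM -!EFinB /=; ring.
Qed.

Section transform.
Variable h : RR -> R.
Hypothesis ih : leb.-integrable setT (EFin \o h).
Hypothesis sqh : sqint leb h.

(** For real [h] the Fourier transform at [w] is [fourierc w - i fouriers w]. *)
Definition fourierc (w : R) : R := \int[leb]_x (h x * cos (2 * pi * w * x)).
Definition fouriers (w : R) : R := \int[leb]_x (h x * sin (2 * pi * w * x)).

Let mh : measurable_fun setT h.
Proof. by apply/measurable_EFinP; exact: measurable_int ih. Qed.

Lemma measurable_phase2 (c : R) :
  measurable_fun setT (fun p : RR * RR => (c * p.1 * p.2 : R)).
Proof.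
apply: measurable_funM; last exact: measurable_snd.
by apply: measurable_funM => //; exact: measurable_fst.
Qed.

Let mhc : measurable_fun setT (fun p : RR * RR => h p.2 * cos (2 * pi * p.1 * p.2)).
Proof.
apply: measurable_funM; first exact: (measurableT_comp mh measurable_snd).
by apply: measurable_cosM; exact: measurable_phase2.
Qed.

Let mhs : measurable_fun setT (fun p : RR * RR => h p.2 * sin (2 * pi * p.1 * p.2)).
Proof.
apply: measurable_funM; first exact: (measurableT_comp mh measurable_snd).
by apply: measurable_sinM; exact: measurable_phase2.
Qed.

Lemma measurable_fourierc : measurable_fun setT (fourierc : RR -> R).
Proof. exact: (measurable_Rintegral2 leb mhc). Qed.

Lemma measurable_fouriers : measurable_fun setT (fouriers : RR -> R).
Proof. exact: (measurable_Rintegral2 leb mhs). Qed.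

Lemma integrable_bounded_mul (k : RR -> R) (M : R) : measurable_fun setT k ->
  (forall x, `|k x| <= M) -> leb.-integrable setT (EFin \o (fun x => h x * k x)).
Proof.
move=> mk kM; apply: (integrableMl measurableT ih mk).
by exists M; split; [exact: num_real|move=> z Mz x _ /=; apply: le_trans (ltW Mz)].
Qed.

Let N1 := \int[leb]_x `|h x|.

Lemma Rintegral_bounded_mul (k : RR -> R) : measurable_fun setT k ->
  (forall x, `|k x| <= 1) -> `|\int[leb]_x (h x * k x)| <= N1.
Proof.
move=> mk k1; have ik := integrable_bounded_mul mk k1.
apply: (le_trans (le_normr_Rintegral _ _)) => //.
apply: le_Rintegral => //; [exact: integrable_norm ik|exact: integrable_norm ih|].
by move=> x _; rewrite normrM ler_piMr.
Qed.

Let cos1 (x : R) : `|cos x| <= 1. Proof. by rewrite ler_norml cos_geN1 cos_le1. Qed.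
Let sin1 (x : R) : `|sin x| <= 1. Proof. by rewrite ler_norml sin_geN1 sin_le1. Qed.

Let mcw (w : R) : measurable_fun setT (fun x : RR => cos (2 * pi * w * x)).
Proof. by apply: measurable_cosM; apply: measurable_funM. Qed.
Let msw (w : R) : measurable_fun setT (fun x : RR => sin (2 * pi * w * x)).
Proof. by apply: measurable_sinM; apply: measurable_funM. Qed.

Lemma fourierc_bound w : `|fourierc w| <= N1.
Proof. by apply: Rintegral_bounded_mul. Qed.
Lemma fouriers_bound w : `|fouriers w| <= N1.
Proof. by apply: Rintegral_bounded_mul. Qed.

Let ch w := integrable_bounded_mul (mcw w) (fun x => cos1 _).
Let sh w := integrable_bounded_mul (msw w) (fun x => sin1 _).

(** Cosine of a difference. The squared modulus of the transform thus becomes an integral of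
    [cos (2 * pi * w * (y - x))], whose exponentially weighted integral over [w] is known. *)
Lemma fourier_shift w x :
  fourierc w * cos (2 * pi * w * x) + fouriers w * sin (2 * pi * w * x) =
  \int[leb]_y (h y * cos (2 * pi * w * (y - x))).
Proof.
have i1 := ch w; have i2 := sh w.
rewrite /fourierc /fouriers -RintegralZr// -RintegralZr//.
rewrite -RintegralD//; last 2 first.
- have := integrableZr measurableT (cos (2 * pi * w * x)) (ch w).
  by apply: eq_integrable => // y _.
- have := integrableZr measurableT (sin (2 * pi * w * x)) (sh w).
  by apply: eq_integrable => // y _.
by apply: eq_Rintegral => y _; rewrite mulrBr cosB; ring.
Qed.

Variable a : R.
Hypothesis a0 : 0 < a.

Let K := cauchyK a.
Let Kb u : `|K u| <= 2 / a.
Proof.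
rewrite ger0_norm ?cauchyK_ge0// /K /cauchyK.
move: (2 * pi * u) => v.
have D0 : 0 < a ^+ 2 + v ^+ 2 by rewrite ltr_pwDl ?exprn_gt0 ?sqr_ge0.
rewrite ler_pdivrMr// (_ : 2 / a * (a ^+ 2 + v ^+ 2) = 2 * a + 2 / a * v ^+ 2).
  by rewrite lerDl mulr_ge0 ?divr_ge0 ?sqr_ge0 ?ltW.
by field; rewrite gt_eqF.
Qed.

(** The exponential weight makes Fubini legitimate: integrating over [w] first produces the Cauchy
    kernel at [y - x], and the substitution [y = x + u] collects the autocorrelation. *)
Lemma integral_cauchy_energy :
  leb.-integrable setT (EFin \o (fun u => K u * autocorr h u)) /\
  \int[leb]_w (E a w * (fourierc w ^+ 2 + fouriers w ^+ 2)) =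
  \int[leb]_u (K u * autocorr h u).
Proof.
have iE := integrable_expabs a0.
pose k1 (p : RR * RR) : R :=
  fourierc p.1 * cos (2 * pi * p.1 * p.2) + fouriers p.1 * sin (2 * pi * p.1 * p.2).
have mk1 : measurable_fun setT k1.
  apply: measurable_funD; apply: measurable_funM.
  - exact: (measurableT_comp measurable_fourierc measurable_fst).
  - by apply: measurable_cosM; exact: measurable_phase2.
  - exact: (measurableT_comp measurable_fouriers measurable_fst).
  - by apply: measurable_sinM; exact: measurable_phase2.
have k1b p : `|k1 p| <= N1 + N1.
  apply: (le_trans (ler_normD _ _)); apply: lerD; rewrite normrM.
    by rewrite (le_trans _ (fourierc_bound p.1))// ler_piMr.
  by rewrite (le_trans _ (fouriers_bound p.1))// ler_piMr.
have -> : \int[leb]_w (E a w * (fourierc w ^+ 2 + fouriers w ^+ 2)) =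
    \int[leb]_w (E a w * \int[leb]_x (h x * k1 (w, x))).
  apply: eq_Rintegral => w _; congr (_ * _).
  transitivity (fourierc w * (\int[leb]_x (h x * cos (2 * pi * w * x))) +
    fouriers w * (\int[leb]_x (h x * sin (2 * pi * w * x)))); first by rewrite !expr2.
  have i1 := ch w; have i2 := sh w.
  rewrite -RintegralZl// -RintegralZl// -RintegralD//.
  - by apply: eq_Rintegral => x _; rewrite /k1 /=; ring.
  - by have := integrableZl measurableT (fourierc w) (ch w).
  - by have := integrableZl measurableT (fouriers w) (sh w).
rewrite (Rfubini_kernel iE ih mk1 k1b).
have -> : \int[leb]_x (h x * \int[leb]_w (E a w * k1 (w, x))) =
    \int[leb]_x (h x * \int[leb]_y (h y * K (y - x))).
  apply: eq_Rintegral => x _; congr (_ * _).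
  under eq_Rintegral do rewrite /k1 /= fourier_shift.
  pose k2 (p : RR * RR) : R := cos (2 * pi * p.1 * (p.2 - x)).
  have mk2 : measurable_fun setT k2.
    apply: measurable_cosM; apply: measurable_funM.
      by apply: measurable_funM => //; exact: measurable_fst.
    by apply: measurable_funB => //; exact: measurable_snd.
  rewrite (Rfubini_kernel (k := k2) iE ih mk2 (fun p => cos1 _)).
  by apply: eq_Rintegral => y _; rewrite /K -(integral_exp_cos a0).
have mK : measurable_fun setT (K : RR -> R) by exact: measurable_cauchyK.
have mxy : measurable_fun setT (fun p : RR * RR => (p.2 - p.1 : R) : RR).
  by apply: (@measurable_funB _ (RR * RR)%type _ setT); [exact: measurable_snd|exact: measurable_fst].
pose F (p : RR * RR) : R := h p.1 * h p.2 * K (p.2 - p.1).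
have iF : (prodm leb leb).-integrable setT (EFin \o F).
  have mKxy : measurable_fun setT (fun p : RR * RR => K (p.2 - p.1)).
    exact: (measurableT_comp mK mxy).
  have kb (p : RR * RR) : `|K (p.2 - p.1)| <= 2 / a by exact: Kb.
  exact: (integrable_kernel ih ih mKxy kb).
(* [G] is [F] after [y = x + u]; it inherits integrability from [F] by Tonelli and translation
   invariance. *)
pose G (p : RR * RR) : R := h p.1 * h ((p.2 + p.1)%R : RR) * K p.2.
have mG : measurable_fun setT G.
  apply: measurable_funM; last exact: (measurableT_comp mK measurable_snd).
  apply: measurable_funM; first exact: (measurableT_comp mh measurable_fst).
  apply: (measurableT_comp mh).
  by apply: (@measurable_funD _ (RR * RR)%type _ setT); [exact: measurable_snd|exact: measurable_fst].
have iG : (prodm leb leb).-integrable setT (EFin \o G).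
  have mF := measurable_int _ iF.
  apply/integrableP; split; first exact/measurable_EFinP.
  have mFa : measurable_fun setT (fun p => `|(EFin \o F) p|%E).
    exact: measurableT_comp.
  have mGa : measurable_fun setT (fun p => `|(EFin \o G) p|%E).
    by apply: measurableT_comp => //; exact/measurable_EFinP.
  have /integrableP[_] := iF.
  rewrite (prodm_tonelli1 leb leb mFa (fun _ => abse_ge0 _)).
  rewrite (prodm_tonelli1 leb leb mGa (fun _ => abse_ge0 _)) => iF'.
  have EFG : (\int[leb]_x \int[leb]_y `|(EFin \o G) (x, y)| =
    \int[leb]_x \int[leb]_y `|(EFin \o F) (x, y)|)%E.
    apply: eq_integral => x _.
    have mFx := measurableT_comp mFa (pair1_measurable x).
    rewrite -[RHS](ge0_integral_shift x mFx (fun _ => abse_ge0 _)).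
    by apply: eq_integral => y _; rewrite /F /G /= addrK.
  exact: (eq_ind_r (fun z => (z < +oo)%E) iF' EFG).
have -> : \int[leb]_x (h x * \int[leb]_y (h y * K (y - x))) =
    \int[leb]_x \int[leb]_u G (x, u).
  apply: eq_Rintegral => x _.
  have mhK : measurable_fun setT (fun y : RR => h y * K (y - x)).
    apply: measurable_funM => //; apply: (measurableT_comp mK).
    exact: (measurable_shift (- x)).
  rewrite -(Rintegral_shift x mhK) -RintegralZl//.
    by apply: eq_Rintegral => u _; rewrite /G /= addrK; ring.
  apply: (integrable_shift x (f := fun y => h y * K (y - x))).
  apply: integrable_bounded_mul (fun y => Kb _).
  by apply: (measurableT_comp mK); exact: (measurable_shift (- x)).
have eqA : (fun u : RR => K u * autocorr h u) = (fun u => \int[leb]_x G (x, u)).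
  apply/funext => u; rewrite /autocorr -RintegralZl//.
    by apply: eq_Rintegral => x _; rewrite /G /= [(u + x)%R]addrC mulrC.
  exact: (sqint_mul sqh (sqint_shift u sqh)).
split; last by rewrite (Rfubini iG) eqA.
rewrite eqA; exact: (Rfubini1 (prodm_swap iG)).1.
Qed.

End transform.

Lemma measurable_autocorr (h : RR -> R) : measurable_fun setT h ->
  measurable_fun setT (autocorr h : RR -> R).
Proof.
move=> mh; apply: (measurable_Rintegral2 leb (F := fun p : RR * RR => h p.2 * h ((p.2 + p.1)%R : RR))).
apply: measurable_funM; first exact: (measurableT_comp mh measurable_snd).
apply: (measurableT_comp mh).
by apply: (@measurable_funD _ (RR * RR)%type _ setT); [exact: measurable_snd|exact: measurable_fst].
Qed.

(** Rescaling reduces every kernel to the one with [a = 1], so that the limit in [a] has a single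
    integrable majorant. *)
Lemma cauchyK_scale (a v : R) : 0 < a -> cauchyK a (a * v) = a^-1 * cauchyK 1 v.
Proof.
move=> a0; rewrite /cauchyK; have -> : 2 * pi * (a * v) = a * (2 * pi * v) by ring.
move: (2 * pi * v) => w.
have -> : a ^+ 2 + (a * w) ^+ 2 = a ^+ 2 * (1 ^+ 2 + w ^+ 2) by ring.
have D0 : 0 < 1 ^+ 2 + w ^+ 2 by rewrite expr1n ltr_pwDl ?sqr_ge0.
move: (1 ^+ 2 + w ^+ 2) D0 => D D0; field.
by rewrite !gt_eqF.
Qed.

Section energy.
Variable h : RR -> R.
Hypothesis ih : leb.-integrable setT (EFin \o h).
Hypothesis sqh : sqint leb h.

Let mh : measurable_fun setT h. Proof. by case: sqh. Qed.
Let an (n : nat) : R := n.+1%:R^-1.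
Let an0 n : 0 < an n. Proof. by rewrite invr_gt0. Qed.

Let iKA n : leb.-integrable setT
  (EFin \o (fun v => cauchyK 1 v * autocorr h (an n * v))).
Proof.
apply: (integrableMl measurableT (integrable_cauchyK ltr01)).
  apply: (measurableT_comp (measurable_autocorr mh)).
  by have := @measurable_affine R (an n) 0; under eq_fun do rewrite addr0.
exists (\int[leb]_x (h x * h x)); split; first exact: num_real.
by move=> z Mz x _ /=; apply: le_trans (ltW Mz); exact: autocorr_bound.
Qed.

Let energy_an n : \int[leb]_w (E (an n) w * (fourierc h w ^+ 2 + fouriers h w ^+ 2)) =
  \int[leb]_v (cauchyK 1 v * autocorr h (an n * v)).
Proof.
have [i1 ->] := integral_cauchy_energy ih sqh (an0 n).
rewrite (Rintegral_scale (an0 n) i1).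
have -> : \int[leb]_x (cauchyK (an n) (an n * x) * autocorr h (an n * x)) =
    \int[leb]_x ((an n)^-1 * (cauchyK 1 x * autocorr h (an n * x))).
  apply: eq_Rintegral => x _; rewrite (cauchyK_scale x (an0 n)).
  exact: esym (mulrA _ _ _).
by rewrite RintegralZl// mulrA mulfV ?mul1r// gt_eqF.
Qed.

Let an_cvg0 : an n @[n --> \oo] --> (0 : R).
Proof.
exact: (@cvg_harmonic R).
Qed.

Let energy_lim :
  \int[leb]_w (E (an n) w * (fourierc h w ^+ 2 + fouriers h w ^+ 2)) @[n --> \oo]
  --> \int[leb]_x (h x * h x).
Proof.
under eq_fun do rewrite energy_an.
have -> : \int[leb]_x (h x * h x) = \int[leb]_v (cauchyK 1 v * autocorr h 0).
  have iK := integrable_cauchyK (@ltr01 R); rewrite RintegralZr//.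
  have -> : \int[leb]_v cauchyK 1 v = 1 by rewrite /Rintegral (integral_cauchyK ltr01).
  rewrite mul1r.
  by apply: eq_Rintegral => x _; rewrite addr0.
pose N := \int[leb]_x (h x * h x).
apply: (@Rintegral_dominated_cvg _ _ _ leb _ _ (fun v => cauchyK 1 v * N)).
- by move=> n; apply/measurable_EFinP; exact: measurable_int (iKA n).
- move=> v; apply: cvgM; first exact: cvg_cst.
  apply: autocorr_cvg => //.
  rewrite -[X in _ --> X](mul0r v).
  by apply: cvgM => //; exact: cvg_cst.
- have := integrableZr measurableT N (integrable_cauchyK (@ltr01 R)).
  by apply: eq_integrable => // x _.
- move=> n v; rewrite normrM ger0_norm ?cauchyK_ge0//.
  by apply: ler_wpM2l; [exact: cauchyK_ge0|exact: autocorr_bound].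
Qed.

Let P w := fourierc h w ^+ 2 + fouriers h w ^+ 2.

Lemma measurable_energy : measurable_fun setT (P : RR -> R).
Proof.
apply: measurable_funD; apply: measurable_funX.
  exact: measurable_fourierc.
exact: measurable_fouriers.
Qed.

(** The weighted energies have two limits along [a = 1 / (n + 1)]: the squared norm of [h], by
    continuity of the autocorrelation at 0, and the unweighted energy, by monotone convergence. The
    second limit needs no prior finiteness of the energy. *)
Lemma plancherel_real :
  (\int[leb]_w (fourierc h w ^+ 2 + fouriers h w ^+ 2)%:E =
   \int[leb]_x (h x ^+ 2)%:E)%E.
Proof.
have P0 w : 0 <= P w by rewrite addr_ge0 ?sqr_ge0.
have mP := measurable_energy.
pose N1 := \int[leb]_x `|h x|.
have PM w : `|P w| <= N1 ^+ 2 + N1 ^+ 2.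
  have N10 : 0 <= N1 by apply: Rintegral_ge0.
  rewrite ger0_norm// /P; apply: lerD; rewrite -[leLHS]real_normK ?num_real//;
    rewrite ler_sqr ?nnegrE//; [exact: fourierc_bound|exact: fouriers_bound].
have iEP n : leb.-integrable setT (EFin \o (fun w => E (an n) w * P w)).
  apply: (integrableMl measurableT (integrable_expabs (an0 n)) mP).
  exists (N1 ^+ 2 + N1 ^+ 2); split; first exact: num_real.
  by move=> z Mz x _ /=; apply: le_trans (ltW Mz).
rewrite -(sqint_normE sqh).
have lim1 : (\int[leb]_w (E (an n) w * P w)%:E)%E @[n --> \oo] -->
    (\int[leb]_x (h x * h x))%:E.
  have -> : (fun n => \int[leb]_w (E (an n) w * P w)%:E)%E =
      (fun n => (\int[leb]_w (E (an n) w * P w))%:E).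
    apply/funext => n; rewrite /Rintegral fineK//.
    exact: integrable_fin_num (iEP n).
  by apply: cvg_EFin; [exact: nearW|exact: energy_lim].
have lim2 : (\int[leb]_w (E (an n) w * P w)%:E)%E @[n --> \oo] -->
    (\int[leb]_w (P w)%:E)%E.
  have EL w : (fun n => (E (an n) w * P w)%:E) n @[n --> \oo] --> (P w)%:E.
    apply: cvg_EFin; first exact: nearW.
    have e0 : - an n * `|w| @[n --> \oo] --> (0 : R).
      have := cvgM (cvgN an_cvg0) (cvg_cst `|w|).
      by rewrite oppr0 mul0r; exact.
    have e1 : expR (- an n * `|w|) @[n --> \oo] --> expR (0 : R).
      by apply: continuous_cvg => //; exact: continuous_expR.
    have := cvgM e1 (cvg_cst (P w)).
    by rewrite expR0 mul1r; exact.
  have -> : (\int[leb]_w (P w)%:E = \int[leb]_w limn (fun n => (E (an n) w * P w)%:E))%E.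
    by apply: eq_integral => w _; apply/esym/cvg_lim => //; exact: EL.
  apply: cvg_monotone_convergence => //.
  - by move=> n; exact: measurable_int (iEP n).
  - by move=> n w _; rewrite lee_fin mulr_ge0 ?expR_ge0.
  - move=> w _ i j ij; rewrite lee_fin; apply: ler_wpM2r => //.
    rewrite ler_expR !mulNr lerN2; apply: ler_wpM2r => //.
    by rewrite lef_pV2 ?posrE// ler_nat ltnS.
exact: (cvg_unique _ lim2 lim1).
Qed.

End energy.

Lemma ge0_integral_reflect (f : RR -> \bar R) : measurable_fun setT f ->
  (forall x, 0 <= f x)%E -> (\int[leb]_x f ((- x)%R : RR) = \int[leb]_x f x)%E.
Proof.
move=> mf f0.
have mN : measurable_fun setT (fun x : RR => (- x)%R : RR).
  by apply: (@measurable_funN _ RR _ setT); exact: measurable_id.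
have := ge0_integral_pushforward mN leb measurableT mf (fun v _ => f0 v).
rewrite preimage_setT => <-.
by apply: eq_measure_integral => A mA _; exact: lebesgue_measureN.
Qed.

(** For [h1 + i h2] the cross terms between the two real transforms are odd in [w]: cosine
    transforms are even and sine transforms odd. Averaging the energy [Q] with its reflection [Q']
    leaves the sum of the two real energies. *)
Lemma plancherel (h1 h2 : RR -> R) :
  leb.-integrable setT (EFin \o h1) -> leb.-integrable setT (EFin \o h2) ->
  sqint leb h1 -> sqint leb h2 ->
  (\int[leb]_w ((fourierc h1 w + fouriers h2 w) ^+ 2 +
                (fourierc h2 w - fouriers h1 w) ^+ 2)%:E =
   \int[leb]_x (h1 x ^+ 2)%:E + \int[leb]_x (h2 x ^+ 2)%:E)%E.
Proof.
move=> i1 i2 s1 s2.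
have c1 := measurable_fourierc i1; have c2 := measurable_fourierc i2.
have t1 := measurable_fouriers i1; have t2 := measurable_fouriers i2.
pose Q (w : RR) : R := (fourierc h1 w + fouriers h2 w) ^+ 2 +
  (fourierc h2 w - fouriers h1 w) ^+ 2.
pose Q' (w : RR) : R := (fourierc h1 w - fouriers h2 w) ^+ 2 +
  (fourierc h2 w + fouriers h1 w) ^+ 2.
have mQ : measurable_fun setT (EFin \o Q).
  apply/measurable_EFinP; apply: measurable_funD; apply: measurable_funX.
    exact: measurable_funD.
  exact: measurable_funB.
have mQ' : measurable_fun setT (EFin \o Q').
  apply/measurable_EFinP; apply: measurable_funD; apply: measurable_funX.
    exact: measurable_funB.
  exact: measurable_funD.
have Q0 w : (0 <= (EFin \o Q) w)%E by rewrite lee_fin addr_ge0 ?sqr_ge0.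
have Q'0 w : (0 <= (EFin \o Q') w)%E by rewrite lee_fin addr_ge0 ?sqr_ge0.
have fcN h w : fourierc h (- w) = fourierc h w.
  by apply: eq_Rintegral => x _; rewrite mulrN mulNr cosN.
have fsN h w : leb.-integrable setT (EFin \o h) ->
    fouriers h (- w) = - fouriers h w.
  move=> ih; rewrite -[RHS]mulN1r /fouriers -RintegralZl//.
    by apply: eq_Rintegral => x _; rewrite mulrN mulNr sinN mulN1r mulrN.
  apply: (integrable_bounded_mul ih (M := 1)).
    by apply: measurable_sinM; apply: measurable_funM.
  by move=> x; rewrite ler_norml sin_geN1 sin_le1.
have E1 : (\int[leb]_w (EFin \o Q) w = \int[leb]_w (EFin \o Q') w)%E.
  rewrite -(ge0_integral_reflect mQ Q0); apply: eq_integral => w _ /=.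
  by rewrite /Q /Q' !fcN (fsN h1)// (fsN h2)// opprK.
have E2 : (\int[leb]_w (EFin \o Q) w + \int[leb]_w (EFin \o Q') w =
   2%:E * (\int[leb]_x (h1 x ^+ 2)%:E + \int[leb]_x (h2 x ^+ 2)%:E))%E.
  rewrite -ge0_integralD//.
  rewrite -(plancherel_real i1 s1) -(plancherel_real i2 s2).
  have m1 := measurable_energy i1; have m2 := measurable_energy i2.
  rewrite -ge0_integralD//; last 4 first.
  - by move=> x _; rewrite lee_fin addr_ge0 ?sqr_ge0.
  - exact/measurable_EFinP.
  - by move=> x _; rewrite lee_fin addr_ge0 ?sqr_ge0.
  - exact/measurable_EFinP.
  rewrite -ge0_integralZl_EFin//; last 2 first.
  - by move=> x _; rewrite lee_fin !addr_ge0 ?sqr_ge0.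
  - by apply: emeasurable_funD; exact/measurable_EFinP.
  apply: eq_integral => w _ /=; rewrite -!EFinD -EFinM /Q /Q'; congr EFin; ring.
have fin : (\int[leb]_x (h1 x ^+ 2)%:E + \int[leb]_x (h2 x ^+ 2)%:E)%E \is a fin_num.
  by rewrite -(sqint_normE s1) -(sqint_normE s2).
move: E2; rewrite -E1 -(fineK fin); move: (fine _) => r.
rewrite -/(\int[leb]_w (EFin \o Q) w)%E.
case: (\int[leb]_w (EFin \o Q) w)%E => [q||]//=.
by rewrite -EFinD -EFinM => -[] h; congr EFin; lra.
Qed.

End plancherel.

(** * Moyal's identity *)

Section tight_kernel.
Context dT dZ (T : measurableType dT) (Z : measurableType dZ) (R : realType).
Variable mu : {sigma_finite_measure set T -> \bar R}.
Variable nu : {sigma_finite_measure set Z -> \bar R}.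

Definition good_kernel (e : Z * T -> R) :=
  measurable_fun setT e /\ forall z, sqint mu (fun x => e (z, x)).

Variables e1 e2 : Z * T -> R.

(* Real and imaginary parts of the coefficient [<f1 + i f2, e1 + i e2>]. *)
Definition kre (f1 f2 : T -> R) (z : Z) : R :=
  \int[mu]_x (f1 x * e1 (z, x) + f2 x * e2 (z, x)).
Definition kim (f1 f2 : T -> R) (z : Z) : R :=
  \int[mu]_x (f2 x * e1 (z, x) - f1 x * e2 (z, x)).

(** A continuous Parseval frame: the coefficient map is an isometry from L2 over [mu] into L2 over
    [nu]. *)
Definition tight_kernel := forall f1 f2, sqint mu f1 -> sqint mu f2 ->
  (\int[nu]_z (kre f1 f2 z ^+ 2 + kim f1 f2 z ^+ 2)%:E =
   \int[mu]_x (f1 x ^+ 2)%:E + \int[mu]_x (f2 x ^+ 2)%:E)%E.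

Hypothesis g1 : good_kernel e1.
Hypothesis g2 : good_kernel e2.

Lemma measurable_kre f1 f2 : measurable_fun setT f1 -> measurable_fun setT f2 ->
  measurable_fun setT (kre f1 f2).
Proof.
move=> m1 m2; apply: (measurable_Rintegral2 mu
  (F := fun p : Z * T => f1 p.2 * e1 p + f2 p.2 * e2 p)).
apply: measurable_funD; apply: measurable_funM.
- exact: (measurableT_comp m1 measurable_snd).
- by case: g1.
- exact: (measurableT_comp m2 measurable_snd).
- by case: g2.
Qed.

Lemma measurable_kim f1 f2 : measurable_fun setT f1 -> measurable_fun setT f2 ->
  measurable_fun setT (kim f1 f2).
Proof.
move=> m1 m2; apply: (measurable_Rintegral2 mu
  (F := fun p : Z * T => f2 p.2 * e1 p - f1 p.2 * e2 p)).
apply: measurable_funB; apply: measurable_funM.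
- exact: (measurableT_comp m2 measurable_snd).
- by case: g1.
- exact: (measurableT_comp m1 measurable_snd).
- by case: g2.
Qed.

Lemma kreE f1 f2 z : sqint mu f1 -> sqint mu f2 ->
  kre f1 f2 z = \int[mu]_x (f1 x * e1 (z, x)) + \int[mu]_x (f2 x * e2 (z, x)).
Proof.
by move=> s1 s2; rewrite /kre RintegralD//; apply: sqint_mul => //; [exact: g1.2|exact: g2.2].
Qed.

Lemma kimE f1 f2 z : sqint mu f1 -> sqint mu f2 ->
  kim f1 f2 z = \int[mu]_x (f2 x * e1 (z, x)) - \int[mu]_x (f1 x * e2 (z, x)).
Proof.
by move=> s1 s2; rewrite /kim RintegralB//; apply: sqint_mul => //; [exact: g1.2|exact: g2.2].
Qed.

Lemma integrable_kre f1 f2 z : sqint mu f1 -> sqint mu f2 ->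
  mu.-integrable setT (EFin \o (fun x => f1 x * e1 (z, x) + f2 x * e2 (z, x))).
Proof.
move=> s1 s2.
by have := integrableD measurableT (sqint_mul s1 (g1.2 z)) (sqint_mul s2 (g2.2 z)).
Qed.

Lemma integrable_kim f1 f2 z : sqint mu f1 -> sqint mu f2 ->
  mu.-integrable setT (EFin \o (fun x => f2 x * e1 (z, x) - f1 x * e2 (z, x))).
Proof.
move=> s1 s2.
by have := integrableB measurableT (sqint_mul s2 (g1.2 z)) (sqint_mul s1 (g2.2 z)).
Qed.

End tight_kernel.

Lemma ae_eq_Rintegral d (T : measurableType d) (R : realType)
    (mu : {measure set T -> \bar R}) (f g : T -> R) :
  measurable_fun setT f -> measurable_fun setT g ->
  {ae mu, forall x, f x = g x} -> \int[mu]_x f x = \int[mu]_x g x.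
Proof.
move=> mf mg fg; congr fine; apply: ae_eq_integral => //.
- exact/measurable_EFinP.
- exact/measurable_EFinP.
by move: fg; apply: filterS => x fgx _; rewrite fgx.
Qed.

Section sqint_product.
Context d1 d2 (T1 : measurableType d1) (T2 : measurableType d2) (R : realType).
Variable m1 : {sigma_finite_measure set T1 -> \bar R}.
Variable m2 : {sigma_finite_measure set T2 -> \bar R}.

Lemma sqint_tensor (f : T1 -> R) (g : T2 -> R) : sqint m1 f -> sqint m2 g ->
  sqint (prodm m1 m2) (fun p => f p.1 * g p.2).
Proof.
move=> [mf fi] [mg gi].
have mfg : measurable_fun setT (fun p : T1 * T2 => f p.1 * g p.2).
  apply: measurable_funM; first exact: (measurableT_comp mf measurable_fst).
  exact: (measurableT_comp mg measurable_snd).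
split => //.
rewrite (prodm_tonelli1 _ _ (measurable_sqrE mfg)); last by move=> z; rewrite lee_fin sqr_ge0.
have -> : (\int[m1]_x \int[m2]_y ((f x * g y) ^+ 2)%:E =
    \int[m1]_x ((f x ^+ 2)%:E * \int[m2]_y (g y ^+ 2)%:E))%E.
  apply: eq_integral => x _; rewrite -ge0_integralZl_EFin//.
  - by apply: eq_integral => y _; rewrite exprMn EFinM.
  - by move=> y _; rewrite lee_fin sqr_ge0.
  - exact: measurable_sqrE.
  - exact: sqr_ge0.
rewrite ge0_integralZr//.
- rewrite lte_mul_pinfty ?sqr_int_ge0//.
  by rewrite ge0_fin_numE ?sqr_int_ge0.
- exact: measurable_sqrE.
- by move=> x _; rewrite lee_fin sqr_ge0.
- exact: sqr_int_ge0.
Qed.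

Lemma sqint_section (f : T1 * T2 -> R) : sqint (prodm m1 m2) f ->
  {ae m1, forall x, sqint m2 (fun y => f (x, y))}.
Proof.
move=> sf; have := ae_integrable1 (sqint_integrable sf).
apply: filterS => x /integrableP[_ h]; split.
  exact: (measurableT_comp sf.1 (pair1_measurable x)).
apply: le_lt_trans h; rewrite le_eqVlt; apply/orP; left; apply/eqP.
by apply: eq_integral => y _; rewrite gee0_abs ?lee_fin ?sqr_ge0.
Qed.

End sqint_product.

(** * Tensor products of tight kernels *)

Section tensor.
Context dT1 dZ1 (T1 : measurableType dT1) (Z1 : measurableType dZ1).
Context dT2 dZ2 (T2 : measurableType dT2) (Z2 : measurableType dZ2) (R : realType).
Variable mu1 : {sigma_finite_measure set T1 -> \bar R}.
Variable nu1 : {sigma_finite_measure set Z1 -> \bar R}.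
Variable mu2 : {sigma_finite_measure set T2 -> \bar R}.
Variable nu2 : {sigma_finite_measure set Z2 -> \bar R}.
Variables (e1 e2 : Z1 * T1 -> R) (k1 k2 : Z2 * T2 -> R).
Hypothesis ge1 : good_kernel mu1 e1.
Hypothesis ge2 : good_kernel mu1 e2.
Hypothesis gk1 : good_kernel mu2 k1.
Hypothesis gk2 : good_kernel mu2 k2.
Hypothesis te : tight_kernel mu1 nu1 e1 e2.
Hypothesis tk : tight_kernel mu2 nu2 k1 k2.

Definition tensor_re (p : (Z1 * Z2) * (T1 * T2)) : R :=
  e1 (p.1.1, p.2.1) * k1 (p.1.2, p.2.2) - e2 (p.1.1, p.2.1) * k2 (p.1.2, p.2.2).
Definition tensor_im (p : (Z1 * Z2) * (T1 * T2)) : R :=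
  e1 (p.1.1, p.2.1) * k2 (p.1.2, p.2.2) + e2 (p.1.1, p.2.1) * k1 (p.1.2, p.2.2).

Let mpe (e : Z1 * T1 -> R) : measurable_fun setT e ->
  measurable_fun setT (fun p : (Z1 * Z2) * (T1 * T2) => e (p.1.1, p.2.1)).
Proof.
move=> me; apply: (measurableT_comp me); apply: measurable_fun_pair.
  exact: (measurableT_comp measurable_fst measurable_fst).
exact: (measurableT_comp measurable_fst measurable_snd).
Qed.

Let mpk (k : Z2 * T2 -> R) : measurable_fun setT k ->
  measurable_fun setT (fun p : (Z1 * Z2) * (T1 * T2) => k (p.1.2, p.2.2)).
Proof.
move=> me; apply: (measurableT_comp me); apply: measurable_fun_pair.
  exact: (measurableT_comp measurable_snd measurable_fst).
exact: (measurableT_comp measurable_snd measurable_snd).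
Qed.

Lemma good_tensor_re : good_kernel (prodm mu1 mu2) tensor_re.
Proof.
split.
  apply: measurable_funB; apply: measurable_funM.
  - by apply: mpe; case: ge1.
  - by apply: mpk; case: gk1.
  - by apply: mpe; case: ge2.
  - by apply: mpk; case: gk2.
move=> z; exact: (sqintB (sqint_tensor (ge1.2 z.1) (gk1.2 z.2))
  (sqint_tensor (ge2.2 z.1) (gk2.2 z.2))).
Qed.

Lemma good_tensor_im : good_kernel (prodm mu1 mu2) tensor_im.
Proof.
split.
  apply: measurable_funD; apply: measurable_funM.
  - by apply: mpe; case: ge1.
  - by apply: mpk; case: gk2.
  - by apply: mpe; case: ge2.
  - by apply: mpk; case: gk1.
move=> z; exact: (sqintD (sqint_tensor (ge1.2 z.1) (gk2.2 z.2))
  (sqint_tensor (ge2.2 z.1) (gk1.2 z.2))).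
Qed.

(** Two isometries in succession: the second variable is transformed with the first one fixed, then
    the first variable with [z2] fixed. Tonelli reorders the energy in between. *)
Lemma tight_tensor :
  tight_kernel (prodm mu1 mu2) (prodm nu1 nu2) tensor_re tensor_im.
Proof.
move=> f1 f2 s1 s2.
have [m1 _] := s1; have [m2 _] := s2.
(* [F1] and [F2] are the real and imaginary parts of the transform in the second variable only. *)
pose F1 (q : T1 * Z2) : R := kre mu2 k1 k2 (fun y => f1 (q.1, y)) (fun y => f2 (q.1, y)) q.2.
pose F2 (q : T1 * Z2) : R := kim mu2 k1 k2 (fun y => f1 (q.1, y)) (fun y => f2 (q.1, y)) q.2.
have mfq (f : T1 * T2 -> R) : measurable_fun setT f ->
    measurable_fun setT (fun r : (T1 * Z2) * T2 => f (r.1.1, r.2)).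
  move=> mf; apply: (measurableT_comp mf); apply: measurable_fun_pair => //.
  exact: (measurableT_comp measurable_fst measurable_fst).
have mkq (k : Z2 * T2 -> R) : measurable_fun setT k ->
    measurable_fun setT (fun r : (T1 * Z2) * T2 => k (r.1.2, r.2)).
  move=> mf; apply: (measurableT_comp mf); apply: measurable_fun_pair => //.
  exact: (measurableT_comp measurable_snd measurable_fst).
have mF1 : measurable_fun setT F1.
  apply: (measurable_Rintegral2 mu2 (F := fun r : (T1 * Z2) * T2 =>
    f1 (r.1.1, r.2) * k1 (r.1.2, r.2) + f2 (r.1.1, r.2) * k2 (r.1.2, r.2))).
  by apply: measurable_funD; apply: measurable_funM; [exact: mfq|apply: mkq; case: gk1|exact: mfq|apply: mkq; case: gk2].
have mF2 : measurable_fun setT F2.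
  apply: (measurable_Rintegral2 mu2 (F := fun r : (T1 * Z2) * T2 =>
    f2 (r.1.1, r.2) * k1 (r.1.2, r.2) - f1 (r.1.1, r.2) * k2 (r.1.2, r.2))).
  by apply: measurable_funB; apply: measurable_funM; [exact: mfq|apply: mkq; case: gk1|exact: mfq|apply: mkq; case: gk2].
pose F (q : T1 * Z2) : \bar R := (F1 q ^+ 2 + F2 q ^+ 2)%:E.
have mF : measurable_fun setT F.
  by apply/measurable_EFinP; apply: measurable_funD; exact: measurable_funX.
have F0 q : (0 <= F q)%E by rewrite lee_fin addr_ge0 ?sqr_ge0.
have ae12 : {ae mu1, forall x, sqint mu2 (fun y => f1 (x, y)) /\
    sqint mu2 (fun y => f2 (x, y))}.
  by move: (sqint_section s1) (sqint_section s2); apply: filterS2 => x.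
have msec (f : T1 * T2 -> R) : measurable_fun setT f ->
    measurable_fun setT (fun x => \int[mu2]_y (f (x, y) ^+ 2)%:E)%E.
  by move=> mf; apply: (measurable_integral2 mu2 (f := fun p => (f p ^+ 2)%:E)); exact: measurable_sqrE.
(* Tightness of the second kernel on each slice; slices of a square-integrable function are square
   integrable only almost everywhere. *)
have norm1 : (\int[mu1]_x \int[nu2]_z F (x, z) =
   \int[prodm mu1 mu2]_p (f1 p ^+ 2)%:E + \int[prodm mu1 mu2]_p (f2 p ^+ 2)%:E)%E.
  rewrite (prodm_tonelli1 _ _ (measurable_sqrE m1)); last by move=> z; rewrite lee_fin sqr_ge0.
  rewrite (prodm_tonelli1 _ _ (measurable_sqrE m2)); last by move=> z; rewrite lee_fin sqr_ge0.
  rewrite -ge0_integralD//; last 4 first.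
  - by move=> x _; exact: sqr_int_ge0.
  - exact: msec.
  - by move=> x _; exact: sqr_int_ge0.
  - exact: msec.
  apply: ge0_ae_eq_integral => //.
  - exact: (measurable_integral2 nu2 mF).
  - by apply: emeasurable_funD; exact: msec.
  - by move=> x _; exact: integral_ge0.
  - by move=> x _; apply: adde_ge0; exact: sqr_int_ge0.
  by move: ae12; apply: filterS => x [sx1 sx2] _; exact: (tk sx1 sx2).
rewrite -norm1 (@fubini_tonelli _ _ _ _ _ mu1 nu2 F mF F0).
have gtr := good_tensor_re; have gti := good_tensor_im.
have mK : measurable_fun setT (fun z =>
    (kre (prodm mu1 mu2) tensor_re tensor_im f1 f2 z ^+ 2 +
     kim (prodm mu1 mu2) tensor_re tensor_im f1 f2 z ^+ 2)%:E).
  apply/measurable_EFinP; apply: measurable_funD; apply: measurable_funX.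
    exact: measurable_kre.
  exact: measurable_kim.
rewrite (prodm_tonelli2 _ _ mK); last by move=> z; rewrite lee_fin addr_ge0 ?sqr_ge0.
apply: ge0_ae_eq_integral => //.
- have mK' := measurableT_comp mK (measurable_swap (T1 := Z2) (T2 := Z1)).
  exact: (measurable_integral2 nu1 mK').
- have mF' := measurableT_comp mF (measurable_swap (T1 := Z2) (T2 := T1)).
  exact: (measurable_integral2 mu1 mF').
- by move=> x _; apply: integral_ge0 => z _; rewrite lee_fin addr_ge0 ?sqr_ge0.
- by move=> x _; exact: integral_ge0.
have iF : (prodm mu1 nu2).-integrable setT F.
  apply/integrableP; split => //.
  under eq_integral do rewrite gee0_abs//.
  rewrite prodm_tonelli1// norm1 lte_add_pinfty//; [by case: s1|by case: s2].
have := ae_integrable2 iF.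
apply: filterS => z2 /integrableP[_ iFz] _.
have mF1z : measurable_fun setT (fun x => F1 (x, z2)).
  exact: (measurableT_comp mF1 (pair2_measurable z2)).
have mF2z : measurable_fun setT (fun x => F2 (x, z2)).
  exact: (measurableT_comp mF2 (pair2_measurable z2)).
have sF1 : sqint mu1 (fun x => F1 (x, z2)).
  split => //; apply: le_lt_trans iFz; apply: ge0_le_integral => //.
  - by move=> x _; rewrite lee_fin sqr_ge0.
  - exact: measurable_sqrE.
  - by apply: measurableT_comp => //; exact: (measurableT_comp mF (pair2_measurable z2)).
  - by move=> x _; rewrite gee0_abs// lee_fin lerDl sqr_ge0.
have sF2 : sqint mu1 (fun x => F2 (x, z2)).
  split => //; apply: le_lt_trans iFz; apply: ge0_le_integral => //.
  - by move=> x _; rewrite lee_fin sqr_ge0.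
  - exact: measurable_sqrE.
  - by apply: measurableT_comp => //; exact: (measurableT_comp mF (pair2_measurable z2)).
  - by move=> x _; rewrite gee0_abs// lee_fin lerDr sqr_ge0.
(* On a good slice [z2] the full coefficient is the first-variable coefficient of the partial
   transform, by Fubini on [T1 * T2]. *)
have kreT z1 : kre (prodm mu1 mu2) tensor_re tensor_im f1 f2 (z1, z2) =
    kre mu1 e1 e2 (fun x => F1 (x, z2)) (fun x => F2 (x, z2)) z1.
  rewrite /kre (Rfubini1 (integrable_kre gtr gti (z1, z2) s1 s2)).2.
  apply: ae_eq_Rintegral.
  - by apply/measurable_EFinP; apply: measurable_int (Rfubini1 (integrable_kre gtr gti (z1, z2) s1 s2)).1.
  - by apply/measurable_EFinP; exact: measurable_int (integrable_kre ge1 ge2 z1 sF1 sF2).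
  move: ae12; apply: filterS => x [sx1 sx2].
  rewrite /F1 /F2 /=.
  rewrite /kre /kim -RintegralZr//; last exact: (integrable_kre gk1 gk2 z2 sx1 sx2).
  rewrite -RintegralZr//; last exact: (integrable_kim gk1 gk2 z2 sx1 sx2).
  rewrite -RintegralD//.
  - by apply: eq_Rintegral => y _; rewrite /tensor_re /tensor_im /=; ring.
  - have := integrableZr measurableT (e1 (z1, x)) (integrable_kre gk1 gk2 z2 sx1 sx2).
    by apply: eq_integrable => // y _.
  - have := integrableZr measurableT (e2 (z1, x)) (integrable_kim gk1 gk2 z2 sx1 sx2).
    by apply: eq_integrable => // y _.
have kimT z1 : kim (prodm mu1 mu2) tensor_re tensor_im f1 f2 (z1, z2) =
    kim mu1 e1 e2 (fun x => F1 (x, z2)) (fun x => F2 (x, z2)) z1.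
  rewrite /kim (Rfubini1 (integrable_kim gtr gti (z1, z2) s1 s2)).2.
  apply: ae_eq_Rintegral.
  - by apply/measurable_EFinP; apply: measurable_int (Rfubini1 (integrable_kim gtr gti (z1, z2) s1 s2)).1.
  - by apply/measurable_EFinP; exact: measurable_int (integrable_kim ge1 ge2 z1 sF1 sF2).
  move: ae12; apply: filterS => x [sx1 sx2].
  rewrite /F1 /F2 /=.
  rewrite /kre /kim -RintegralZr//; last exact: (integrable_kim gk1 gk2 z2 sx1 sx2).
  rewrite -RintegralZr//; last exact: (integrable_kre gk1 gk2 z2 sx1 sx2).
  rewrite -RintegralB//.
  - by apply: eq_Rintegral => y _; rewrite /tensor_re /tensor_im /=; ring.
  - have := integrableZr measurableT (e1 (z1, x)) (integrable_kim gk1 gk2 z2 sx1 sx2).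
    by apply: eq_integrable => // y _.
  - have := integrableZr measurableT (e2 (z1, x)) (integrable_kre gk1 gk2 z2 sx1 sx2).
    by apply: eq_integrable => // y _.
under eq_integral do rewrite kreT kimT.
rewrite te// -ge0_integralD//.
- by move=> x _; rewrite lee_fin sqr_ge0.
- exact: measurable_sqrE.
- by move=> x _; rewrite lee_fin sqr_ge0.
- exact: measurable_sqrE.
Qed.

End tensor.

(** * Time-frequency atoms, and Moyal's identity on the line *)

Section moyal.
Variable R : realType.
Notation leb := (@lebesgue_measure R).
Notation RR := (measurableTypeR R).
Notation vec m := (rvec R m).
Notation mu m := (rvec_measure R m).

Definition window m (v : 'rV[R]_m) : R := \1_(@box R m 0 1) (v : vec m).

Definition phase m (w x : 'rV[R]_m) : R := 2 * pi * \sum_(j < m) w ord0 j * x ord0 j.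

Definition atomc m (p : (vec m * vec m) * vec m) : R :=
  window ((p.2 : 'rV[R]_m) - (p.1.1 : 'rV[R]_m)) * cos (phase p.1.2 p.2).
Definition atoms m (p : (vec m * vec m) * vec m) : R :=
  window ((p.2 : 'rV[R]_m) - (p.1.1 : 'rV[R]_m)) * sin (phase p.1.2 p.2).

Lemma measurable_window m : measurable_fun setT (fun v : vec m => window v).
Proof. by apply: measurable_indic; exact: measurable_box. Qed.

Lemma measurable_rvecB d (T : measurableType d) m (f g : T -> vec m) :
  measurable_fun setT f -> measurable_fun setT g ->
  measurable_fun setT (fun x => ((f x : 'rV[R]_m) - (g x : 'rV[R]_m))%R : vec m).
Proof.
move=> mf mg; apply: measurable_rvecP => i.
under eq_fun do rewrite !mxE.
by apply: measurable_funB; apply: (measurableT_comp (@measurable_coord R m i)).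
Qed.

Lemma measurable_phase d (T : measurableType d) m (f g : T -> vec m) :
  measurable_fun setT f -> measurable_fun setT g ->
  measurable_fun setT (fun x => phase (f x) (g x)).
Proof.
move=> mf mg; apply: measurable_funM => //.
apply: measurable_sum => j.
by apply: measurable_funM; apply: (measurableT_comp (@measurable_coord R m j)).
Qed.

Let mw m : measurable_fun setT (fun p : (vec m * vec m) * vec m =>
  window ((p.2 : 'rV[R]_m) - (p.1.1 : 'rV[R]_m))).
Proof.
apply: (measurableT_comp (@measurable_window m)).
apply: measurable_rvecB => //.
exact: (measurableT_comp measurable_fst measurable_fst).
Qed.

Let mph m : measurable_fun setT (fun p : (vec m * vec m) * vec m => phase p.1.2 p.2).
Proof.
by apply: measurable_phase => //; exact: (measurableT_comp measurable_snd measurable_fst).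
Qed.

Lemma window01 m (v : 'rV[R]_m) : 0 <= window v <= 1.
Proof. by rewrite /window indicE; case: (_ \in _); rewrite ?lexx ?ler01. Qed.

Lemma integral_window m (t : 'rV[R]_m) :
  (\int[mu m]_x (window ((x : 'rV[R]_m) - t))%:E = 1)%E.
Proof.
have := ge0_integral_affine (@ltr01 R) (- t) (f := fun x : vec m => (window x)%:E).
rewrite expr1n mul1e => E.
transitivity (\int[mu m]_x (window x)%:E)%E.
  rewrite E.
  - by apply: eq_integral => x _; rewrite scale1r.
  - by apply/measurable_EFinP; exact: measurable_window.
  - by move=> x; rewrite lee_fin; case/andP: (window01 x).
rewrite /window integral_indic//; last exact: measurable_box.
by rewrite setIT [LHS](@rvec_measure_box R m 0 1 ler01) subr0 expr1n.
Qed.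

Lemma sqint_windowed m (t : 'rV[R]_m) (u : vec m -> R) : measurable_fun setT u ->
  (forall x, `|u x| <= 1) ->
  sqint (mu m) (fun x => window ((x : 'rV[R]_m) - t) * u x).
Proof.
move=> mu_ u1.
have mwt : measurable_fun setT (fun x : vec m => window ((x : 'rV[R]_m) - t)).
  apply: (measurableT_comp (@measurable_window m)).
  by apply: measurable_rvecB => //; exact: measurable_cst.
have mf : measurable_fun setT (fun x : vec m => window ((x : 'rV[R]_m) - t) * u x).
  exact: measurable_funM.
split => //.
apply: (@le_lt_trans _ _ (\int[mu m]_x (window ((x : 'rV[R]_m) - t))%:E)%E); last first.
  by rewrite integral_window ltry.
apply: ge0_le_integral => //.
- by move=> x _; rewrite lee_fin sqr_ge0.
- exact: measurable_sqrE.
- exact/measurable_EFinP.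
- move=> x _; rewrite lee_fin exprMn.
  have /andP[w0 window1] := window01 ((x : 'rV[R]_m) - t).
  have u2 : u x ^+ 2 <= 1 by rewrite -[leLHS]real_normK ?num_real// expr_le1.
  apply: (@le_trans _ _ (window ((x : 'rV[R]_m) - t) ^+ 2)).
    by rewrite ler_piMr ?sqr_ge0.
  by rewrite expr2 ler_piMr.
Qed.

Lemma good_atomc m : good_kernel (mu m) (@atomc m).
Proof.
split; first by apply: measurable_funM => //; exact: measurable_cosM.
move=> [t w]; apply: sqint_windowed.
  apply: measurable_cosM.
  exact: (measurable_phase (f := fun=> w) (g := id) (measurable_cst w) (@measurable_id _ _ setT)).
by move=> x; rewrite ler_norml cos_geN1 cos_le1.
Qed.

Lemma good_atoms m : good_kernel (mu m) (@atoms m).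
Proof.
split; first by apply: measurable_funM => //; exact: measurable_sinM.
move=> [t w]; apply: sqint_windowed.
  apply: measurable_sinM.
  exact: (measurable_phase (f := fun=> w) (g := id) (measurable_cst w) (@measurable_id _ _ setT)).
by move=> x; rewrite ler_norml sin_geN1 sin_le1.
Qed.

(** The one-dimensional atom lives on the line itself, where Plancherel is available; it is the
    scalar factor of the vector atoms. *)
Definition window1 (x : R) : R := \1_(`[0, 1]%classic : set RR) (x : RR).
Definition atom1c (p : (RR * RR) * RR) : R := window1 (p.2 - p.1.1) * cos (2 * pi * p.1.2 * p.2).
Definition atom1s (p : (RR * RR) * RR) : R := window1 (p.2 - p.1.1) * sin (2 * pi * p.1.2 * p.2).

Let mw1 : measurable_fun setT (window1 : RR -> R).
Proof. by apply: measurable_indic; exact: measurable_itv. Qed.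

Let mw1p : measurable_fun setT (fun p : (RR * RR) * RR => window1 (p.2 - p.1.1)).
Proof.
apply: (measurableT_comp mw1).
apply: (@measurable_funB _ ((RR * RR) * RR)%type _ setT); first exact: measurable_snd.
exact: (measurableT_comp measurable_fst measurable_fst).
Qed.

Let mph1 : measurable_fun setT (fun p : (RR * RR) * RR => 2 * pi * p.1.2 * p.2 : R).
Proof.
apply: measurable_funM; last exact: measurable_snd.
by apply: measurable_funM => //; exact: (measurableT_comp measurable_snd measurable_fst).
Qed.

Let w1_01 x : 0 <= window1 x <= 1.
Proof. by rewrite /window1 indicE; case: (_ \in _); rewrite ?lexx ?ler01. Qed.

Let mw1t (t : RR) : measurable_fun setT (fun x : RR => window1 (x - t)).
Proof. exact: (measurableT_comp mw1 (measurable_shift (- t))). Qed.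

Let int_w1 (t : RR) : (\int[leb]_x (window1 (x - t))%:E = 1)%E.
Proof.
have mE : measurable_fun setT (fun x : RR => (window1 x)%:E) by exact/measurable_EFinP.
have E0 (x : RR) : (0 <= (window1 x)%:E)%E by rewrite lee_fin; case/andP: (w1_01 x).
have -> := ge0_integral_shift (- t) mE E0.
rewrite /window1 integral_indic//.
by rewrite setIT [LHS](lebesgue_measure_itv `[0, 1])/= lte_fin ltr01 sube0.
Qed.

Let sq_w1 (t : RR) (u : RR -> R) : measurable_fun setT u ->
  (forall x, `|u x| <= 1) -> sqint leb (fun x => window1 (x - t) * u x).
Proof.
move=> mu_ u1.
have mf : measurable_fun setT (fun x : RR => window1 (x - t) * u x) by exact: measurable_funM.
split => //.
apply: (@le_lt_trans _ _ (\int[leb]_x (window1 (x - t))%:E)%E); last by rewrite int_w1 ltry.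
apply: ge0_le_integral => //.
- by move=> x _; rewrite lee_fin sqr_ge0.
- exact: measurable_sqrE.
- exact/measurable_EFinP.
- move=> x _; rewrite lee_fin exprMn.
  have /andP[w10 w11] := w1_01 (x - t).
  have u2 : u x ^+ 2 <= 1 by rewrite -[leLHS]real_normK ?num_real// expr_le1.
  apply: (@le_trans _ _ (window1 (x - t) ^+ 2)); first by rewrite ler_piMr ?sqr_ge0.
  by rewrite expr2 ler_piMr.
Qed.

Lemma good_atom1c : good_kernel leb atom1c.
Proof.
split; first by apply: measurable_funM => //; exact: measurable_cosM.
move=> [t w]; apply: sq_w1.
  by apply: measurable_cosM; exact: (@measurable_funM _ RR _ setT (fun=> 2 * pi * w) id).
by move=> x; rewrite ler_norml cos_geN1 cos_le1.
Qed.

Lemma good_atom1s : good_kernel leb atom1s.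
Proof.
split; first by apply: measurable_funM => //; exact: measurable_sinM.
move=> [t w]; apply: sq_w1.
  by apply: measurable_sinM; exact: (@measurable_funM _ RR _ setT (fun=> 2 * pi * w) id).
by move=> x; rewrite ler_norml sin_geN1 sin_le1.
Qed.

(** For fixed [t] the coefficients are the Fourier transform of [f] cut to [[t, t + 1]], so
    Plancherel in [w] gives the energy of that piece. Integrating over [t] restores [f], since the
    translates covering a given [x] form an interval of length 1. *)
Lemma tight_atom1 : tight_kernel leb (prodm leb leb) atom1c atom1s.
Proof.
move=> f1 f2 s1 s2.
have [m1 _] := s1; have [m2 _] := s2.
have gc := good_atom1c; have gs := good_atom1s.
have sw (t : RR) : sqint leb (fun x => window1 (x - t)).
  have mc : measurable_fun setT (fun _ : RR => 1 : R) by exact: measurable_cst.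
  have n1 (x : RR) : `|1 : R| <= 1 by rewrite normr1.
  have := sq_w1 t (u := fun=> 1) mc n1.
  by congr sqint; apply/funext => x; rewrite mulr1.
pose h (f : RR -> R) (t : RR) (x : RR) : R := f x * window1 (x - t).
have ih f t : sqint leb f -> leb.-integrable setT (EFin \o h f t).
  by move=> sf; exact: (sqint_mul sf (sw t)).
have sh f t : sqint leb f -> sqint leb (h f t).
  move=> [mf fi]; have mh : measurable_fun setT (h f t) by exact: measurable_funM.
  split => //; apply: le_lt_trans fi; apply: ge0_le_integral => //.
  - by move=> x _; rewrite lee_fin sqr_ge0.
  - exact: measurable_sqrE.
  - exact: measurable_sqrE.
  - move=> x _; rewrite lee_fin exprMn ler_piMr ?sqr_ge0//.
    by have /andP[w0 window1'] := w1_01 (x - t); rewrite expr_le1.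
have mK : measurable_fun setT (fun z =>
    (kre leb atom1c atom1s f1 f2 z ^+ 2 + kim leb atom1c atom1s f1 f2 z ^+ 2)%:E).
  apply/measurable_EFinP; apply: measurable_funD; apply: measurable_funX.
    exact: measurable_kre.
  exact: measurable_kim.
rewrite (prodm_tonelli1 _ _ mK); last by move=> z; rewrite lee_fin addr_ge0 ?sqr_ge0.
have E t : (\int[leb]_w (kre leb atom1c atom1s f1 f2 (t, w) ^+ 2 +
     kim leb atom1c atom1s f1 f2 (t, w) ^+ 2)%:E =
   \int[leb]_x (h f1 t x ^+ 2)%:E + \int[leb]_x (h f2 t x ^+ 2)%:E)%E.
  rewrite -plancherel; [|exact: ih|exact: ih|exact: sh|exact: sh].
  apply: eq_integral => w _; rewrite kreE// kimE//.
  have F f : \int[leb]_x (f x * atom1c ((t, w), x)) = fourierc (h f t) w.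
    by apply: eq_Rintegral => x _; rewrite /atom1c /h /= mulrA.
  have S f : \int[leb]_x (f x * atom1s ((t, w), x)) = fouriers (h f t) w.
    by apply: eq_Rintegral => x _; rewrite /atom1s /h /= mulrA.
  by rewrite !F !S.
have norm f : sqint leb f ->
    (\int[leb]_t \int[leb]_x (h f t x ^+ 2)%:E = \int[leb]_x (f x ^+ 2)%:E)%E /\
    measurable_fun setT (fun t => \int[leb]_x (h f t x ^+ 2)%:E)%E.
  move=> sf; have [mf _] := sf.
  have mH : measurable_fun setT (fun p : RR * RR => (h f p.1 p.2 ^+ 2)%:E).
    apply: measurable_sqrE; apply: measurable_funM.
      exact: (measurableT_comp mf measurable_snd).
    apply: (measurableT_comp mw1).
    by apply: (@measurable_funB _ (RR * RR)%type _ setT); [exact: measurable_snd|exact: measurable_fst].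
  split; last exact: (measurable_integral2 leb mH).
  have H0 (p : RR * RR) : (0 <= (h f p.1 p.2 ^+ 2)%:E)%E by rewrite lee_fin sqr_ge0.
  rewrite (@fubini_tonelli _ _ _ _ _ leb leb _ mH H0).
  apply: eq_integral => x _ /=.
  have mwx : measurable_fun setT (fun t : RR => (window1 (x - t) ^+ 2)%:E).
    apply: measurable_sqrE; apply: (measurableT_comp mw1).
    by apply: (@measurable_funB _ RR _ setT); [exact: measurable_cst|exact: measurable_id].
  have -> : (\int[leb]_t (h f t x ^+ 2)%:E =
     \int[leb]_t ((f x ^+ 2)%:E * (window1 (x - t) ^+ 2)%:E))%E.
    by apply: eq_integral => t _; rewrite /h exprMn EFinM.
  rewrite ge0_integralZl_EFin//; last 2 first.
  - by move=> t _; rewrite lee_fin sqr_ge0.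
  - exact: sqr_ge0.
  rewrite -[RHS]mule1; congr (_ * _)%E.
  have mE : measurable_fun setT (fun y : RR => (window1 y)%:E) by exact/measurable_EFinP.
  have w10 y : (0 <= (window1 y)%:E)%E by rewrite lee_fin; case/andP: (w1_01 y).
  transitivity (\int[leb]_t (window1 ((- t) + x)%R)%:E)%E.
    apply: eq_integral => t _; rewrite addrC /window1 indicE.
    by case: (_ \in _); rewrite ?expr1n ?expr0n.
  have := ge0_integral_reflect (f := fun t : RR => (window1 (t + x))%:E).
  move=> ->; last 2 first.
  - by apply/measurable_EFinP; exact: (measurableT_comp mw1 (measurable_shift x)).
  - by move=> t.
  have := int_w1 (- x : R); under eq_integral do rewrite opprK.
  by [].
under eq_integral do rewrite E.
have [n1 mm1] := norm f1 s1; have [n2 mm2] := norm f2 s2.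
rewrite ge0_integralD//; last 2 first.
- by move=> t _; exact: sqr_int_ge0.
- by move=> t _; exact: sqr_int_ge0.
by rewrite n1 n2.
Qed.

End moyal.

(** Phase space groups its variables as time and frequency, each split into a scalar and a vector;
    the tensor product needs a scalar pair and a vector pair. *)
Lemma prodm_interchange (R : realType) dA dB dC dD
    (TA : measurableType dA) (TB : measurableType dB)
    (TC : measurableType dC) (TD : measurableType dD)
    (a : {sigma_finite_measure set TA -> \bar R})
    (b : {sigma_finite_measure set TB -> \bar R})
    (c : {sigma_finite_measure set TC -> \bar R})
    (e : {sigma_finite_measure set TD -> \bar R})
    (H : (TA * TB) * (TC * TD) -> \bar R) :
  measurable_fun setT H -> (forall z, 0 <= H z)%E ->
  (\int[prodm a b]_p \int[prodm c e]_q H (p, q) =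
   \int[prodm (prodm a c) (prodm b e)]_z H ((z.1.1, z.2.1), (z.1.2, z.2.2)))%E.
Proof.
move=> mH H0.
have mI : measurable_fun setT (fun p => \int[prodm c e]_q H (p, q))%E.
  exact: measurable_integral2.
rewrite (prodm_tonelli1 _ _ mI); last by move=> z; exact: integral_ge0.
have m11 : measurable_fun setT (fun z : (TA * TC) * (TB * TD) => z.1.1).
  exact: (measurableT_comp measurable_fst measurable_fst).
have m12 : measurable_fun setT (fun z : (TA * TC) * (TB * TD) => z.1.2).
  exact: (measurableT_comp measurable_snd measurable_fst).
have m21 : measurable_fun setT (fun z : (TA * TC) * (TB * TD) => z.2.1).
  exact: (measurableT_comp measurable_fst measurable_snd).
have m22 : measurable_fun setT (fun z : (TA * TC) * (TB * TD) => z.2.2).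
  exact: (measurableT_comp measurable_snd measurable_snd).
have mH' : measurable_fun setT
    (fun z : (TA * TC) * (TB * TD) => H ((z.1.1, z.2.1), (z.1.2, z.2.2))).
  apply: (measurableT_comp mH).
  by apply/measurable_fun_pairP; split; apply/measurable_fun_pairP; split.
rewrite (prodm_tonelli1 _ _ mH')//.
have mI' : measurable_fun setT (fun p : TA * TC => \int[prodm b e]_q
    H ((p.1, q.1), (p.2, q.2)))%E.
  exact: (measurable_integral2 (prodm b e) mH').
rewrite (prodm_tonelli1 _ _ mI'); last by move=> z; exact: integral_ge0.
apply: eq_integral => x _.
have mx1 : measurable_fun setT (fun z : (TB * TC) * TD => H ((x, z.1.1), (z.1.2, z.2))).
  apply: (measurableT_comp mH).
  apply/measurable_fun_pairP; split => /=; apply/measurable_fun_pairP; split => //=.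
  - exact: measurable_cst.
  - exact: (measurableT_comp measurable_fst measurable_fst).
  - exact: (measurableT_comp measurable_snd measurable_fst).
  - exact: measurable_snd.
have mG : measurable_fun setT (fun p : TB * TC => \int[e]_t H ((x, p.1), (p.2, t)))%E.
  exact: (measurable_integral2 e mx1).
have G0 (p : TB * TC) : (0 <= \int[e]_t H ((x, p.1), (p.2, t)))%E by exact: integral_ge0.
transitivity (\int[b]_y \int[c]_s \int[e]_t H ((x, y), (s, t)))%E.
  apply: eq_integral => y _.
  have m1 : measurable_fun setT (fun q => H ((x, y), q)).
    by apply: (measurableT_comp mH); exact: pair1_measurable.
  by rewrite (prodm_tonelli1 _ _ m1).
rewrite (@fubini_tonelli _ _ _ _ _ b c _ mG G0) /=.
apply: eq_integral => s _.
have m1 : measurable_fun setT (fun q : TB * TD => H ((x, q.1), (s, q.2))).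
  apply: (measurableT_comp mH).
  apply/measurable_fun_pairP; split => /=; apply/measurable_fun_pairP; split => /=.
  - exact: measurable_cst.
  - exact: measurable_fst.
  - exact: measurable_cst.
  - exact: measurable_snd.
by rewrite (prodm_tonelli1 _ _ m1).
Qed.

(** * Moyal's identity in every dimension *)

Section moyal_dim.
Variable R : realType.
Notation leb := (@lebesgue_measure R).
Notation RR := (measurableTypeR R).
Notation vec m := (rvec R m).
Notation mu m := (rvec_measure R m).

Lemma window_consv m (p q : RR * vec m) :
  window ((consv p : 'rV[R]_m.+1) - (consv q : 'rV[R]_m.+1)) =
  window1 (p.1 - q.1) * window ((p.2 : 'rV[R]_m) - (q.2 : 'rV[R]_m)).
Proof.
have D n (u v : 'rV[R]_n) j : (u - v) ord0 j = u ord0 j - v ord0 j.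
  by rewrite mxE [X in _ + X = _]mxE.
rewrite /window /window1 !indicE -natrM mulnb; congr (_ %:R); congr nat_of_bool.
apply/idP/andP => [/set_mem h|[/set_mem h1 /set_mem h2]].
  split; apply/mem_set.
    by have := h ord0; rewrite /= in_itv/= D !consv0.
  by move=> j; have := h (lift ord0 j); rewrite !D !consvS.
apply/mem_set => j; case: (unliftP ord0 j) => [i|] ->.
  by have := h2 i; rewrite !D !consvS.
by move: h1; rewrite /= in_itv/= D !consv0.
Qed.

Lemma phase_consv m (p q : RR * vec m) :
  phase (consv p) (consv q) = 2 * pi * p.1 * q.1 + phase p.2 q.2 :> R.
Proof.
rewrite /phase big_ord_recl !consv0 mulrDr mulrA; congr (_ + _ * _).
by apply: eq_bigr => j _; rewrite !consvS.
Qed.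

(** The cube is a product and the phase is additive, so the atom is a complex product of a scalar
    atom and a lower-dimensional one. *)
Lemma atomc_consv m (t w x : RR * vec m) :
  atomc ((consv t, consv w), consv x) =
  tensor_re (@atom1c R) (@atom1s R) (@atomc R m) (@atoms R m)
    (((t.1, w.1), (t.2, w.2)), x).
Proof.
rewrite /atomc /tensor_re /atom1c /atom1s /atoms /= window_consv phase_consv cosD.
by rewrite /atomc /=; ring.
Qed.

Lemma atoms_consv m (t w x : RR * vec m) :
  atoms ((consv t, consv w), consv x) =
  tensor_im (@atom1c R) (@atom1s R) (@atomc R m) (@atoms R m)
    (((t.1, w.1), (t.2, w.2)), x).
Proof.
rewrite /atoms /tensor_im /atom1c /atom1s /atomc /= window_consv phase_consv sinD.
by rewrite /atoms /=; ring.
Qed.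

(** Induction on the dimension: dimension 0 is a one-point space with constant atom 1, and the step
    tensors with the atom on the line. *)
Lemma tight_atom m :
  tight_kernel (mu m) (prodm (mu m) (mu m)) (@atomc R m) (@atoms R m).
Proof.
elim: m => [|m IH] f1 f2 s1 s2; have [m1 _] := s1; have [m2 _] := s2.
  have mQ : measurable_fun setT (fun z =>
      (kre (mu 0) (@atomc R 0) (@atoms R 0) f1 f2 z ^+ 2
     + kim (mu 0) (@atomc R 0) (@atoms R 0) f1 f2 z ^+ 2)%:E).
    apply/measurable_EFinP; apply: measurable_funD; apply: measurable_funX.
      by apply: measurable_kre => //; [exact: good_atomc|exact: good_atoms].
    by apply: measurable_kim => //; [exact: good_atomc|exact: good_atoms].
  rewrite (prodm_tonelli1 _ _ mQ); last by move=> z; rewrite lee_fin addr_ge0 ?sqr_ge0.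
  have dirE (f : vec 0 -> \bar R) : measurable_fun setT f ->
      (\int[mu 0]_x f x = f (((0 : 'rV[R]_0)%R) : vec 0))%E.
    by move=> mf; rewrite integral_dirac// diracT mul1e.
  have aE (z : vec 0 * vec 0) (x : vec 0) : atomc (z, x) = 1 :> R.
    rewrite /atomc /phase /= big_ord0 mulr0 cos0 mulr1 /window indicE mem_set//.
    by case.
  have bE (z : vec 0 * vec 0) (x : vec 0) : atoms (z, x) = 0 :> R.
    by rewrite /atoms /phase /= big_ord0 mulr0 sin0 mulr0.
  have kE z : kre (mu 0) (@atomc R 0) (@atoms R 0) f1 f2 z = f1 (0 : 'rV[R]_0).
    rewrite /kre /Rintegral.
    under eq_integral do rewrite aE bE mulr1 mulr0 addr0.
    by rewrite dirE//; exact/measurable_EFinP.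
  have jE z : kim (mu 0) (@atomc R 0) (@atoms R 0) f1 f2 z = f2 (0 : 'rV[R]_0).
    rewrite /kim /Rintegral.
    under eq_integral do rewrite aE bE mulr1 mulr0 subr0.
    by rewrite dirE//; exact/measurable_EFinP.
  under eq_integral do under eq_integral do rewrite kE jE.
  by rewrite !dirE//; exact: measurable_sqrE.
have sqS (f : vec m.+1 -> R) : sqint (mu m.+1) f ->
    sqint (prodm leb (mu m)) (fun p => f (consv p)).
  move=> [mf fi]; split; first exact: (measurableT_comp mf (@measurable_consv R m)).
  move: fi; rewrite rvec_measureS//; first exact: measurable_sqrE.
  by move=> v; rewrite lee_fin sqr_ge0.
have sqE (f : vec m.+1 -> R) : sqint (mu m.+1) f ->
    (\int[mu m.+1]_x (f x ^+ 2)%:E = \int[prodm leb (mu m)]_p (f (consv p) ^+ 2)%:E)%E.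
  move=> [mf fi]; rewrite rvec_measureS//; first exact: measurable_sqrE.
  by move=> v; rewrite lee_fin sqr_ge0.
have gc := @good_atomc R m.+1; have gs := @good_atoms R m.+1.
set Q := fun z => (kre (mu m.+1) (@atomc R m.+1) (@atoms R m.+1) f1 f2 z ^+ 2
     + kim (mu m.+1) (@atomc R m.+1) (@atoms R m.+1) f1 f2 z ^+ 2)%:E.
have mQ : measurable_fun setT Q.
  apply/measurable_EFinP; apply: measurable_funD; apply: measurable_funX.
    exact: measurable_kre.
  exact: measurable_kim.
have Q0 z : (0 <= Q z)%E by rewrite lee_fin addr_ge0 ?sqr_ge0.
have T := tight_tensor (@good_atom1c R) (@good_atom1s R) (@good_atomc R m) (@good_atoms R m)
  (@tight_atom1 R) IH (sqS _ s1) (sqS _ s2).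
rewrite (sqE _ s1) (sqE _ s2) -T (prodm_tonelli1 _ _ mQ)//.
rewrite rvec_measureS; last 2 first.
- exact: (measurable_integral2 (mu m.+1) mQ).
- by move=> v; exact: integral_ge0.
have E (p : RR * vec m) : (\int[mu m.+1]_w Q (consv p, w) =
    \int[prodm leb (mu m)]_q Q (consv p, consv q))%E.
  rewrite rvec_measureS//.
  by apply: (measurableT_comp mQ); exact: pair1_measurable.
under eq_integral do rewrite E.
have mQ2 : measurable_fun setT (fun z : (RR * vec m) * (RR * vec m) =>
    Q (consv z.1, consv z.2)).
  apply: (measurableT_comp mQ); apply/measurable_fun_pairP; split.
    exact: (measurableT_comp (@measurable_consv R m) measurable_fst).
  exact: (measurableT_comp (@measurable_consv R m) measurable_snd).
rewrite (prodm_interchange leb (mu m) leb (mu m)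
  (H := fun z : (RR * vec m) * (RR * vec m) => Q (consv z.1, consv z.2)) mQ2)//.
apply: eq_integral => -[[t0 w0] [t w]] _ /=.
rewrite /Q; congr (((_ ^+ 2) + (_ ^+ 2))%:E).
- rewrite /kre /Rintegral (integral_rvecS (integrable_kre gc gs _ s1 s2)).
  congr fine; apply: eq_integral => x _ /=.
  by rewrite (atomc_consv (t0, t) (w0, w)) (atoms_consv (t0, t) (w0, w)).
- rewrite /kim /Rintegral (integral_rvecS (integrable_kim gc gs _ s1 s2)).
  congr fine; apply: eq_integral => x _ /=.
  by rewrite (atomc_consv (t0, t) (w0, w)) (atoms_consv (t0, t) (w0, w)).
Qed.

End moyal_dim.

(** * Counting points in dilated parallelepipeds *)

Section bodies.
Variables (R : realType) (n : nat).
Notation vec := (rvec R n).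
Notation mu := (rvec_measure R n).

Definition mxsum (A : 'M[R]_n) : R := \sum_(i < n) \sum_(j < n) `|A i j|.

Lemma mxsum_ge0 A : 0 <= mxsum A.
Proof. by apply: sumr_ge0 => i _; apply: sumr_ge0. Qed.

Lemma mulmx_bound (u : 'rV[R]_n) (A : 'M[R]_n) (b : R) i :
  0 <= b -> (forall j, `|u ord0 j| <= b) -> `|(u *m A) ord0 i| <= b * mxsum A.
Proof.
move=> b0 ub; rewrite mxE; apply: le_trans (ler_norm_sum _ _ _) _.
rewrite /mxsum mulr_sumr; apply: ler_sum => j _.
rewrite normrM; apply: ler_pM => //.
by rewrite (bigD1 i)//= lerDl sumr_ge0.
Qed.

Let rv0 j : (0 : 'rV[R]_n) ord0 j = 0. Proof. by rewrite mxE. Qed.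
Let rvD (u v : 'rV[R]_n) j : (u + v) ord0 j = u ord0 j + v ord0 j.
Proof. by rewrite mxE. Qed.
Let rvN (u : 'rV[R]_n) j : (- u) ord0 j = - u ord0 j. Proof. by rewrite mxE. Qed.
Let rvZ (a : R) (u : 'rV[R]_n) j : (a *: u) ord0 j = a * u ord0 j.
Proof. by rewrite mxE. Qed.

Variable N : 'M[R]_n.

(** With [N] the inverse transpose of [M] this is the parallelepiped [MQ]. Describing it by
    inequalities allows real sizes [s], and makes monotonicity and Minkowski sums immediate. *)
Definition body (c : 'rV[R]_n) (s : R) : set vec :=
  [set v | forall j, `|((v : 'rV[R]_n) *m N) ord0 j - c ord0 j| <= s / 2].

Lemma measurable_body c s : measurable (body c s).
Proof.
have -> : body c s = \bigcap_(j in [set: 'I_n])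
    ((fun v : vec => `|((v : 'rV[R]_n) *m N) ord0 j - c ord0 j|) @^-1` `]-oo, (s / 2)]%classic).
  apply/seteqP; split => [v h j _ /=|v h j]; first by rewrite in_itv /=; exact: h.
  by have := h j I; rewrite /= in_itv.
apply: fin_bigcap_measurable; first exact: finite_finset.
move=> j _; rewrite -[X in measurable X]setTI.
suff m : measurable_fun setT (fun v : vec => `|((v : 'rV[R]_n) *m N) ord0 j - c ord0 j|).
  by apply: m => //; exact: measurable_itv.
apply: measurableT_comp => //; apply: measurable_funB => //.
under eq_fun do rewrite mxE.
apply: measurable_sum => i; apply: measurable_funM => //.
exact: measurable_coord.
Qed.

Lemma bodyD c s t (v w : 'rV[R]_n) :
  body c s v -> body 0 t w -> body c (s + t) (v + w)%R.
Proof.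
move=> hv hw j; have := hv j; have := hw j; rewrite rv0 subr0 mulmxDl rvD => h1 h2.
rewrite mulrDl -addrA [X in _ + X]addrC addrA; apply: le_trans (ler_normD _ _) _.
exact: lerD.
Qed.

Lemma bodyN t (w : 'rV[R]_n) : body 0 t w -> body 0 t (- w)%R.
Proof. by move=> h j; have := h j; rewrite mulNmx rvN rv0 !subr0 normrN. Qed.

Lemma body_le c s t : s <= t -> body c s `<=` body c t.
Proof. by move=> st v h j; apply: le_trans (h j) _; rewrite ler_wpM2r ?invr_ge0. Qed.

Lemma box_body (rho : R) : 0 <= rho ->
  @box R n (- rho) rho `<=` body 0 (rho * mxsum N * 2).
Proof.
move=> r0 v h j; rewrite rv0 subr0 mulfK//.
by apply: mulmx_bound => // i; rewrite ler_norml; exact: h.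
Qed.

Hypothesis Nu : N \in unitmx.

(** The map [x |-> s x + c N^-1] carries the unit body onto this one, so only a dilation and a
    translation occur and no determinant has to be computed. *)
Lemma body_measure c s : 0 < s -> mu (body c s) = ((s ^+ n)%:E * mu (body 0 1))%E.
Proof.
move=> s0; have m1 := measurable_body c s; have m2 := measurable_body 0 1.
have i1 : (mu (body c s) = \int[mu]_x (\1_(body c s) x)%:E)%E.
  by rewrite integral_indic// setIT.
have i2 : (mu (body 0 1) = \int[mu]_x (\1_(body 0 1) x)%:E)%E.
  by rewrite integral_indic// setIT.
rewrite i1 i2 (ge0_integral_affine s0 (c *m invmx N)); last 2 first.
- by apply/measurable_EFinP; exact: measurable_indic.
- by move=> x; rewrite lee_fin.
congr (_ * _)%E; apply: eq_integral => x _; rewrite !indicE; congr ((_ : bool)%:R%:E).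
apply/idP/idP => /set_mem h; apply/mem_set => j; move: (h j);
  rewrite mulmxDl -mulmxA mulVmx// mulmx1 -scalemxAl rvD rvZ;
  rewrite addrK rv0 subr0 normrM gtr0_norm// mul1r.
- by rewrite ler_pM2l.
- by rewrite ler_pM2l.
Qed.

(** A small box lies inside the unit body and a large one contains it; the sizes come from entry
    sums of [N] and of its inverse. *)
Lemma body_bounds : (0 < mu (body 0 1) < +oo)%E.
Proof.
apply/andP; split; last first.
  set b := 2^-1 * mxsum (invmx N).
  have b0 : 0 <= b by rewrite mulr_ge0 ?mxsum_ge0.
  have sub : body 0 1 `<=` @box R n (- b) b.
    move=> v h j; rewrite -ler_norml.
    have -> : (v : 'rV[R]_n) = (v : 'rV[R]_n) *m N *m invmx N by rewrite mulmxK.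
    apply: mulmx_bound => // i; have := h i; by rewrite rv0 subr0 mul1r.
  apply: (@le_lt_trans _ _ (mu (@box R n (- b) b))).
    by apply: le_measure => //; rewrite inE; [exact: measurable_body|exact: measurable_box].
  by rewrite rvec_measure_box ?ltry// ge0_cp.
set e := (2 * (mxsum N + 1))^-1.
have M0 : 0 < mxsum N + 1 by rewrite ltr_wpDl ?mxsum_ge0.
have e0 : 0 < e by rewrite invr_gt0 mulr_gt0.
have sub : @box R n (- e) e `<=` body 0 1.
  apply: subset_trans (box_body (ltW e0)) _; apply: body_le.
  rewrite /e invfM mulrAC [X in X * _]mulrAC mulVf// mul1r mulrC ler_pdivrMr//.
  by rewrite mul1r lerDl.
apply: (@lt_le_trans _ _ (mu (@box R n (- e) e))).
  rewrite rvec_measure_box ?lte_fin ?exprn_gt0 ?opprK ?addr_gt0//.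
  by rewrite ge0_cp ?ltW.
by apply: le_measure => //; rewrite inE; [exact: measurable_box|exact: measurable_body].
Qed.

Lemma bigcup_box : \bigcup_k @box R n (- k%:R) k%:R = [set: vec].
Proof.
apply/seteqP; split => // v _.
have [k hk] : exists k : nat, forall j, `|(v : 'rV[R]_n) ord0 j| <= k%:R.
  have s0 : 0 <= \sum_j `|(v : 'rV[R]_n) ord0 j| by exact: sumr_ge0.
  exists (Num.truncn (\sum_j `|(v : 'rV[R]_n) ord0 j|)).+1 => j.
  apply: le_trans (ltW (truncnS_gt _)).
  by rewrite (bigD1 j)//= lerDl sumr_ge0.
by exists k => // j; rewrite -ler_norml.
Qed.

End bodies.

(* The library instance stops short of the [{sigma_finite_measure}] structure. *)
HB.instance Definition _ (R : realType) :=
  Measure_isSigmaFinite.Build _ _ _ (@counting nat R) (sigma_finite_counting R).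

Lemma measurable_nat_pair d (T : measurableType d) d' (X : measurableType d')
    (f : nat * T -> X) :
  (forall i, measurable_fun setT (fun x => f (i, x))) -> measurable_fun setT f.
Proof.
move=> mf _ A mA; rewrite setTI.
have -> : f @^-1` A = \bigcup_i ([set i] `*` ((fun x => f (i, x)) @^-1` A)).
  apply/seteqP; split => [[i x] /= Af|[i x] [j _ [/= -> //]]].
  by exists i.
apply: bigcup_measurable => i _; apply: measurableX => //.
by rewrite -[X in measurable X]setTI; exact: mf.
Qed.

Lemma ge0_integral_rvec_shift (R : realType) n (c : 'rV[R]_n) (f : rvec R n -> \bar R) :
  measurable_fun setT f -> (forall x, 0 <= f x)%E ->
  (\int[rvec_measure R n]_x f (((x : 'rV[R]_n) + c)%R : rvec R n) =
   \int[rvec_measure R n]_x f x)%E.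
Proof.
move=> mf f0; rewrite [RHS](ge0_integral_affine (@ltr01 R) c mf f0) expr1n mul1e.
by apply: eq_integral => x _; rewrite scale1r.
Qed.

Lemma measurable_rvec_shift (R : realType) n (c : 'rV[R]_n) :
  measurable_fun setT (fun x : rvec R n => ((x : 'rV[R]_n) + c)%R : rvec R n).
Proof.
have := @measurable_rvec_affine R 1 n c.
by under eq_fun do rewrite scale1r.
Qed.

(** * Point counts from Bessel's inequality *)

Section counting_points.
Variables (R : realType) (n : nat).
Notation vec := (rvec R n).
Notation mu := (rvec_measure R n).
Notation cnt := (@counting nat R).
Variables (val : nat -> bool) (pt : nat -> 'rV[R]_n) (W : vec -> R) (B : R).
Hypothesis mW : measurable_fun setT W.
Hypothesis W0 : forall z, 0 <= W z.
Hypothesis Wi : (\int[mu]_z (W z)%:E < +oo)%E.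
Hypothesis Wpos : (0 < \int[mu]_z (W z)%:E)%E.

(** The energy density of the frame vector with number [q.1] at the phase-space point [q.2]; [val]
    marks the naturals that encode an actual index. *)
Definition Wpt (q : nat * vec) : R := (val q.1)%:R * W ((q.2 : 'rV[R]_n) - pt q.1).

Hypothesis bessel : forall z, (\int[cnt]_i (Wpt (i, z))%:E <= B%:E)%E.

Lemma measurable_Wpt : measurable_fun setT Wpt.
Proof.
apply: (@measurable_nat_pair _ vec _ R Wpt) => i; rewrite /Wpt /=; apply: measurable_funM.
  exact: measurable_cst.
exact: (measurableT_comp mW (measurable_rvec_shift (- pt i))).
Qed.

Lemma Wpt_ge0 q : 0 <= Wpt q.
Proof. by rewrite mulr_ge0. Qed.

Let bx k := @box R n (- k%:R) k%:R.

Lemma integrable_W : mu.-integrable setT (EFin \o W).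
Proof.
apply/integrableP; split; first exact/measurable_EFinP.
by under eq_integral do rewrite gee0_abs ?lee_fin//.
Qed.

(** If every box carried zero mass, dominated convergence would make the total mass of [W] zero. *)
Lemma local_mass : exists k : nat, exists2 c : R, 0 < c &
  (\int[mu]_x (W x * \1_(bx k) x)%:E = c%:E)%E.
Proof.
have mf k : measurable_fun setT (fun x => W x * \1_(bx k) x).
  by apply: measurable_funM => //; apply: measurable_indic; exact: measurable_box.
have f0 k x : 0 <= W x * \1_(bx k) x by rewrite mulr_ge0.
have fle k x : W x * \1_(bx k) x <= W x.
  by rewrite ler_piMr// indicE; case: (_ \in _); rewrite ?lexx ?ler01.
have I0 k : (0 <= \int[mu]_x (W x * \1_(bx k) x)%:E)%E.
  by apply: integral_ge0 => x _; rewrite lee_fin.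
have Ifin k : (\int[mu]_x (W x * \1_(bx k) x)%:E)%E \is a fin_num.
  rewrite ge0_fin_numE//; apply: le_lt_trans Wi; apply: ge0_le_integral => //.
  - by move=> x _; rewrite lee_fin.
  - exact/measurable_EFinP.
  - exact/measurable_EFinP.
  - by move=> x _; rewrite lee_fin.
apply: contrapT => H.
have Z k : \int[mu]_x (W x * \1_(bx k) x) = 0.
  apply/eqP; rewrite eq_le; apply/andP; split; last exact: fine_ge0.
  rewrite leNgt; apply/negP => h; apply: H; exists k; exists (fine (\int[mu]_x (W x * \1_(bx k) x)%:E)).
    exact: h.
  by rewrite fineK.
have := @Rintegral_dominated_cvg _ _ R mu (fun k x => W x * \1_(bx k) x) W W mf.
move=> /(_ _ integrable_W) L.
have {L} : \int[mu]_x (W x * \1_(bx k) x) @[k --> \oo] --> \int[mu]_x W x.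
  apply: L; last by move=> k x; rewrite ger0_norm.
  move=> x; apply: cvg_near_cst.
  have : [set: vec] x by [].
  rewrite -bigcup_box => -[k0 _ hk0].
  near=> k; rewrite indicE mem_set ?mulr1// => j.
  have /andP[h1 h2] := hk0 j.
  have kk : k0%:R <= k%:R :> R by rewrite ler_nat; near: k; exact: nbhs_infty_ge.
  by rewrite (le_trans h2 kk) (le_trans _ h1)// lerN2.
under eq_fun do rewrite Z.
move=> /(cvg_lim (@Rhausdorff R)); rewrite lim_cst//= => E.
have : fine (\int[mu]_x (W x)%:E) = 0 by rewrite -[LHS]E.
by move/eqP; rewrite gt_eqF// fine_gt0// Wpos Wi.
Unshelve. all: by end_near. Qed.

(** The Bessel sum is integrated over [U]: each counted point contributes at least [c], because [U]
    contains the box around it, while the sum is at most [B] everywhere. *)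
Lemma counting_bound k c (P : nat -> bool) (U : set vec) :
  (\int[mu]_x (W x * \1_(bx k) x)%:E = c%:E)%E -> measurable U ->
  (forall i, P i -> val i) ->
  (forall i, P i -> forall b, bx k b -> U (pt i + b)%R) ->
  (\int[cnt]_i (P i)%:R%:E * c%:E <= B%:E * mu U)%E.
Proof.
move=> cE mU Pv PU.
have mb : measurable (bx k) by exact: measurable_box.
have mf : measurable_fun setT (fun x => W x * \1_(bx k) x).
  by apply: measurable_funM => //; exact: measurable_indic.
have f0 x : 0 <= W x * \1_(bx k) x by rewrite mulr_ge0.
have c0 : (0 <= c%:E)%E by rewrite -cE; apply: integral_ge0 => x _; rewrite lee_fin.
have m1 : measurable_fun setT (fun q : nat * vec => \1_U q.2 * Wpt q).
  apply: measurable_funM; last exact: measurable_Wpt.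
  by apply: (measurableT_comp (measurable_indic mU)).
have m1' : measurable_fun setT (fun q : nat * vec => (\1_U q.2 * Wpt q)%:E).
  exact/measurable_EFinP.
have g0 (q : nat * vec) : (0 <= (\1_U q.2 * Wpt q)%:E)%E.
  by rewrite lee_fin mulr_ge0 ?Wpt_ge0.
rewrite -ge0_integralZr//.
apply: (@le_trans _ _ (\int[cnt]_i \int[mu]_z (\1_U z * Wpt (i, z))%:E)%E).
  apply: ge0_le_integral => //.
  - by move=> i _; rewrite mule_ge0// lee_fin.
  - move=> i _; case Pi: (P i); last first.
      by rewrite mul0e; apply: integral_ge0 => z _; exact: (g0 (i, z)).
    have mfE : measurable_fun setT (fun x : vec => (W x * \1_(bx k) x)%:E).
      exact/measurable_EFinP.
    have f0E x : (0 <= (W x * \1_(bx k) x)%:E)%E by rewrite lee_fin.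
    rewrite mul1e -cE -(ge0_integral_rvec_shift (- pt i) mfE f0E).
    apply: ge0_le_integral => //.
    + apply/measurable_EFinP; exact: (measurableT_comp mf (measurable_rvec_shift _)).
    + exact: (measurableT_comp m1' (pair1_measurable i)).
    + move=> z _; rewrite lee_fin /Wpt /= (Pv _ Pi) mul1r mulrC.
      apply: ler_wpM2r => //; rewrite !indicE.
      case: (boolP (_ \in bx k)) => // /set_mem hb.
      have := PU _ Pi _ hb; rewrite addrC subrK => hU.
      by rewrite mem_set.
have -> : (\int[cnt]_i \int[mu]_z (\1_U z * Wpt (i, z))%:E =
    \int[mu]_z \int[cnt]_i (\1_U z * Wpt (i, z))%:E)%E.
  pose cs : {sigma_finite_measure set nat -> \bar R} := cnt.
  exact: (fubini_tonelli (m1 := cs) (m2 := mu) _ m1' g0).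
apply: (@le_trans _ _ (\int[mu]_z (B%:E * (\1_U z)%:E))%E); last first.
  rewrite ge0_integralZl//.
  - by rewrite integral_indic// setIT.
  - by apply/measurable_EFinP; exact: measurable_indic.
  - have := bessel 0; apply: le_trans; apply: integral_ge0 => i _.
    by rewrite lee_fin Wpt_ge0.
have mI : measurable_fun setT (fun z => \int[cnt]_i (\1_U z * Wpt (i, z))%:E)%E.
  apply: (@measurable_integral2 R _ _ _ _ cnt (fun p : vec * nat => (\1_U p.1 * Wpt (p.2, p.1))%:E)).
  apply: (measurableT_comp m1' (f := fun p : nat * vec => (\1_U p.2 * Wpt p)%:E)
    (g := fun p : vec * nat => (p.2, p.1))).
  by apply/measurable_fun_pairP; split; [exact: measurable_snd|exact: measurable_fst].
apply: ge0_le_integral => //.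
- by move=> z _; apply: integral_ge0 => i _; exact: (g0 (i, z)).
- by apply/measurable_EFinP; apply: measurable_funM => //; exact: measurable_indic.
- move=> z _; rewrite indicE; case: (_ \in U); last first.
    by rewrite mule0; under eq_integral do rewrite mul0r; rewrite integral0.
  by rewrite mule1; under eq_integral do rewrite mul1r; exact: bessel.
Qed.

End counting_points.

Lemma shell_ratio_cvg (R : realType) (n s : nat) :
  ((j.+1 + s)%:R ^+ n - (j.+1%:R - s%:R) ^+ n) / j.+1%:R ^+ n @[j --> \oo] --> (0 : R).
Proof.
have h : s%:R * harmonic j @[j --> \oo] --> (0 : R).
  rewrite -(mulr0 (s%:R : R)); apply: cvgM; [exact: cvg_cst|exact: cvg_harmonic].
have hX (u : nat -> R) : u j @[j --> \oo] --> (1 : R) -> u j ^+ n @[j --> \oo] --> (1 : R).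
  move=> u1; rewrite -[X in _ --> X](expr1n R n).
  exact: (@continuous_cvg _ _ _ _ _ u (fun x : R => x ^+ n) 1 (@exprn_continuous R n 1) u1).
have h1 : (1 + s%:R * harmonic j) ^+ n @[j --> \oo] --> (1 : R).
  by apply: hX; rewrite -[X in _ --> X]addr0; apply: cvgD h; exact: cvg_cst.
have h2 : (1 - s%:R * harmonic j) ^+ n @[j --> \oo] --> (1 : R).
  by apply: hX; rewrite -[X in _ --> X]subr0; apply: cvgB h; exact: cvg_cst.
have E (j : nat) : ((j.+1 + s)%:R ^+ n - (j.+1%:R - s%:R) ^+ n) / j.+1%:R ^+ n =
    (1 + s%:R * harmonic j) ^+ n - (1 - s%:R * harmonic j) ^+ n :> R.
  rewrite /harmonic /= mulrBl -!expr_div_n natrD.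
  by rewrite [X in X ^+ n - _]mulrDl [X in _ - X ^+ n]mulrBl mulfV.
by under eq_fun do rewrite E; rewrite -(subrr (1 : R)); exact: cvgB.
Qed.

Section shells.
Variables (R : realType) (n : nat).
Notation vec := (rvec R n).
Notation mu := (rvec_measure R n).
Notation cnt := (@counting nat R).
Variables (val : nat -> bool) (pt : nat -> 'rV[R]_n) (W : vec -> R) (B : R).
Hypothesis mW : measurable_fun setT W.
Hypothesis W0 : forall z, 0 <= W z.
Hypothesis Wi : (\int[mu]_z (W z)%:E < +oo)%E.
Hypothesis Wpos : (0 < \int[mu]_z (W z)%:E)%E.
Hypothesis bessel : forall z, (\int[cnt]_i (Wpt val pt W (i, z))%:E <= B%:E)%E.
Variables (N : 'M[R]_n) (c0 : 'rV[R]_n).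
Hypothesis Nu : N \in unitmx.

Let K (s : R) := body N c0 s.
Let v0 : R := fine (mu (body N 0 1)).

Lemma body1_measure : mu (body N 0 1) = v0%:E /\ 0 < v0.
Proof.
have /andP[h1 h2] := body_bounds Nu; rewrite /v0 fineK ?fine_gt0 ?h1//.
by rewrite ge0_fin_numE// ltW.
Qed.

Lemma body_volume s : 0 < s -> mu (K s) = (s ^+ n * v0)%:E.
Proof. by move=> s0; rewrite (body_measure Nu)// body1_measure.1. Qed.

Definition inK (s : R) (z : 'rV[R]_n) : bool := `[< body N c0 s z >].

Definition selected s i : bool := val i && inK s (pt i).
(** The displacement [w] carries the point across the boundary of the body, in either direction. *)
Definition crossing s (w : 'rV[R]_n) i : bool :=
  val i && (inK s (pt i) != inK s (pt i + w)).

(* Bessel's inequality and [int_box W = c > 0] bound the number of points [x] with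
   [x + box] inside [U] by [(B / c) * vol U]; for points crossing the boundary of
   the dilate [j], [U] is a shell of width independent of [j]. *)
Lemma count_constants : exists2 C : R, 0 < C & exists s0 : nat,
  (forall j, (0 < j)%N ->
     (\int[cnt]_i (selected j%:R i)%:R%:E <= (C * (j + s0)%:R ^+ n)%:E)%E) /\
  (forall w : 'rV[R]_n, exists s : nat, forall j, (s < j)%N ->
     (\int[cnt]_i (crossing j%:R w i)%:R%:E <=
        (C * ((j + s)%:R ^+ n - (j%:R - s%:R) ^+ n))%:E)%E) /\
  (forall (w : 'rV[R]_n) j, (0 < j)%N ->
     (\int[cnt]_i (crossing j%:R w i)%:R%:E <= (2 * C * (j + s0)%:R ^+ n)%:E)%E).
Proof.
have [k [c cpos cE]] := local_mass mW W0 Wi Wpos.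
have [_ v0pos] := body1_measure.
have count := counting_bound mW W0 bessel cE.
have B0 : 0 <= B.
  rewrite -lee_fin; apply: le_trans (bessel 0); apply: integral_ge0 => i _.
  by rewrite lee_fin Wpt_ge0.
(* The [+ 1] keeps [C] positive even when [B] is 0. *)
pose C := (B * v0 + 1) / c.
have C0 : 0 < C by rewrite divr_gt0// ltr_wpDl// mulr_ge0// ltW.
have CE (P : nat -> bool) (U : set vec) (a : R) : 0 <= a -> measurable U ->
    (forall i, P i -> val i) ->
    (forall i, P i -> forall b, @box R n (- k%:R) k%:R b -> U (pt i + b)%R) ->
    (mu U = (a * v0)%:E)%E -> (\int[cnt]_i (P i)%:R%:E <= (C * a)%:E)%E.
  move=> a0 mU Pv PU Ua; have := count P U mU Pv PU.
  rewrite Ua -EFinM -lee_pdivlMr// => h; apply: le_trans h _.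
  rewrite -EFinM lee_fin /C [leRHS]mulrAC ler_pM2r ?invr_gt0// mulrDl mul1r.
  by rewrite [a * v0]mulrC mulrA lerDl.
(* A size at which the centred body contains the box of [local_mass]; adding a box vector then
   enlarges a body by at most [s0]. *)
pose s0 := (Num.truncn (k%:R * mxsum N * 2 : R)).+1.
have bs0 b : @box R n (- k%:R) k%:R b -> body N 0 s0%:R b.
  move=> /(@box_body R n N k%:R (ler0n R k)) h; apply: body_le h.
  exact/ltW/truncnS_gt.
have bodies (w : 'rV[R]_n) : exists t : nat, body N 0 t%:R w.
  have : [set: vec] w by [].
  rewrite -bigcup_box => -[q _ /(@box_body R n N q%:R (ler0n R q)) h].
  by exists (Num.truncn (q%:R * mxsum N * 2 : R)).+1; apply: body_le h; exact/ltW/truncnS_gt.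
have selB j : (0 < j)%N ->
    (\int[cnt]_i (selected j%:R i)%:R%:E <= (C * (j + s0)%:R ^+ n)%:E)%E.
  move=> j0; apply: (CE _ (K (j + s0)%:R)) => //.
  - exact: measurable_body.
  - by move=> i /andP[].
  - move=> i /andP[_ /asboolP ki] b /bs0 hb; rewrite /K natrD; exact: bodyD.
  - by rewrite body_volume// ltr0n addn_gt0 j0.
exists C => //; exists s0; split => //; split.
  move=> w; have [t wt] := bodies w.
  exists (s0 + t)%N => j sj.
  have j0 : (0 < j)%N by exact: leq_ltn_trans sj.
  set s := (s0 + t)%N.
  have js : (0 : R) < j%:R - s%:R by rewrite subr_gt0 ltr_nat.
  have sub : K (j%:R - s%:R) `<=` K (j + s)%:R.
    by apply: body_le; rewrite natrD lerD2l -subr_ge0 opprK addr_ge0.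
  have mK1 := measurable_body N c0 (j%:R - s%:R).
  have mK2 := measurable_body N c0 (j + s)%:R.
  apply: (CE _ (K (j + s)%:R `\` K (j%:R - s%:R))).
  - rewrite subr_ge0; apply: lerXn2r; rewrite ?nnegrE ?ler0n//; first exact: ltW.
    by rewrite natrD lerD2l -subr_ge0 opprK addr_ge0.
  - exact: measurableD.
  - by move=> i /andP[].
  - move=> i /andP[_ hi] b /bs0 hb.
    (* One of [pt i] and [pt i + w] is inside the body and the other outside. Both differ from
       [pt i + b] by vectors of size at most [s], so [pt i + b] lies in the enlarged body but not in
       the shrunken one. *)
    have c1 : body N 0 s%:R (b - w)%R.
      by rewrite /s natrD; apply: bodyD => //; exact: bodyN.
    have c2 : body N 0 s%:R b by apply: body_le hb; rewrite ler_nat leq_addr.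
    have c3 : body N 0 s%:R (w - b)%R by rewrite -opprB; exact: bodyN.
    have c4 : body N 0 s%:R (- b)%R by exact: bodyN.
    have e1 : (pt i + w + (b - w) = pt i + b)%R by rewrite addrAC addrA subrK.
    have e2 : (pt i + b + (w - b) = pt i + w)%R by rewrite addrAC addrA subrK.
    have e3 : (pt i + b - b = pt i)%R by rewrite addrK.
    move: hi; rewrite /inK; case: asboolP => h1; case: asboolP => h2 //= _.
    + split; first by rewrite /K natrD; exact: bodyD.
      move=> h3; apply: h2; rewrite -e2 -[j%:R](subrK s%:R); exact: bodyD.
    + split; first by rewrite /K natrD -e1; exact: bodyD.
      move=> h3; apply: h1; rewrite -e3 -[j%:R](subrK s%:R); exact: bodyD.
  - have fK : (mu (K (j + s)%:R) < +oo)%E.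
      by rewrite body_volume ?ltry// ltr0n addn_gt0 j0.
    have D : (mu (K (j + s)%:R `\` K (j%:R - s%:R)) =
        mu (K (j + s)%:R) - mu (K (j%:R - s%:R)))%E.
      have EI : K (j + s)%:R `&` K (j%:R - s%:R) = K (j%:R - s%:R) by apply/setIidPr.
      by have := measureD mK2 mK1 fK; rewrite EI.
    rewrite D.
    by rewrite !body_volume ?ltr0n ?addn_gt0 ?j0// -EFinB mulrBl.
move=> w j j0.
(* For the crude bound, a crossing puts [pt i] or [pt i + w] inside the body, and the translated
   body has the same volume. The constant is uniform in [w]. *)
have sel2 : (\int[cnt]_i (val i && inK j%:R (pt i + w)%R)%:R%:E
    <= (C * (j + s0)%:R ^+ n)%:E)%E.
  have mU : measurable ((fun x : vec => ((x : 'rV[R]_n) + w)%R : vec) @^-1` K (j + s0)%:R).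
    rewrite -[X in measurable X]setTI; apply: measurable_rvec_shift => //.
    exact: measurable_body.
  apply: (CE _ _ _ _ mU) => //.
  - by move=> i /andP[].
  - move=> i /andP[_ /asboolP ki] b /bs0 hb /=; rewrite addrAC /K natrD; exact: bodyD.
  - have mK := measurable_body N c0 (j + s0)%:R.
    have mI : measurable_fun setT (fun x : vec => (\1_(K (j + s0)%:R) x : R)%:E).
      by apply/measurable_EFinP; exact: measurable_indic.
    have I0 (x : vec) : (0 <= (\1_(K (j + s0)%:R) x : R)%:E)%E by rewrite lee_fin.
    have i1 : (\int[mu]_x (\1_(K (j + s0)%:R) x)%:E = mu (K (j + s0)%:R))%E.
      by rewrite integral_indic// setIT.
    set U := (X in mu X).
    have i2 : (\int[mu]_x (\1_U x)%:E = mu U)%E by rewrite integral_indic// setIT.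
    have := ge0_integral_rvec_shift w mI I0; rewrite i1 => E.
    rewrite -i2 -body_volume ?ltr0n ?addn_gt0 ?j0// -E.
have -> : 2 * C * (j + s0)%:R ^+ n = C * (j + s0)%:R ^+ n + C * (j + s0)%:R ^+ n by ring.
rewrite EFinD; apply: le_trans (leeD (selB _ j0) sel2).
rewrite -ge0_integralD//.
apply: ge0_le_integral; [by []|by move=> i _; rewrite lee_fin|by []|by []|].
move=> i _; rewrite -EFinD lee_fin /crossing /selected.
by case: (val i); case: (inK _ _); case: (inK _ _); rewrite /= ?addr0 ?add0r ?lexx ?ler01 ?addr_ge0.
Qed.

End shells.

(** * Localization of the diagonal terms *)

Lemma ge0_integrable_lt d (T : measurableType d) (R : realType)
    (mu : {measure set T -> \bar R}) (f : T -> R) :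
  measurable_fun setT f -> (forall x, 0 <= f x) -> (\int[mu]_x (f x)%:E < +oo)%E ->
  mu.-integrable setT (EFin \o f).
Proof.
move=> mf f0 fi; apply/integrableP; split; first exact/measurable_EFinP.
by under eq_integral do rewrite gee0_abs ?lee_fin//.
Qed.

Section prodm_weighted.
Context d1 d2 (T1 : measurableType d1) (T2 : measurableType d2) (R : realType).
Variable m1 : {sigma_finite_measure set T1 -> \bar R}.
Variable m2 : {sigma_finite_measure set T2 -> \bar R}.
Variable H : T1 * T2 -> R.
Hypothesis mH : measurable_fun setT H.
Hypothesis H0 : forall q, 0 <= H q.

Lemma prodm_weighted1 (s : T1 -> R) (c : R) : measurable_fun setT s ->
  (forall x, 0 <= s x) -> (forall x, \int[m2]_y (H (x, y))%:E <= c%:E)%E ->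
  (\int[prodm m1 m2]_q (s q.1 * H q)%:E <= (\int[m1]_x (s x)%:E) * c%:E)%E.
Proof.
move=> ms s0 Hc.
have mE : measurable_fun setT (fun q : T1 * T2 => (s q.1 * H q)%:E).
  apply/measurable_EFinP; apply: measurable_funM => //.
  exact: (measurableT_comp ms measurable_fst).
have msE : measurable_fun setT (fun x => (s x)%:E) by exact/measurable_EFinP.
have E0 (q : T1 * T2) : (0 <= (s q.1 * H q)%:E)%E by rewrite lee_fin mulr_ge0.
(* The sign of [c] is known only through a point of [T1]; without one both sides vanish. *)
have [x0|nx] := pselect (exists x0 : T1, True); last first.
  have -> : (\int[prodm m1 m2]_q (s q.1 * H q)%:E = 0)%E.
    rewrite (prodm_tonelli1 _ _ mE E0); apply: integral0_eq => x _.
    by exfalso; apply: nx; exists x.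
  rewrite [X in (_ <= X * _)%E](_ : _ = 0%E) ?mul0e//.
  by apply: integral0_eq => x _; exfalso; apply: nx; exists x.
have c0 : (0 <= c%:E)%E.
  case: x0 => x0 _; apply: le_trans (Hc x0); apply: integral_ge0 => y _.
  by rewrite lee_fin.
rewrite (prodm_tonelli1 _ _ mE E0) -ge0_integralZr//; last first.
  by move=> x _; rewrite lee_fin.
apply: ge0_le_integral => //.
- by move=> x _; apply: integral_ge0 => y _; exact: (E0 (x, y)).
- exact: measurable_integral2 mE.
- by apply: emeasurable_funM => //; exact: measurable_cst.
- move=> x _ /=; have mHx : measurable_fun setT (fun y => (H (x, y))%:E).
    apply/measurable_EFinP; exact: (measurableT_comp mH (pair1_measurable x)).
  under eq_integral do rewrite EFinM.
  rewrite ge0_integralZl_EFin//; last by move=> y _; rewrite lee_fin.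
  by apply: lee_wpmul2l; [rewrite lee_fin|exact: Hc].
Qed.

End prodm_weighted.

Lemma prodm_weighted2 d1 d2 (T1 : measurableType d1) (T2 : measurableType d2) (R : realType)
    (m1 : {sigma_finite_measure set T1 -> \bar R})
    (m2 : {sigma_finite_measure set T2 -> \bar R}) (H : T1 * T2 -> R) (s : T2 -> R) (c : R) :
  measurable_fun setT H -> (forall q, 0 <= H q) -> measurable_fun setT s ->
  (forall y, 0 <= s y) -> (forall y, \int[m1]_x (H (x, y))%:E <= c%:E)%E ->
  (\int[prodm m1 m2]_q (s q.2 * H q)%:E <= (\int[m2]_y (s y)%:E) * c%:E)%E.
Proof.
move=> mH H0 ms s0 Hc.
have msw : measurable_fun setT (fun p : T2 * T1 => (p.2, p.1)).
  by apply/measurable_fun_pairP; split; [exact: measurable_snd|exact: measurable_fst].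
have mE : measurable_fun setT (fun q : T1 * T2 => (s q.2 * H q)%:E).
  apply/measurable_EFinP; apply: measurable_funM => //.
  exact: (measurableT_comp ms measurable_snd).
have E0 (q : T1 * T2) : (0 <= (s q.2 * H q)%:E)%E by rewrite lee_fin mulr_ge0.
have := @prodm_weighted1 _ _ T2 T1 R m2 m1 (fun p => H (p.2, p.1)) (measurableT_comp mH msw)
  (fun p => H0 _) s c ms s0 Hc.
apply: le_trans; rewrite (prodm_tonelli2 _ _ mE E0).
by rewrite (prodm_tonelli1 m2 m1 (measurableT_comp mE msw)) // => z; exact: E0.
Qed.

Section localization.
Variables (R : realType) (n : nat).
Notation vec := (rvec R n).
Notation mu := (rvec_measure R n).
Notation cnt := (@counting nat R).
Variables (val : nat -> bool) (pt : nat -> 'rV[R]_n) (W : vec -> R) (B : R).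
Hypothesis mW : measurable_fun setT W.
Hypothesis W0 : forall z, 0 <= W z.
Hypothesis Wi : (\int[mu]_z (W z)%:E < +oo)%E.
Hypothesis Wpos : (0 < \int[mu]_z (W z)%:E)%E.
Hypothesis bessel : forall z, (\int[cnt]_i (Wpt val pt W (i, z))%:E <= B%:E)%E.
Variables (N : 'M[R]_n) (c0 : 'rV[R]_n).
Hypothesis Nu : N \in unitmx.
Variables (u1 u2 v1 v2 : nat * vec -> R) (x : nat -> R) (C1 : R).
Hypothesis mu1 : measurable_fun setT u1.
Hypothesis mu2 : measurable_fun setT u2.
Hypothesis mv1 : measurable_fun setT v1.
Hypothesis mv2 : measurable_fun setT v2.
(** The pairs [u] and [v] stand for the coefficients of a frame vector and of its dual against
    [e_z]. [V] is the dual energy and [T] the real part of the mixed product. *)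
Let V q := v1 q ^+ 2 + v2 q ^+ 2.
Let T q := u1 q * v1 q + u2 q * v2 q.
Hypothesis Ueq : forall q, u1 q ^+ 2 + u2 q ^+ 2 = Wpt val pt W q.
Hypothesis Vz : forall i, (\int[mu]_z (V (i, z))%:E <= C1%:E)%E.
Hypothesis Vi : forall z, (\int[cnt]_i (V (i, z))%:E <= C1%:E)%E.
Hypothesis Tz : forall i, \int[mu]_z T (i, z) = x i.
Hypothesis Ti : forall z, \int[cnt]_i T (i, z) = 1.

Local Notation Wp := (Wpt val pt W).
Local Notation sel := (selected val pt N c0).
Local Notation crs := (crossing val pt N c0).
Local Notation ink := (inK N c0).

Let V0 q : 0 <= V q. Proof. by rewrite addr_ge0 ?sqr_ge0. Qed.
Let mV : measurable_fun setT V.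
Proof. by apply: measurable_funD; exact: measurable_funX. Qed.
Let mT : measurable_fun setT T.
Proof. by apply: measurable_funD; exact: measurable_funM. Qed.
Let mWp : measurable_fun setT Wp. Proof. exact: measurable_Wpt. Qed.
Let Wp0 q : 0 <= Wp q. Proof. exact: Wpt_ge0. Qed.

Let T_le (e : R) q : 0 < e -> `|T q| <= e * V q + e^-1 * Wp q.
Proof.
move=> e0; have ei0 : 0 < e^-1 by rewrite invr_gt0.
have ee : e * e^-1 = 1 by rewrite mulfV// gt_eqF.
have AM (a b : R) : `|a * b| <= e * b ^+ 2 + e^-1 * a ^+ 2.
  rewrite normrM -(real_normK (num_real a)) -(real_normK (num_real b)).
  have := normr_ge0 a; have := normr_ge0 b.
  move: `|a| `|b| => p q' p0 q0.
  have h : 0 <= e * (q' - e^-1 * p) ^+ 2 by rewrite mulr_ge0 ?sqr_ge0 ?ltW.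
  have h2 : e * (q' - e^-1 * p) ^+ 2 = e * q' ^+ 2 - 2 * (e * e^-1) * (p * q') +
     (e * e^-1) * e^-1 * p ^+ 2 by ring.
  have h3 : 0 <= p * q' by rewrite mulr_ge0.
  rewrite h2 ee in h; lra.
rewrite /T -Ueq /V; apply: le_trans (ler_normD _ _) _.
by have := AM (u1 q) (v1 q); have := AM (u2 q) (v2 q); lra.
Qed.

Let ink_indic s : (fun z : vec => (ink s z)%:R : R) = \1_(body N c0 s).
Proof. by apply/funext => z; rewrite indicE. Qed.

Let m_ink s : measurable_fun setT (fun z : vec => (ink s z)%:R : R).
Proof. by rewrite ink_indic; apply: measurable_indic; exact: measurable_body. Qed.

Let int_ink s : (\int[mu]_z ((ink s z)%:R : R)%:E = mu (body N c0 s))%E.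
Proof.
have mK := measurable_body N c0 s.
transitivity (\int[mu]_z (\1_(body N c0 s) z)%:E)%E; last by rewrite integral_indic// setIT.
by apply: eq_integral => z _; rewrite indicE.
Qed.

Lemma Wpt_integral_le i : (\int[mu]_z (Wp (i, z))%:E <= \int[mu]_z (W z)%:E)%E.
Proof.
have mWE : measurable_fun setT (fun z : vec => (W z)%:E) by exact/measurable_EFinP.
have W0E (z : vec) : (0 <= (W z)%:E)%E by rewrite lee_fin.
rewrite -(ge0_integral_rvec_shift (- pt i) mWE W0E).
apply: ge0_le_integral => //.
- by move=> z _; rewrite lee_fin.
- apply/measurable_EFinP; exact: (measurableT_comp mWp (pair1_measurable i)).
- apply/measurable_EFinP; exact: (measurableT_comp mW (measurable_rvec_shift _)).
- by move=> z _; rewrite lee_fin /Wpt ler_piMl//; case: (val _); rewrite ?ler01.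
Qed.

(** The substitution [z = pt i + w] turns pairs straddling the boundary into crossings by [w],
    averaged against [W]. *)
Let crossing_integral s :
  (\int[prodm cnt mu]_q ((ink s (pt q.1) != ink s q.2)%:R * Wp q)%:E =
   \int[mu]_w ((W w)%:E * \int[cnt]_i (crs s w i)%:R%:E))%E.
Proof.
have mX : measurable_fun setT (fun q : nat * vec => (ink s (pt q.1) != ink s q.2)%:R : R).
  apply: (@measurable_nat_pair _ vec _ R) => i /=.
  have -> : (fun z : vec => (ink s (pt i) != ink s z)%:R : R) =
      (fun z : vec => if ink s (pt i) then 1 - (ink s z)%:R else (ink s z)%:R).
    by apply/funext => z; case: (ink s (pt i)); case: (ink s z); rewrite ?subrr ?subr0.
  by case: (ink s (pt i)); [apply: measurable_funB => //; exact: measurable_cst|].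
have mE : measurable_fun setT (fun q : nat * vec => ((ink s (pt q.1) != ink s q.2)%:R * Wp q)%:E).
  by apply/measurable_EFinP; exact: measurable_funM.
have E0 (q : nat * vec) : (0 <= ((ink s (pt q.1) != ink s q.2)%:R * Wp q)%:E)%E.
  by rewrite lee_fin mulr_ge0.
have mc : measurable_fun setT (fun q : nat * vec => (crs s q.2 q.1)%:R : R).
  apply: (@measurable_nat_pair _ vec _ R) => i /=.
  rewrite /crossing; case: (val i) => /=; last exact: measurable_cst.
  have m1 := measurableT_comp mX (pair1_measurable i).
  have := measurableT_comp m1 (measurable_rvec_shift (pt i)).
  by congr measurable_fun; apply/funext => z; rewrite addrC.
have mG : measurable_fun setT (fun q : nat * vec => (W q.2 * (crs s q.2 q.1)%:R)%:E).
  apply/measurable_EFinP; apply: measurable_funM => //.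
  exact: (measurableT_comp mW measurable_snd).
have G0 (q : nat * vec) : (0 <= (W q.2 * (crs s q.2 q.1)%:R)%:E)%E.
  by rewrite lee_fin mulr_ge0.
rewrite (prodm_tonelli1 _ _ mE E0).
transitivity (\int[cnt]_i \int[mu]_w (W w * (crs s w i)%:R)%:E)%E.
  apply: eq_integral => i _.
  have mEi := measurableT_comp mE (pair1_measurable i).
  have := ge0_integral_rvec_shift (pt i) mEi (fun z => E0 (i, z)).
  rewrite /comp /= => <-; apply: eq_integral => w _; rewrite /Wpt /= addrK /crossing.
  rewrite [pt i + w]addrC mulrCA mulrC [val i && _]andbC -mulnb natrM.
  by rewrite -mulrA; congr (_%:E); ring.
have -> : (\int[cnt]_i \int[mu]_w (W w * (crs s w i)%:R)%:E =
    \int[prodm cnt mu]_q (W q.2 * (crs s q.2 q.1)%:R)%:E)%E.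
  by rewrite (prodm_tonelli1 _ _ mG G0).
rewrite (prodm_tonelli2 _ _ mG G0); apply: eq_integral => w _ /=.
by under eq_integral do rewrite EFinM; rewrite ge0_integralZl_EFin.
Qed.

(* By AM-GM [|T| <= e * V + e^-1 * W(z - pt i)]: the first term is controlled by
   the total volume, the second only by the boundary crossings. *)
Lemma localization_bound s vol a X e : 0 < e ->
  mu (body N c0 s) = vol%:E ->
  (\int[cnt]_i (sel s i)%:R%:E <= a%:E)%E ->
  (\int[mu]_w ((W w)%:E * \int[cnt]_i (crs s w i)%:R%:E) <= X%:E)%E ->
  `|\int[cnt]_i ((sel s i)%:R * x i) - vol| <= e * ((a + vol) * C1) + e^-1 * X.
Proof.
move=> e0 Kvol Sa crX.
pose S (i : nat) : R := (sel s i)%:R.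
pose k (z : vec) : R := (ink s z)%:R.
have S0 i : 0 <= S i by [].
have k0 z : 0 <= k z by [].
have mk : measurable_fun setT k by exact: m_ink.
have mS : measurable_fun setT (fun q : nat * vec => S q.1).
  by apply: (@measurable_nat_pair _ vec _ R) => i /=; exact: measurable_cst.
have mk2 : measurable_fun setT (fun q : nat * vec => k q.2).
  exact: (measurableT_comp mk measurable_snd).
have C10 : 0 <= C1.
  rewrite -lee_fin; apply: le_trans (Vz 0); apply: integral_ge0 => z _.
  by rewrite lee_fin.
have B0 : 0 <= B.
  rewrite -lee_fin; apply: le_trans (bessel 0); apply: integral_ge0 => i _.
  by rewrite lee_fin.
have wE : (\int[mu]_z (W z)%:E = (fine (\int[mu]_z (W z)%:E))%:E)%E.
  by rewrite fineK// ge0_fin_numE// ltW.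
set w0 := fine _ in wE.
have w00 : 0 <= w0 by rewrite -lee_fin -wE ltW.
have bV1 : (\int[prodm cnt mu]_q (S q.1 * V q)%:E <= (a * C1)%:E)%E.
  apply: le_trans (prodm_weighted1 cnt (m2 := mu) mV V0 (s := S) _ S0 Vz) _ => //.
  by rewrite EFinM; apply: lee_wpmul2r; rewrite ?lee_fin.
have bV2 : (\int[prodm cnt mu]_q (k q.2 * V q)%:E <= (vol * C1)%:E)%E.
  apply: le_trans (prodm_weighted2 (m1 := cnt) mu mV V0 mk k0 Vi) _ => //.
  by rewrite int_ink Kvol EFinM.
have bW1 : (\int[prodm cnt mu]_q (S q.1 * Wp q)%:E <= (a * w0)%:E)%E.
  have Wz i : (\int[mu]_z (Wp (i, z))%:E <= w0%:E)%E by rewrite -wE; exact: Wpt_integral_le.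
  apply: le_trans (prodm_weighted1 cnt (m2 := mu) mWp Wp0 (s := S) _ S0 Wz) _ => //.
  by rewrite EFinM; apply: lee_wpmul2r; rewrite ?lee_fin.
have bW2 : (\int[prodm cnt mu]_q (k q.2 * Wp q)%:E <= (vol * B)%:E)%E.
  apply: le_trans (prodm_weighted2 (m1 := cnt) mu mWp Wp0 mk k0 bessel) _ => //.
  by rewrite int_ink Kvol EFinM.
(* The pointwise bound with weight 1 gives absolute integrability, so that [T] may be integrated in
   either order. *)
have intg (h : nat * vec -> R) (cV cW : R) : measurable_fun setT h ->
    (forall q, 0 <= h q) ->
    (\int[prodm cnt mu]_q (h q * V q)%:E <= cV%:E)%E ->
    (\int[prodm cnt mu]_q (h q * Wp q)%:E <= cW%:E)%E ->
    (prodm cnt mu).-integrable setT (EFin \o (fun q => h q * T q)).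
  move=> mh h0 hV hW.
  have i1 := ge0_integrable_lt (mu := prodm cnt mu) (measurable_funM mh mV)
    (fun q => mulr_ge0 (h0 q) (V0 q)) (le_lt_trans hV (ltry _)).
  have i2 := ge0_integrable_lt (mu := prodm cnt mu) (measurable_funM mh mWp)
    (fun q => mulr_ge0 (h0 q) (Wp0 q)) (le_lt_trans hW (ltry _)).
  apply: (le_integrable measurableT _ _ (integrableD measurableT i1 i2)).
    by apply/measurable_EFinP; exact: measurable_funM.
  move=> q _; rewrite /= lee_fin normrM ger0_norm// [leRHS]ger0_norm; last first.
    by rewrite addr_ge0 ?mulr_ge0.
  by rewrite -mulrDr ler_wpM2l//; have := T_le q ltr01; rewrite invr1 !mul1r.
have i1 := intg _ _ _ mS (fun q => S0 q.1) bV1 bW1.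
have i2 := intg _ _ _ mk2 (fun q => k0 q.2) bV2 bW2.
have E1 : \int[prodm cnt mu]_q (S q.1 * T q) = \int[cnt]_i (S i * x i).
  rewrite (Rfubini1 i1).2; apply: eq_Rintegral => i _; rewrite -Tz /=.
  rewrite /S; case: (sel s i); first by rewrite mul1r; under eq_Rintegral do rewrite mul1r.
  by rewrite mul0r; under eq_Rintegral do rewrite mul0r; rewrite /Rintegral integral0.
have E2 : \int[prodm cnt mu]_q (k q.2 * T q) = vol.
  rewrite (Rfubini1 i2).2 (Rfubini i2).
  transitivity (\int[mu]_z k z); last by rewrite /Rintegral int_ink Kvol.
  apply: eq_Rintegral => z _ /=.
  rewrite /k; case: (ink s z); first by under eq_Rintegral do rewrite mul1r; exact: Ti.
  by under eq_Rintegral do rewrite mul0r; rewrite /Rintegral integral0.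
rewrite -/S -E1 -[X in _ - X]E2 -RintegralB//.
have iF := integrableB measurableT i1 i2.
have iF' : (prodm cnt mu).-integrable setT
    (EFin \o (fun q => S q.1 * T q - k q.2 * T q)) by apply: eq_integrable iF.
apply: le_trans (le_normr_Rintegral measurableT iF') _.
pose G1 (q : nat * vec) : R := e * ((S q.1 + k q.2) * V q).
pose G2 (q : nat * vec) : R := e^-1 * ((ink s (pt q.1) != ink s q.2)%:R * Wp q).
have ei0 : 0 < e^-1 by rewrite invr_gt0.
(* The two indicators differ only across the boundary, where [G2] is active. Numbers that encode no
   index are never selected, but there [Wpt] is 0, which forces [T] to vanish too. *)
have le1 (q : nat * vec) : `|S q.1 * T q - k q.2 * T q| <= G1 q + G2 q.
  rewrite -mulrBl normrM /G1 /G2.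
  have := T_le q e0; rewrite /S /k /selected; case Ev: (val q.1) => /= TL; last first.
    have W00 : Wp q = 0 by rewrite /Wpt Ev mul0r.
    have T00 : `|T q| = 0.
      have u10 : u1 q = 0 /\ u2 q = 0.
        have := Ueq q; rewrite W00 => /eqP; rewrite paddr_eq0 ?sqr_ge0// !sqrf_eq0.
        by move=> /andP[/eqP -> /eqP ->].
      by rewrite /T u10.1 u10.2 !mul0r addr0 normr0.
    rewrite T00 mulr0 W00 mulr0 mulr0 addr0; apply: mulr_ge0; [exact: ltW|by apply: mulr_ge0 => //; exact: addr_ge0].
  have VV := V0 q; have WW := Wp0 q.
  case: (ink s (pt q.1)); case: (ink s q.2) => /=.
  - rewrite subrr normr0 mul0r mul0r mulr0 addr0; apply: mulr_ge0; [exact: ltW|by apply: mulr_ge0 => //; exact: addr_ge0].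
  - by rewrite subr0 addr0 normr1 !mul1r.
  - by rewrite sub0r add0r normrN1 !mul1r.
  - rewrite subrr normr0 mul0r mul0r mulr0 addr0; apply: mulr_ge0; [exact: ltW|by apply: mulr_ge0 => //; exact: addr_ge0].
have mX : measurable_fun setT (fun q : nat * vec => (ink s (pt q.1) != ink s q.2)%:R : R).
  apply: (@measurable_nat_pair _ vec _ R) => i /=.
  have -> : (fun z : vec => (ink s (pt i) != ink s z)%:R : R) =
      (fun z : vec => if ink s (pt i) then 1 - (ink s z)%:R else (ink s z)%:R).
    by apply/funext => z; case: (ink s (pt i)); case: (ink s z); rewrite ?subrr ?subr0.
  by case: (ink s (pt i)); [apply: measurable_funB => //; exact: measurable_cst|].
have mG1 : measurable_fun setT (fun q : nat * vec => (G1 q)%:E).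
  apply/measurable_EFinP; apply: measurable_funM; first exact: measurable_cst.
  by apply: measurable_funM => //; exact: measurable_funD.
have mG2 : measurable_fun setT (fun q : nat * vec => (G2 q)%:E).
  apply/measurable_EFinP; apply: measurable_funM; first exact: measurable_cst.
  exact: measurable_funM.
have G10 (q : nat * vec) : (0 <= (G1 q)%:E)%E.
  by rewrite lee_fin; apply: mulr_ge0; [exact: ltW|apply: mulr_ge0 => //; exact: addr_ge0].
have G20 (q : nat * vec) : (0 <= (G2 q)%:E)%E.
  by rewrite lee_fin; apply: mulr_ge0; [exact: ltW|exact: mulr_ge0].
have I1 : (\int[prodm cnt mu]_q (G1 q)%:E <= (e * ((a + vol) * C1))%:E)%E.
  under eq_integral do rewrite /G1 EFinM.
  rewrite ge0_integralZl_EFin//; last 3 first.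
  - by move=> q _; rewrite lee_fin; apply: mulr_ge0 => //; exact: addr_ge0.
  - by apply/measurable_EFinP; apply: measurable_funM => //; exact: measurable_funD.
  - exact: ltW.
  rewrite EFinM; apply: lee_wpmul2l; first by rewrite lee_fin ltW.
  under eq_integral do rewrite mulrDl EFinD.
  rewrite ge0_integralD//; last 4 first.
  - by move=> q _; rewrite lee_fin mulr_ge0.
  - by apply/measurable_EFinP; exact: measurable_funM.
  - by move=> q _; rewrite lee_fin mulr_ge0.
  - by apply/measurable_EFinP; exact: measurable_funM.
  by rewrite mulrDl EFinD; exact: leeD.
have I2 : (\int[prodm cnt mu]_q (G2 q)%:E <= (e^-1 * X)%:E)%E.
  under eq_integral do rewrite /G2 EFinM.
  rewrite ge0_integralZl_EFin//; last 3 first.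
  - by move=> q _; rewrite lee_fin mulr_ge0.
  - by apply/measurable_EFinP; exact: measurable_funM.
  - exact: ltW.
  rewrite EFinM; apply: lee_wpmul2l; first by rewrite lee_fin ltW.
  by rewrite crossing_integral.
have I : (\int[prodm cnt mu]_q `|S q.1 * T q - k q.2 * T q|%:E <=
    (e * ((a + vol) * C1) + e^-1 * X)%:E)%E.
  rewrite EFinD; apply: le_trans (leeD I1 I2); rewrite -ge0_integralD//.
  apply: ge0_le_integral => //.
  - apply/measurable_EFinP; apply: measurableT_comp => //.
    by apply: measurable_funB; exact: measurable_funM.
  - exact: emeasurable_funD.
  - by move=> q _; rewrite -EFinD lee_fin.
rewrite -lee_fin /Rintegral fineK// ge0_fin_numE; first exact: le_lt_trans I (ltry _).
by apply: integral_ge0 => q _; rewrite lee_fin.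
Qed.

End localization.

(** * The limit over large dilates *)

Section localization_limit.
Variables (R : realType) (n : nat).
Notation vec := (rvec R n).
Notation mu := (rvec_measure R n).
Notation cnt := (@counting nat R).
Variables (val : nat -> bool) (pt : nat -> 'rV[R]_n) (W : vec -> R) (B : R).
Hypothesis mW : measurable_fun setT W.
Hypothesis W0 : forall z, 0 <= W z.
Hypothesis Wi : (\int[mu]_z (W z)%:E < +oo)%E.
Hypothesis Wpos : (0 < \int[mu]_z (W z)%:E)%E.
Hypothesis bessel : forall z, (\int[cnt]_i (Wpt val pt W (i, z))%:E <= B%:E)%E.
Variables (N : 'M[R]_n) (c0 : 'rV[R]_n).
Hypothesis Nu : N \in unitmx.

Local Notation sel := (selected val pt N c0).
Local Notation crs := (crossing val pt N c0).
Local Notation v0 := (fine (mu (body N 0 1))).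
Local Notation vol j := (j%:R ^+ n * v0).

Lemma vol_gt0 j : (0 < j)%N -> 0 < vol j.
Proof. by move=> j0; rewrite mulr_gt0 ?exprn_gt0 ?ltr0n// (body1_measure Nu).2. Qed.

(** For positive [j] one has [j + s0 <= (1 + s0) * j], which absorbs the enlargement into the
    constant. *)
Lemma selected_count : exists2 C : R, 0 < C & forall j, (0 < j)%N ->
  (\int[cnt]_i (sel j%:R i)%:R%:E <= (C * vol j)%:E)%E.
Proof.
have [C C0 [s0 [h _]]] := count_constants mW W0 Wi Wpos bessel c0 Nu.
have v00 := (body1_measure Nu).2.
exists (C * (1 + s0)%:R ^+ n / v0).
  by rewrite divr_gt0// mulr_gt0// exprn_gt0.
move=> j j0; apply: le_trans (h j j0) _; rewrite lee_fin.
have v0n : v0 != 0 by rewrite gt_eqF.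
have E (c a b v : R) : v != 0 -> c * a / v * (b * v) = c * (b * a) by move=> vn; field.
rewrite E// ler_pM2l// -exprMn lerXn2r ?nnegrE// -natrM ler_nat.
by rewrite mulnDr muln1 leq_add2l leq_pmull.
Qed.

(** Dominated convergence in the displacement [w]: for fixed [w] the crossings lie in a shell of
    fixed width, negligible against the volume, while the bound uniform in [w] provides the majorant
    [W w * D]. *)
Lemma crossing_cvg0 :
  exists2 X : nat -> R, X j / vol j.+1 @[j --> \oo] --> 0 &
   forall j, (\int[mu]_w ((W w)%:E * \int[cnt]_i (crs j.+1%:R w i)%:R%:E) <= (X j)%:E)%E.
Proof.
have [C C0 [s0 [_ [hs hu]]]] := count_constants mW W0 Wi Wpos bessel c0 Nu.
have v00 := (body1_measure Nu).2.
have vp j : 0 < vol j.+1 by exact: vol_gt0.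
pose ec j (w : vec) := (\int[cnt]_i ((crs j.+1%:R w i)%:R : R)%:E)%E.
have ec0 j w : (0 <= ec j w)%E by apply: integral_ge0 => i _; rewrite lee_fin.
have ecf j w : (ec j w)%E \is a fin_num.
  by rewrite ge0_fin_numE//; apply: le_lt_trans (hu w j.+1 isT) (ltry _).
pose cr j w := fine (ec j w).
have crE j w : ec j w = (cr j w)%:E by rewrite fineK.
have cr0 j w : 0 <= cr j w by exact: fine_ge0.
pose D := 2 * C * (1 + s0)%:R ^+ n / v0.
have D0 : 0 < D by rewrite divr_gt0// !mulr_gt0// exprn_gt0.
have crD j w : cr j w / vol j.+1 <= D.
  rewrite ler_pdivrMr//; apply: (@le_trans _ _ (2 * C * (j.+1 + s0)%:R ^+ n)).
    by rewrite -lee_fin -crE; exact: hu.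
  have v0n : v0 != 0 by rewrite gt_eqF.
  have E (c a b v : R) : v != 0 -> c * a / v * (b * v) = c * (b * a) by move=> vn; field.
  rewrite /D E// ler_pM2l ?mulr_gt0// -exprMn lerXn2r ?nnegrE// -natrM ler_nat.
  by rewrite mulnDr muln1 leq_add2l leq_pmull.
have mink s : measurable_fun setT (fun z : vec => (inK N c0 s z)%:R : R).
  have -> : (fun z : vec => (inK N c0 s z)%:R : R) = \1_(body N c0 s).
    by apply/funext => z; rewrite indicE.
  by apply: measurable_indic; exact: measurable_body.
have mcr j : measurable_fun setT (cr j).
  apply: (measurable_Rintegral2 cnt (F := fun p : vec * nat => (crs j.+1%:R p.1 p.2)%:R)).
  have msw : measurable_fun setT (fun p : vec * nat => (p.2, p.1)).
    by apply/measurable_fun_pairP; split; [exact: measurable_snd|exact: measurable_fst].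
  apply: (measurableT_comp (f := fun q : nat * vec => (crs j.+1%:R q.2 q.1)%:R : R) _ msw).
  apply: (@measurable_nat_pair _ vec _ R) => i /=.
  rewrite /crossing; case: (val i) => /=; last exact: measurable_cst.
  have -> : (fun z : vec => (inK N c0 j.+1%:R (pt i) != inK N c0 j.+1%:R (pt i + z))%:R : R) =
      (fun z : vec => if inK N c0 j.+1%:R (pt i) then 1 - (inK N c0 j.+1%:R ((z : 'rV[R]_n) + pt i))%:R
        else (inK N c0 j.+1%:R ((z : 'rV[R]_n) + pt i))%:R).
    apply/funext => z; rewrite [pt i + z]addrC.
    by case: (inK _ _ _ (pt i)); case: (inK _ _ _ _); rewrite ?subrr ?subr0.
  have m1 := measurableT_comp (mink j.+1%:R) (measurable_rvec_shift (pt i)).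
  by case: (inK _ _ _ (pt i)); [apply: measurable_funB => //; exact: measurable_cst|].
have iW := integrable_W mW W0 Wi.
pose f_ j w := W w * (cr j w / vol j.+1).
have mf_ j : measurable_fun setT (f_ j).
  by apply: measurable_funM => //; apply: measurable_funM => //; exact: measurable_cst.
have f_D j w : `|f_ j w| <= W w * D.
  have f0 : 0 <= f_ j w.
    by apply: mulr_ge0 => //; apply: divr_ge0 => //; exact: ltW.
  by rewrite ger0_norm//; apply: ler_wpM2l => //; exact: crD.
have iWD : mu.-integrable setT (EFin \o (fun w => W w * D)).
  have := integrableZl measurableT D iW; apply: eq_integrable => // w _.
  by rewrite /= mulrC EFinM.
have if_ j : mu.-integrable setT (EFin \o f_ j).
  apply: (le_integrable measurableT _ _ iWD); first exact/measurable_EFinP.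
  move=> w _; rewrite /= lee_fin; apply: le_trans (f_D j w) _.
  exact: ler_norm.
have pt0 w : f_ j w @[j --> \oo] --> (0 : R).
  have [s hsj] := hs w.
  have L : cr j w / vol j.+1 @[j --> \oo] --> (0 : R).
    have R0 : C / v0 * (((j.+1 + s)%:R ^+ n - (j.+1%:R - s%:R) ^+ n) / j.+1%:R ^+ n)
        @[j --> \oo] --> (0 : R).
      rewrite -(mulr0 (C / v0)); apply: cvgM; first exact: cvg_cst.
      exact: shell_ratio_cvg.
    apply: (squeeze_cvgr _ (cvg_cst 0) R0).
    near=> j; apply/andP; split; first by apply: divr_ge0 => //; exact: ltW.
    rewrite ler_pdivrMr//.
    have sj : (s < j.+1)%N by near: j; exact: nbhs_infty_ge.
    have jn0 : j.+1%:R ^+ n != 0 :> R by rewrite expf_neq0.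
    have -> : C / v0 * (((j.+1 + s)%:R ^+ n - (j.+1%:R - s%:R) ^+ n) / j.+1%:R ^+ n) *
       vol j.+1 = C * ((j.+1 + s)%:R ^+ n - (j.+1%:R - s%:R) ^+ n).
      have v0n : v0 != 0 by rewrite gt_eqF.
      move: v0n jn0; move: (v0) (j.+1%:R ^+ n) => a b; move: (_ - _) => c an bn.
      by field; rewrite an bn.
    by rewrite -lee_fin -crE; exact: hsj.
  rewrite -(mulr0 (W w)); apply: cvgM => //; exact: cvg_cst.
exists (fun j => \int[mu]_w (W w * cr j w)).
  have Z : \int[mu]_(w in setT) (0 : R) = 0 by rewrite /Rintegral integral0.
  have EX : (fun j => (\int[mu]_w (W w * cr j w)) / vol j.+1) =
      (fun j => \int[mu]_w f_ j w).
    apply/funext => j; apply/esym.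
    transitivity (\int[mu]_w ((W w * cr j w) * (vol j.+1)^-1)).
      by apply: eq_Rintegral => w _; rewrite /f_ mulrA.
    rewrite RintegralZr//.
    have := integrableZl measurableT (vol j.+1) (if_ j); apply: eq_integrable => // w _.
    by rewrite /= -EFinM /f_ mulrCA [_ * (_ / _)]mulrC divfK// gt_eqF.
  by rewrite EX -Z; exact: (Rintegral_dominated_cvg mf_ pt0 iWD f_D).
move=> j.
have E : (\int[mu]_w ((W w)%:E * \int[cnt]_i (crs j.+1%:R w i)%:R%:E) =
    \int[mu]_w (W w * cr j w)%:E)%E.
  by apply: eq_integral => w _; rewrite EFinM -crE.
rewrite E /Rintegral fineK//.
have : mu.-integrable setT (EFin \o (fun w => W w * cr j w)).
  have := integrableZl measurableT (vol j.+1) (if_ j); apply: eq_integrable => // w _.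
  by rewrite /= -EFinM /f_ mulrCA [_ * (_ / _)]mulrC divfK// gt_eqF.
by move=> /(integrable_fin_num measurableT).
Unshelve. all: by end_near. Qed.

Variables (u1 u2 v1 v2 : nat * vec -> R) (x : nat -> R) (C1 : R).
Hypothesis mu1 : measurable_fun setT u1.
Hypothesis mu2 : measurable_fun setT u2.
Hypothesis mv1 : measurable_fun setT v1.
Hypothesis mv2 : measurable_fun setT v2.
Hypothesis Ueq : forall q, u1 q ^+ 2 + u2 q ^+ 2 = Wpt val pt W q.
Hypothesis Vz : forall i, (\int[mu]_z (v1 (i, z) ^+ 2 + v2 (i, z) ^+ 2)%:E <= C1%:E)%E.
Hypothesis Vi : forall z, (\int[cnt]_i (v1 (i, z) ^+ 2 + v2 (i, z) ^+ 2)%:E <= C1%:E)%E.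
Hypothesis Tz : forall i,
  \int[mu]_z (u1 (i, z) * v1 (i, z) + u2 (i, z) * v2 (i, z)) = x i.
Hypothesis Ti : forall z,
  \int[cnt]_i (u1 (i, z) * v1 (i, z) + u2 (i, z) * v2 (i, z)) = 1.

Lemma localization_cvg :
  (\int[cnt]_i ((sel j%:R i)%:R * x i)) / vol j @[j --> \oo] --> (1 : R).
Proof.
rewrite -cvg_shiftS /=.
have [C C0 selC] := selected_count.
have [X X0 XP] := crossing_cvg0.
have C10 : 0 <= C1.
  rewrite -lee_fin; apply: le_trans (Vz 0); apply: integral_ge0 => z _.
  by rewrite lee_fin addr_ge0 ?sqr_ge0.
have key e j : 0 < e ->
    `|1 - (\int[cnt]_i ((sel j.+1%:R i)%:R * x i)) / vol j.+1| <=
    e * ((C + 1) * C1) + e^-1 * (X j / vol j.+1).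
  move=> e0; have vp : 0 < vol j.+1 by exact: vol_gt0.
  have K := body_volume c0 Nu (ltr0Sn R j).
  have := localization_bound mW W0 Wi Wpos bessel mu1 mu2 mv1 mv2 Ueq Vz Vi Tz Ti e0 K
    (selC j.+1 isT) (XP j).
  set Y := (\int[cnt]_i _) => h.
  move: vp h; move: (vol j.+1) Y (X j) => v y t vp h.
  have vn : v != 0 by rewrite gt_eqF.
  have -> : 1 - y / v = (v - y) / v by field.
  rewrite normrM normfV (gtr0_norm vp) distrC ler_pdivrMr//; apply: le_trans h _.
  rewrite le_eqVlt; apply/orP; left; apply/eqP.
  by move: vn; move: e^-1 => e'; move=> vn; field.
apply/cvgrPdist_le => eps eps0.
(* The volume term is made at most [eps / 2] for every [j], and only then is [j] taken large for the
   crossing term. The [+ 1] guards against a zero denominator. *)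
pose e := eps / 2 / ((C + 1) * C1 + 1).
have den0 : 0 < (C + 1) * C1 + 1 by rewrite ltr_wpDl// mulr_ge0// addr_ge0// ltW.
have e0 : 0 < e by rewrite !divr_gt0.
have L : e^-1 * (X j / vol j.+1) @[j --> \oo] --> (0 : R).
  rewrite -(mulr0 e^-1); apply: cvgM => //; exact: cvg_cst.
have h2 : 0 < eps / 2 by rewrite divr_gt0.
near=> j; apply: le_trans (key e j e0) _.
have q2 : e^-1 * (X j / vol j.+1) <= eps / 2.
  apply: le_trans (ler_norm _) _; apply: ltW; near: j.
  exact: (cvgr0_norm_lt _ L).
have q1 : e * ((C + 1) * C1) <= eps / 2.
  by rewrite /e mulrAC ler_pdivrMr// ler_pM2l// lerDl.
by rewrite (splitr eps) lerD.
Unshelve. all: by end_near. Qed.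

End localization_limit.

(** * Short-time Fourier coefficients of Gabor systems *)

Lemma Rintegral_rvec_shift (R : realType) n (c : 'rV[R]_n) (f : rvec R n -> R) :
  measurable_fun setT f ->
  \int[rvec_measure R n]_x f (((x : 'rV[R]_n) + c)%R : rvec R n) =
  \int[rvec_measure R n]_x f x.
Proof.
move=> mf; rewrite /Rintegral; congr fine.
have mE : measurable_fun setT (EFin \o f) by exact/measurable_EFinP.
rewrite [LHS]integralE [RHS]integralE; congr (_ - _)%E.
- rewrite -[RHS](ge0_integral_rvec_shift c)//; last exact: measurable_funepos.
  by apply: eq_integral => x _; rewrite !funeposE.
- rewrite -[RHS](ge0_integral_rvec_shift c)//; last exact: measurable_funeneg.
  by apply: eq_integral => x _; rewrite !funenegE.
Qed.

Section short_time_fourier.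
Variables (R : realType) (m : nat).
Notation vec m := (rvec R m).
Notation mu m := (rvec_measure R m).

Definition splitv (z : vec (m + m)) : vec m * vec m :=
  (lsubmx (z : 'rV[R]_(m + m)), rsubmx (z : 'rV[R]_(m + m))).

Lemma measurable_splitv : measurable_fun setT splitv.
Proof.
apply/measurable_fun_pairP; split; apply: measurable_rvecP => i /=.
  under eq_fun do rewrite mxE; exact: measurable_coord.
by under eq_fun do rewrite mxE; exact: measurable_coord.
Qed.

Lemma ge0_integral_splitv (f : vec m * vec m -> \bar R) : measurable_fun setT f ->
  (forall x, 0 <= f x)%E ->
  (\int[mu (m + m)]_z f (splitv z) = \int[prodm (mu m) (mu m)]_p f p)%E.
Proof.
move=> mf f0.
have mfs := measurableT_comp mf measurable_splitv.
have E1 := prodm_tonelli1 (mu m) (mu m) mf f0.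
apply: (etrans _ (esym E1)).
apply: (etrans (integral_catv (f := fun z => f (splitv z)) mfs (fun z => f0 _))).
apply: eq_integral => x _; apply: eq_integral => y _.
by rewrite /= /splitv /catv /= row_mxKl row_mxKr.
Qed.

(* The time-frequency shift [x |-> e^{2 pi i <w, x>} 1_{[0,1]^m}(x - t)], [z = (t, w)]. *)
Definition atomv (z : 'rV[R]_(m + m)) : CFun R m :=
  fun x => (atomc (splitv z, x), atoms (splitv z, x)).

Lemma L2c_atomv z : L2c (atomv z).
Proof.
by apply/L2cP; split; [exact: (good_atomc R m).2|exact: (good_atoms R m).2].
Qed.

Lemma ipL2_atomv f z : L2c f -> ipL2 f (atomv z) =
  (kre (mu m) (@atomc R m) (@atoms R m) (rpart f) (ipart f) (splitv z),
   kim (mu m) (@atomc R m) (@atoms R m) (rpart f) (ipart f) (splitv z)).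
Proof.
move=> Lf; have /L2cP[f1 f2] := Lf; have La := L2c_atomv z.
have gc := good_atomc R m; have gs := good_atoms R m.
rewrite [LHS]surjective_pairing ipL2_re// ipL2_im//; congr pair.
  by rewrite (kreE gc gs).
by rewrite (kimE gc gs).
Qed.

Lemma measurable_coef_re f : L2c f ->
  measurable_fun setT (fun z : vec (m + m) => (ipL2 f (atomv z)).1).
Proof.
move=> Lf; have /L2cP[f1 f2] := Lf.
under eq_fun do rewrite ipL2_atomv//=.
apply: (measurableT_comp _ measurable_splitv).
exact: (measurable_kre (good_atomc R m) (good_atoms R m) f1.1 f2.1).
Qed.

Lemma measurable_coef_im f : L2c f ->
  measurable_fun setT (fun z : vec (m + m) => (ipL2 f (atomv z)).2).
Proof.
move=> Lf; have /L2cP[f1 f2] := Lf.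
under eq_fun do rewrite ipL2_atomv//=.
apply: (measurableT_comp _ measurable_splitv).
exact: (measurable_kim (good_atomc R m) (good_atoms R m) f1.1 f2.1).
Qed.

Lemma moyal_norm f : L2c f ->
  (\int[mu (m + m)]_z (cabs2 (ipL2 f (atomv z)))%:E = ((ipL2 f f).1)%:E)%E.
Proof.
move=> Lf; have /L2cP[f1 f2] := Lf.
rewrite ipL2_sqr// -(tight_atom f1 f2) -ge0_integral_splitv.
- by apply: eq_integral => z _; rewrite ipL2_atomv.
- apply/measurable_EFinP; apply: measurable_funD; apply: measurable_funX.
    exact: (measurable_kre (good_atomc R m) (good_atoms R m) f1.1 f2.1).
  exact: (measurable_kim (good_atomc R m) (good_atoms R m) f1.1 f2.1).
- by move=> x; rewrite lee_fin addr_ge0 ?sqr_ge0.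
Qed.

Lemma sqint_coef f : L2c f ->
  sqint (mu (m + m)) (fun z => (ipL2 f (atomv z)).1) /\
  sqint (mu (m + m)) (fun z => (ipL2 f (atomv z)).2).
Proof.
move=> Lf; have m1 := measurable_coef_re Lf; have m2 := measurable_coef_im Lf.
have mS : measurable_fun setT (fun z : vec (m + m) => (cabs2 (ipL2 f (atomv z)))%:E).
  by apply/measurable_EFinP; apply: measurable_funD; exact: measurable_funX.
have fin : (\int[mu (m + m)]_z (cabs2 (ipL2 f (atomv z)))%:E < +oo)%E.
  by rewrite moyal_norm// ltry.
by split; split => //; apply: le_lt_trans fin; apply: ge0_le_integral => //;
  try (by move=> z _; rewrite lee_fin sqr_ge0); try exact: measurable_sqrE;
  move=> z _; rewrite lee_fin /cabs2 ?lerDl ?lerDr sqr_ge0.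
Qed.

(** Polarization: only the real part is needed, so comparing the norms of [f], [h] and [f + h]
    suffices. *)
Lemma moyal f h : L2c f -> L2c h ->
  \int[mu (m + m)]_z ((ipL2 f (atomv z)).1 * (ipL2 h (atomv z)).1
     + (ipL2 f (atomv z)).2 * (ipL2 h (atomv z)).2) = (ipL2 f h).1.
Proof.
move=> Lf Lh; have LD := L2cD Lf Lh.
have [f1 f2] := sqint_coef Lf; have [h1 h2] := sqint_coef Lh.
have normE g : L2c g -> \int[mu (m + m)]_z cabs2 (ipL2 g (atomv z)) = (ipL2 g g).1.
  by move=> Lg; rewrite /Rintegral moyal_norm.
have i1 := sqint_mul f1 h1; have i2 := sqint_mul f2 h2.
have i12 := integrableD measurableT i1 i2.
have iS g : L2c g -> (mu (m + m)).-integrable setT (EFin \o (fun z => cabs2 (ipL2 g (atomv z)))).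
  move=> Lg; have [g1 g2] := sqint_coef Lg.
  have := integrableD measurableT (sqint_mul g1 g1) (sqint_mul g2 g2).
  by apply: eq_integrable => // z _; rewrite /= /cabs2 !expr2.
have nD := normE _ LD; have nf := normE _ Lf; have nh := normE _ Lh.
pose c z := (ipL2 f (atomv z)).1 * (ipL2 h (atomv z)).1
     + (ipL2 f (atomv z)).2 * (ipL2 h (atomv z)).2.
have ic : (mu (m + m)).-integrable setT (EFin \o c) by exact: i12.
have ic2 : (mu (m + m)).-integrable setT (EFin \o (fun z => 2 * c z)).
  by have := integrableZl measurableT 2 ic; apply: eq_integrable.
have E : \int[mu (m + m)]_z cabs2 (ipL2 (f + h : CFun R m) (atomv z)) =
    \int[mu (m + m)]_z cabs2 (ipL2 f (atomv z)) + \int[mu (m + m)]_z cabs2 (ipL2 h (atomv z))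
    + 2 * \int[mu (m + m)]_z c z.
  rewrite -RintegralD//; [|exact: iS..].
  have isum : (mu (m + m)).-integrable setT (EFin \o
      (fun z => cabs2 (ipL2 f (atomv z)) + cabs2 (ipL2 h (atomv z)))).
    by have := integrableD measurableT (iS _ Lf) (iS _ Lh); apply: eq_integrable.
  rewrite -RintegralZl// -RintegralD//.
  apply: eq_Rintegral => z _; have La := L2c_atomv z.
  by rewrite /cabs2 /c ipL2_reD// ipL2_imD//; ring.
have E2 : (ipL2 (f + h : CFun R m) (f + h : CFun R m)).1 =
    (ipL2 f f).1 + (ipL2 h h).1 + 2 * (ipL2 f h).1.
  rewrite ipL2_reD// (ipL2_reC Lf LD) (ipL2_reC Lh LD) !ipL2_reD//.
  by rewrite (ipL2_reC Lh Lf); ring.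
move: E; rewrite nD nf nh E2 => /addrI /(mulfI _) -> //.
Qed.

Lemma atomv_norm z : (ipL2 (atomv z) (atomv z)).1 = 1.
Proof.
apply: EFin_inj; have La := L2c_atomv z; have /L2cP[a1 a2] := La.
rewrite ipL2_sqr// -ge0_integralD//; last 4 first.
- by move=> x _; rewrite lee_fin sqr_ge0.
- exact: measurable_sqrE a1.1.
- by move=> x _; rewrite lee_fin sqr_ge0.
- exact: measurable_sqrE a2.1.
rewrite -(integral_window (lsubmx z)); apply: eq_integral => x _.
rewrite -EFinD /rpart /ipart /= /atomc /atoms /= !exprMn -mulrDr cos2Dsin2 mulr1.
by rewrite /window indicE; case: (_ \in _); rewrite ?expr1n ?expr0n.
Qed.

Lemma integrable_ipL2 f h : L2c f -> L2c h ->
  (mu m).-integrable setT (EFin \o (fun x => (cmul (f x) (cconj (h x))).1)) /\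
  (mu m).-integrable setT (EFin \o (fun x => (cmul (f x) (cconj (h x))).2)).
Proof.
move=> /L2cP[f1 f2] /L2cP[h1 h2]; split.
  have := integrable_linc 1 (sqint_mul f1 h1) (sqint_mul f2 h2).
  by apply: eq_integrable => // x _; rewrite /= mulrN opprK mul1r.
have := integrable_linc (-1) (sqint_mul f2 h1) (sqint_mul f1 h2).
by apply: eq_integrable => // x _; rewrite /= mulrN mulN1r addrC.
Qed.

Lemma phaseD (w x y : 'rV[R]_m) : phase w (x + y) = phase w x + phase w y.
Proof.
rewrite /phase -mulrDr -big_split; congr (_ * _); apply: eq_bigr => j _ /=.
by rewrite mxE mulrDr.
Qed.

Lemma phaseB (w w' x : 'rV[R]_m) : phase (w - w') x = phase w x - phase w' x.
Proof.
rewrite /phase -mulrBr -sumrB; congr (_ * _); apply: eq_bigr => j _ /=.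
by rewrite !mxE mulrBl.
Qed.

(* Time-frequency shifts commute up to a unimodular constant. *)
Lemma gabor_coef g ph s z : L2c g -> L2c (gabor g ph s) ->
  cabs2 (ipL2 (gabor g ph s) (atomv z)) = cabs2 (ipL2 g (atomv (z - s))).
Proof.
move=> Lg LG; have La := L2c_atomv z; have La' := L2c_atomv (z - s).
set t0 := lsubmx s; set w0 := rsubmx s.
(* The unimodular factor left over when the shift by [s] is moved from the Gabor vector to the
   atom. *)
pose th := ph - phase (rsubmx z - w0) t0.
pose P x := cmul (gabor g ph s x) (cconj (atomv z x)).
pose P' x := cmul (g x) (cconj (atomv (z - s) x)).
have [iP1 iP2] := integrable_ipL2 LG La.
have [iP1' iP2'] := integrable_ipL2 Lg La'.
have PE x : P (x + t0) = cmul (cexpi th) (P' x).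
  rewrite /P /P' /gabor /atomv /atomc /atoms /= addrK.
  have -> : lsubmx (z - s) = lsubmx z - t0 by rewrite linearB.
  have -> : rsubmx (z - s) = rsubmx z - w0 by rewrite linearB.
  have -> : x - (lsubmx z - t0) = x + t0 - lsubmx z by rewrite opprB addrA addrAC.
  rewrite -/(phase w0 (x + t0)) phaseB [phase (rsubmx z) (x + t0)]phaseD.
  rewrite [phase w0 (x + t0)]phaseD /th phaseB.
  set a := phase (rsubmx z) t0; set b := phase w0 t0.
  set c := phase (rsubmx z) x; set e := phase w0 x.
  set W := window _; case: (g x) => p q.
  (* The angle of [e_z] at [x + t0] splits into the angle of the atom at [z - s], the part absorbed
     by [th], and the part cancelled by the modulation of the Gabor vector. *)
  have E : (W * cos (c + a), W * sin (c + a)) =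
     cmul (cmul (W * cos (c - e), W * sin (c - e)) (cexpi (a - b))) (cexpi (e + b)).
    have -> : c + a = (c - e) + (a - b) + (e + b) by ring.
    move: (c - e) (a - b) (e + b) => p' q' r'.
    by rewrite /cmul /cexpi /= !(cosD, sinD); congr pair; ring.
  have [E1 E2] : W * cos (c + a) = (cmul (cmul (W * cos (c - e), W * sin (c - e)) (cexpi (a - b))) (cexpi (e + b))).1 /\
     W * sin (c + a) = (cmul (cmul (W * cos (c - e), W * sin (c - e)) (cexpi (a - b))) (cexpi (e + b))).2.
    by rewrite -E.
  rewrite /cconj E1 E2 /cmul /cexpi /= [cos (ph - _)]cosB [sin (ph - _)]sinB.
  have U := cos2Dsin2 (e + b).
  move: U; move: (cos (e + b)) (sin (e + b)) (cos (a - b)) (sin (a - b)) (cos ph) (sin ph)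
    (W * cos (c - e)) (W * sin (c - e)) => x1 x2 x3 x4 x5 x6 x7 x8 U.
  have x1E : x1 ^+ 2 = 1 - x2 ^+ 2 by rewrite -U addrK.
  congr pair; ring: x1E.
have mP1 : measurable_fun setT (fun x : vec m => (P x).1).
  by apply/measurable_EFinP; exact: (measurable_int _ iP1).
have mP2 : measurable_fun setT (fun x : vec m => (P x).2).
  by apply/measurable_EFinP; exact: (measurable_int _ iP2).
have s1 := Rintegral_rvec_shift t0 mP1; have s2 := Rintegral_rvec_shift t0 mP2.
have e1 : (ipL2 (gabor g ph s) (atomv z)).1 =
    cos th * (ipL2 g (atomv (z - s))).1 - sin th * (ipL2 g (atomv (z - s))).2.
  rewrite /ipL2 /= (Rint_integrable iP1) (Rint_integrable iP1') (Rint_integrable iP2').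
  rewrite -/P -[LHS]s1 -RintegralZl// -RintegralZl//.
  rewrite -RintegralB//; last 2 first.
  - by have := integrableZl measurableT (cos th) iP1'; apply: eq_integrable.
  - by have := integrableZl measurableT (sin th) iP2'; apply: eq_integrable.
  by apply: eq_Rintegral => x _; rewrite PE.
have e2 : (ipL2 (gabor g ph s) (atomv z)).2 =
    cos th * (ipL2 g (atomv (z - s))).2 + sin th * (ipL2 g (atomv (z - s))).1.
  rewrite /ipL2 /= (Rint_integrable iP2) (Rint_integrable iP1') (Rint_integrable iP2').
  rewrite -/P -[LHS]s2 -RintegralZl// -RintegralZl//.
  rewrite -RintegralD//; last 2 first.
  - by have := integrableZl measurableT (cos th) iP2'; apply: eq_integrable.
  - by have := integrableZl measurableT (sin th) iP1'; apply: eq_integrable.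
  by apply: eq_Rintegral => x _; rewrite PE.
rewrite /cabs2 e1 e2; have U := cos2Dsin2 th.
move: U; move: (cos th) (sin th) (ipL2 _ _).1 (ipL2 _ _).2 => x1 x2 p q U.
have -> : (x1 * p - x2 * q) ^+ 2 + (x1 * q + x2 * p) ^+ 2 =
  (x1 ^+ 2 + x2 ^+ 2) * (p ^+ 2 + q ^+ 2) by ring.
by rewrite U mul1r.
Qed.

End short_time_fourier.

(** * Limits along free ultrafilters *)

Section free_ultrafilter_limits.
Variables (R : realType) (p : set_system nat).
Hypothesis fp : free_ultrafilter p.

Lemma free_ultrafilter_proper : ProperFilter p.
Proof.
case: fp => -[p0 pT] pI pS _ _; split; first exact: p0.
by split => //; exact: pS.
Qed.

Local Instance proper_p : ProperFilter p := free_ultrafilter_proper.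

(** [ulim] picks some limit by [epsilon]; limits along a proper filter in a Hausdorff space are
    unique. *)
Lemma ulim_cvg (u : nat -> R) (L : R) : u n @[n --> p] --> L -> ulim p u = L.
Proof.
move=> uL.
have H (L' : R) : (forall e : R, 0 < e -> p [set n | `|u n - L'| < e]) ->
    u n @[n --> p] --> L'.
  move=> h; apply/cvgrPdist_lt => e e0; have [_ _ pS _ _] := fp.
  by apply: pS (h e e0) => n /=; rewrite distrC.
apply: (cvg_unique (@Rhausdorff R) _ uL).
apply: H; apply: (ClassicalEpsilon.epsilon_spec (inhabits 0)
  (fun L => forall e : R, 0 < e -> p [set n | `|u n - L| < e])).
exists L => e e0; move/cvgrPdist_lt: uL => /(_ e e0).
by have [_ _ pS _ _] := fp; apply: pS => n /=; rewrite distrC.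
Qed.

(** An ultrafilter missing a cofinite set would contain its finite complement. *)
Lemma free_ultrafilter_oo : p --> \oo.
Proof.
move=> A [N _ NA]; have [_ _ pS pU pF] := fp.
case: (pU A) => // pA; exfalso; apply: (pF _ _ pA).
apply: (sub_finite_set _ (finite_II N)) => n An /=.
by rewrite ltnNge; apply/negP => /NA.
Qed.

Lemma cvg_free (u : nat -> R) (L : R) : u n @[n --> \oo] --> L -> u n @[n --> p] --> L.
Proof. by move=> uL A LA; exact: free_ultrafilter_oo (uL A LA). Qed.

(** The push-forward of [p] is an ultrafilter on a compact segment, hence convergent. *)
Lemma bounded_ulim_cvg (u : nat -> R) C : (forall n, `|u n| <= C) ->
  exists L : R, u n @[n --> p] --> L.
Proof.
move=> uC; have [[p0 pT] pI pS pU pF] := fp.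
have UF : UltraFilter (u n @[n --> p]).
  split; first exact: fmap_proper_filter.
  move=> G PG FG; apply/seteqP; split => // A GA.
  have [//|pA] := pU (u @^-1` A).
  exfalso; have GC : G (~` A) by exact: FG.
  have GI := filterI GA GC; rewrite setICr in GI.
  exact: (@filter_not_empty _ G PG (GI _)).
have := @segment_compact R (- C) C; rewrite compact_ultra => /(_ _ UF) [].
  apply: pS pT => n _ /=; rewrite in_itv /=.
  by rewrite -ler_norml.
by move=> L [_ uL]; exists L.
Qed.

End free_ultrafilter_limits.

(** * Finite sums as counting integrals *)

Section counting_sums.
Variables (R : realType) (I : countType).
Notation cnt := (@counting nat R).

Let ge0_count_fsum (S : set I) (f : I -> R) : finite_set S -> (forall i, 0 <= f i) ->
  (\int[cnt]_n (nat_ext 0 (fun i => `[<S i>]%:R * f i) n)%:E = (\sum_(i \in S) f i)%:E)%E.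
Proof.
move=> fS f0.
transitivity (\int[cnt]_n nat_ext 0 (fun i => (`[<S i>]%:R * f i)%:E) n)%E.
  by apply: eq_integral => n _; rewrite /nat_ext; case: (pickle_inv n).
rewrite -esum_nat; last by move=> i; rewrite lee_fin mulr_ge0.
transitivity (\esum_(i in S) (f i)%:E)%E.
  rewrite [RHS]esum_mkcond; apply: eq_esum => i _.
  rewrite (_ : `[<S i>] = (i \in S)) //.
  by case: (i \in S); rewrite ?mul1r ?mul0r.
rewrite esum_fset//; last by move=> i _; rewrite lee_fin.
by rewrite !fsbig_finite//= sumEFin.
Qed.

(** A signed [f] is the difference of the nonnegative families [f + |f|] and [|f|], to which the
    nonnegative case applies. *)
Lemma count_fsum (S : set I) (f : I -> R) : finite_set S ->
  \int[cnt]_n (nat_ext 0 (fun i => `[<S i>]%:R * f i) n) = \sum_(i \in S) f i.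
Proof.
move=> fS; pose g i := f i + `|f i|.
have g0 i : 0 <= g i by rewrite /g; have := ler_norm (- f i); rewrite normrN; lra.
have gE := ge0_count_fsum fS g0.
have nE := ge0_count_fsum fS (fun i => normr_ge0 (f i)).
have ext0 (h : I -> R) n : (forall i, 0 <= h i) -> 0 <= nat_ext 0 (fun i => `[<S i>]%:R * h i) n.
  by move=> h0; rewrite /nat_ext; case: (pickle_inv n) => //= i; rewrite mulr_ge0.
have int (h : I -> R) : (forall i, 0 <= h i) ->
    (\int[cnt]_n (nat_ext 0 (fun i => `[<S i>]%:R * h i) n)%:E = (\sum_(i \in S) h i)%:E)%E ->
    cnt.-integrable setT (EFin \o nat_ext 0 (fun i => `[<S i>]%:R * h i)).
  move=> h0 hE; apply: ge0_integrable_lt => //; first by move=> n; exact: ext0.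
  by rewrite hE ltry.
transitivity (\int[cnt]_n (nat_ext 0 (fun i => `[<S i>]%:R * g i) n -
    nat_ext 0 (fun i => `[<S i>]%:R * `|f i|) n)).
  apply: eq_Rintegral => n _; rewrite /nat_ext; case: (pickle_inv n) => /= [i|].
    by rewrite -mulrBr /g addrK.
  by rewrite subr0.
rewrite RintegralB//; [|exact: int..].
rewrite /Rintegral gE nE /= !fsbig_finite//= -sumrB.
by apply: eq_bigr => i _; rewrite /g addrK.
Qed.

(** Infinite sets have infinite counting measure. Finiteness has to be secured, since a sum over an
    infinite support is 0 by convention and [mcount] would then be meaningless. *)
Lemma count_finite (S : set I) (a : R) :
  (\int[cnt]_n (nat_ext 0 (fun i => `[<S i>]%:R) n)%:E <= a%:E)%E -> finite_set S.
Proof.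
move=> h; pose A : set nat := [set n | nat_ext false (fun i => `[<S i>]) n].
have AE : (\int[cnt]_n (nat_ext 0 (fun i => `[<S i>]%:R) n)%:E = cnt A :> \bar R)%E.
  transitivity (\int[cnt]_n (\1_A n)%:E)%E; last by rewrite integral_indic// setIT.
  apply: eq_integral => n _; rewrite indicE.
  have -> : (n \in A) = nat_ext false (fun i => `[<S i>]) n.
    by apply/idP/idP => [/set_mem//|h']; exact/mem_set.
  by rewrite /nat_ext; case: (pickle_inv n).
have fA : finite_set A.
  apply: contrapT => nA; suff : (+oo <= a%:E)%E by rewrite leye_eq.
  by move: h; rewrite AE /counting asboolF.

have : finite_set ((@pickle I) @^-1` A).
  apply: (@finite_preimage _ _ A (@pickle I)) fA => x y _ _.
  exact: (pcan_inj pickleK).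
apply: sub_finite_set => i Si /=; rewrite /A /= nat_ext_pickle.
exact/asboolP.
Qed.

Lemma mcount_le (S : set I) (f : I -> R) C : finite_set S ->
  (forall i, `|f i| <= C) -> `|\sum_(i \in S) f i| <= C * mcount S.
Proof.
move=> fS fC; rewrite /mcount !fsbig_finite//=.
apply: le_trans (ler_norm_sum _ _ _) _; rewrite mulr_sumr.
by apply: ler_sum => i _; rewrite mulr1.
Qed.

(** The overlap cancels, and the bracket is the size of the symmetric difference. *)
Lemma fsum_symdiff (S T : set I) (f : I -> R) C : finite_set S -> finite_set T ->
  (forall i, `|f i| <= C) ->
  `|\sum_(i \in S) f i - \sum_(i \in T) f i| <=
  C * (mcount S + mcount T - 2 * mcount (S `&` T)).
Proof.
move=> fS fT fC.
have -> : mcount S = mcount (S `&` T) + mcount (S `&` ~` T) :> R by exact: fsbigID.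
have -> : mcount T = mcount (S `&` T) + mcount (T `&` ~` S) :> R.
  by rewrite [S `&` T]setIC; exact: fsbigID.
rewrite (fsbigID T) // [X in _ - X](fsbigID S)// [T `&` S]setIC.
set a := \sum_(i \in S `&` T) _; rewrite opprD addrACA subrr add0r.
have -> : mcount (S `&` T) + mcount (S `&` ~` T) + (mcount (S `&` T) + mcount (T `&` ~` S))
   - 2 * mcount (S `&` T) = mcount (S `&` ~` T) + mcount (T `&` ~` S) :> R by ring.
rewrite mulrDr; apply: le_trans (ler_normB _ _) _.
by apply: lerD; apply: mcount_le => //; exact: finite_setIl.
Qed.

Lemma mcount_bij (J : countType) (a : I -> J) (S : set J) : bijective a ->
  mcount (a @^-1` S) = mcount S :> R.
Proof.
rewrite -setTT_bijective => -[_ ainj asurj]; rewrite /mcount.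
apply/esym/(reindex_fsbig a); split; first by move=> i.
- by move=> i j _ _ ij; apply: ainj => //; rewrite inE.
- by move=> j Sj; have [i _ ij] := asurj j Logic.I; exists i => //; rewrite /preimage/= ij.
Qed.

End counting_sums.

Lemma ipL2_re_bound (R : realType) m (f h : CFun R m) : L2c f -> L2c h ->
  `|(ipL2 f h).1| <= (ipL2 f f).1 + (ipL2 h h).1.
Proof.
move=> Lf Lh.
have sq (c : R) : 0 <= (ipL2 f f).1 + 2 * (c * (ipL2 f h).1) + c ^+ 2 * (ipL2 h h).1.
  have Lc := L2cZ c Lh; have LD := L2cD Lf Lc.
  have := ipL2_re_ge0 LD.
  rewrite ipL2_reD// (ipL2_reC Lf LD) (ipL2_reC Lc LD) !ipL2_reD//.
  rewrite (ipL2_reC Lf Lc) ipL2_reZ// ipL2_reZ// (ipL2_reC Lh Lc) ipL2_reZ//.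
  rewrite (ipL2_reC Lh Lf); congr (0 <= _); ring.
have := sq 1; have := sq (-1).
have := ipL2_re_ge0 Lf; have := ipL2_re_ge0 Lh.
by rewrite ler_norml; move: (ipL2 _ _).1 (ipL2 _ _).1 (ipL2 _ _).1 => a b c *; lra.
Qed.

Section bodies_MQ.
Variables (R : realType) (n : nat) (M : 'M[R]_n) (O : 'rV[R]_n).
Hypothesis Mu : M \in unitmx.

Lemma MQ_body j : MQ M O j = body (invmx M^T) O j%:R.
Proof.
have MTu : M^T \in unitmx by rewrite unitmx_tr.
apply/seteqP; split => [v [w [Qw ->]] i|v h].
  by rewrite mulmxK//; exact: Qw.
by exists (v *m invmx M^T); split; [exact: h|rewrite mulmxKV].
Qed.

Lemma volm_MQ j : (0 < j)%N ->
  volm (MQ M O j) = j%:R ^+ n * fine (rvec_measure R n (body (invmx M^T) 0 1)).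
Proof.
move=> j0; have Nu : invmx M^T \in unitmx by rewrite unitmx_inv unitmx_tr.
rewrite /volm MQ_body; have mK := measurable_body (invmx M^T) O j%:R.
rewrite iint_ge0; last 2 first.
- by apply/measurable_EFinP; exact: measurable_indic.
- by move=> v; rewrite lee_fin.
have -> : (\int[rvec_measure R n]_v (\1_(body (invmx M^T) O j%:R) v)%:E =
    rvec_measure R n (body (invmx M^T) O j%:R))%E by rewrite integral_indic// setIT.
by rewrite body_volume// ltr0n.
Qed.

Lemma volm_MQ_gt0 j : (0 < j)%N -> 0 < volm (MQ M O j).
Proof.
move=> j0; rewrite volm_MQ//; apply: vol_gt0 => //.
by rewrite unitmx_inv unitmx_tr.
Qed.

End bodies_MQ.

(** * The diagonal terms of one component *)

Section dual_frame.
Variables (R : realType) (m d : nat).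
Notation V := ('I_d -> 'rV[R]_m -> R * R).
Notation mem := (@dsum_mem R m d).
Notation ip := (@dsum_ip R m d).
Variables (I : countType) (F : I -> V).
Hypothesis hF : is_frame mem ip F.

Definition dual i : V := can_dual mem ip (@zero_vec R m d) F i.

Let H := @dsum_hilbert R m d.

Lemma dual_ext_spec n : mem (nat_ext 0 dual n) /\ (forall f, mem f ->
  frame_form ip (nat_ext 0 F) (nat_ext 0 dual n) f = (ip (nat_ext 0 F n) f).1).
Proof.
have [[i <-]|none] := pselect (exists i : I, pickle i = n).
  by rewrite !nat_ext_pickle; exact: (can_dual_spec H _ hF i).
rewrite !(nat_ext_None _ _ none).
have m0 := ch_mem0 H; split => // f mf.
have z h : mem h -> ip 0 h = 0.
  move=> mh; apply: injective_projections.
    by rewrite (ch_reC H m0 mh) (ch_ipr0 H mh).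
  by rewrite (ch_imC H m0 mh) (ch_ipr0 H mh) oppr0.
rewrite z// /frame_form -[RHS](_ : \int[@counting nat R]_(n in setT) (0 : R) = 0); last first.
  by rewrite /Rintegral integral0.
apply: eq_Rintegral => j _; rewrite /cdot z; last exact: (mem_nat_ext H hF).
by rewrite !mul0r addr0.
Qed.

Lemma dual_mem i : mem (dual i).
Proof. by have [] := dual_ext_spec (pickle i); rewrite nat_ext_pickle. Qed.

Lemma dual_diag i : 0 <= (ip (F i) (dual i)).1 <= 1.
Proof.
have [A [B [A0 lb ub]]] := nat_frame_bounds H hF.
have := dual_diag_bounds H (mem_nat_ext H hF) A0 lb ub
  (fun n => (dual_ext_spec n).1) (fun n => (dual_ext_spec n).2) (pickle i).
by rewrite !nat_ext_pickle.
Qed.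

Section component.
Variables (k : 'I_d) (g : CFun R m) (ph : I -> R) (pt : I -> 'rV[R]_(m + m)).
Variables (M : 'M[R]_(m + m)) (O : 'rV[R]_(m + m)).
Hypothesis Lg : L2c g.
Hypothesis Fk : forall i, F i k = gabor g (ph i) (pt i).
Hypothesis Mu : M \in unitmx.

Definition diag_part i : R := (ipL2 (F i k) (dual i k)).1.
Definition in_region j : set I := [set i | MQ M O j (pt i)].

(** Test vectors supported in the summand [k]: through them the frame bounds, the dual Bessel bound
    and the reconstruction formula of the whole frame become statements about component [k]. *)
Definition atom_at (z : 'rV[R]_(m + m)) : V := 
  fun j => if j == k then atomv z else (0 : CFun R m).

Lemma atom_at_mem z : mem (atom_at z).
Proof.
by move=> j; rewrite /atom_at; case: eqP => _; [exact: L2c_atomv|exact: L2c0].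
Qed.

Let ipL2_0 (f : CFun R m) : L2c f -> ipL2 f (0 : CFun R m) = 0.
Proof.
move=> Lf; have L0 := @L2c0 R m.
have E1 : (ipL2 (0 : CFun R m) f).1 = 0 by rewrite -(scale0r (0 : CFun R m)) ipL2_reZ// mul0r.
have E2 : (ipL2 (0 : CFun R m) f).2 = 0 by rewrite -(scale0r (0 : CFun R m)) ipL2_imZ// mul0r.
apply: injective_projections; first by rewrite ipL2_reC// E1.
by rewrite ipL2_imC// E2 oppr0.
Qed.

Lemma ip_atom_at (f : V) z : mem f -> ip f (atom_at z) = ipL2 (f k) (atomv z).
Proof.
move=> mf; have Ek : atom_at z k = atomv z by rewrite /atom_at eqxx.
have Ej j : j != k -> ipL2 (f j) (atom_at z j) = 0.
  by move=> jk; rewrite /atom_at (negbTE jk) ipL2_0.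
rewrite [RHS]surjective_pairing /dsum_ip; congr pair; rewrite (bigD1 k)//= Ek big1 ?addr0//.
  by move=> j /Ej; rewrite /ipL2 => -[].
by move=> j /Ej; rewrite /ipL2 => -[].
Qed.

Lemma atom_at_norm z : (ip (atom_at z) (atom_at z)).1 = 1.
Proof.
by rewrite ip_atom_at; [rewrite /atom_at eqxx; exact: atomv_norm|exact: atom_at_mem].
Qed.

Lemma cabs2_ipC (f h : V) : mem f -> mem h -> cabs2 (ip f h) = cabs2 (ip h f).
Proof.
by move=> mf mh; rewrite /cabs2 (ch_reC H mf mh) (ch_imC H mf mh) sqrrN.
Qed.

(** Supplies the hypotheses of the localization theorem: Bessel bounds and the unit sum over [i]
    come from the direct-sum frame tested on [atom_at z], and the integral over [z] is Moyal's
    identity. *)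
Lemma component_limit :
  [/\ exists C, forall i, `|diag_part i| <= C,
   exists2 C, 0 < C & forall j, (0 < j)%N -> finite_set (in_region j) /\
       mcount (in_region j) <= C * volm (MQ M O j) &
   (\sum_(i \in in_region j) diag_part i) / volm (MQ M O j) @[j --> \oo] --> (1 : R)].
Proof.
have [A [B [A0 lb ub]]] := nat_frame_bounds H hF.
have mF := mem_nat_ext H hF.
have mD n : mem (nat_ext 0 dual n) := (dual_ext_spec n).1.
have Dd n := (dual_ext_spec n).2.
pose Fs := nat_ext 0 F; pose Ds := nat_ext 0 dual.
pose val n : bool := pickle_inv (T := I) n.
pose pts n := nat_ext 0 pt n.
pose W (z : rvec R (m + m)) := cabs2 (ipL2 g (atomv z)).
have mW : measurable_fun setT W.
  apply: measurable_funD; apply: measurable_funX.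
    exact: measurable_coef_re.
  exact: measurable_coef_im.
have W0 z : 0 <= W z by rewrite addr_ge0 ?sqr_ge0.
have Wi : (\int[rvec_measure R (m + m)]_z (W z)%:E < +oo)%E by rewrite moyal_norm// ltry.
have LF i : L2c (F i k) by have [h _] := hF; exact: h.
(* Numbers outside the image of [pickle] carry the zero vector, and there [val] makes [Wpt] vanish
   as well. *)
have UE n z : cabs2 (ipL2 (Fs n k) (atomv z)) = Wpt val pts W (n, z).
  rewrite /Wpt /Fs /val /pts /nat_ext /=; case: (pickle_inv n) => [i|] /=.
    by rewrite mul1r Fk gabor_coef// -Fk.
  rewrite mul0r /cabs2 (_ : ipL2 _ _ = 0) /= ?expr0n ?addr0//.
  have L0 := @L2c0 R m; have La := L2c_atomv z; have E := ipL2_0 La.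
  apply: injective_projections; first by rewrite ipL2_reC// E.
  by rewrite ipL2_imC// E oppr0.
have UE' n z : cabs2 (ip (atom_at z) (Fs n)) = Wpt val pts W (n, z).
  have ma := atom_at_mem z.
  by rewrite cabs2_ipC// ip_atom_at// UE.
have bessel z : (\int[@counting nat R]_n (Wpt val pts W (n, z))%:E <= B%:E)%E.
  have := ub _ (atom_at_mem z); rewrite atom_at_norm mulr1; apply: le_trans.
  by rewrite le_eqVlt; apply/orP; left; apply/eqP; apply: eq_integral => n _; rewrite -UE'.
(* With no mass in [W], the frame sums tested on [atom_at z] would have zero integral over [z],
   whereas the lower frame bound makes them at least [A] on the unit cube. *)
have Wpos : (0 < \int[rvec_measure R (m + m)]_z (W z)%:E)%E.
  rewrite lt_neqAle integral_ge0 ?andbT; last by move=> z _; rewrite lee_fin.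
  apply/eqP => Wz.
  have mWp := measurable_Wpt val pts mW.
  have mWE : measurable_fun setT (fun q => (Wpt val pts W q)%:E) by exact/measurable_EFinP.
  have Wp0 q : 0 <= Wpt val pts W q by exact: Wpt_ge0.
  have Wp0E q : (0 <= (Wpt val pts W q)%:E)%E by rewrite lee_fin.
  have z0 : (\int[prodm (@counting nat R) (rvec_measure R (m + m))]_q (Wpt val pts W q)%:E = 0)%E.
    rewrite (prodm_tonelli1 _ _ mWE Wp0E); apply: integral0_eq => n _.
    apply/eqP; rewrite eq_le integral_ge0 ?andbT; last by move=> z _; exact: Wp0E.
    by rewrite Wz; exact: Wpt_integral_le.
  suff : (A%:E <= 0)%E by rewrite lee_fin leNgt A0.
  rewrite -z0 (prodm_tonelli2 _ _ mWE Wp0E).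
  have mb := @measurable_box R (m + m) 0 1.
  have -> : (A%:E = \int[rvec_measure R (m + m)]_z (A%:E * (\1_(@box R (m + m) 0 1) z)%:E))%E.
    rewrite ge0_integralZl_EFin//; last 2 first.
    - by apply/measurable_EFinP; exact: measurable_indic.
    - exact: ltW.
    rewrite integral_indic// setIT [X in (_ * X)%E](@rvec_measure_box R _ 0 1 ler01).
    by rewrite subr0 expr1n mule1.
  apply: ge0_le_integral => //.
  - by move=> z _; rewrite mule_ge0// lee_fin// ltW.
  - apply: measurable_funeM; apply/measurable_EFinP; exact: measurable_indic.
  - have msw : measurable_fun setT (fun p : rvec R (m + m) * nat => (p.2, p.1)).
      by apply/measurable_fun_pairP; split; [exact: measurable_snd|exact: measurable_fst].
    exact: (measurable_integral2 (@counting nat R) (measurableT_comp mWE msw)).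
  - move=> z _; apply: (@le_trans _ _ A%:E).
      rewrite -EFinM lee_fin; apply: ler_piMr; first exact: ltW.
      by rewrite indicE; case: (_ \in _); rewrite ?lexx ?ler01.
    have := lb _ (atom_at_mem z); rewrite atom_at_norm mulr1 => h; apply: le_trans h _.
    by rewrite le_eqVlt; apply/orP; left; apply/eqP; apply: eq_integral => n _; rewrite UE'.
have LFs n : L2c (Fs n k) by exact: mF.
have LDs n : L2c (Ds n k) by exact: mD.
pose u1 (q : nat * rvec R (m + m)) := (ipL2 (Fs q.1 k) (atomv q.2)).1.
pose u2 (q : nat * rvec R (m + m)) := (ipL2 (Fs q.1 k) (atomv q.2)).2.
pose v1 (q : nat * rvec R (m + m)) := (ipL2 (Ds q.1 k) (atomv q.2)).1.
pose v2 (q : nat * rvec R (m + m)) := (ipL2 (Ds q.1 k) (atomv q.2)).2.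
have mu1 : measurable_fun setT u1.
  by apply: (@measurable_nat_pair _ (rvec R (m + m)) _ R) => n; exact: (measurable_coef_re (LFs n)).
have mu2 : measurable_fun setT u2.
  by apply: (@measurable_nat_pair _ (rvec R (m + m)) _ R) => n; exact: (measurable_coef_im (LFs n)).
have mv1 : measurable_fun setT v1.
  by apply: (@measurable_nat_pair _ (rvec R (m + m)) _ R) => n; exact: (measurable_coef_re (LDs n)).
have mv2 : measurable_fun setT v2.
  by apply: (@measurable_nat_pair _ (rvec R (m + m)) _ R) => n; exact: (measurable_coef_im (LDs n)).
have Ueq q : u1 q ^+ 2 + u2 q ^+ 2 = Wpt val pts W q by case: q => n z; rewrite -UE.
(* A component is no longer than the whole dual vector. *)
have dn n : (ipL2 (Ds n k) (Ds n k)).1 <= A^-1.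
  have := dual_norm H mF A0 lb ub mD Dd n; apply: le_trans.
  change ((ipL2 (Ds n k) (Ds n k)).1 <= \sum_(j < d) (ipL2 (Ds n j) (Ds n j)).1).
  by rewrite (bigD1 k)//= lerDl sumr_ge0// => j _; apply: ipL2_re_ge0; exact: mD.
have Vz n : (\int[rvec_measure R (m + m)]_z (v1 (n, z) ^+ 2 + v2 (n, z) ^+ 2)%:E <= (A^-1)%:E)%E.
  have E := moyal_norm (LDs n); rewrite /cabs2 in E.
  by rewrite /v1 /v2 [X in (X <= _)%E]E lee_fin.
have Vi z : (\int[@counting nat R]_n (v1 (n, z) ^+ 2 + v2 (n, z) ^+ 2)%:E <= (A^-1)%:E)%E.
  have := dual_bessel H mF A0 lb ub mD Dd (atom_at_mem z).
  rewrite atom_at_norm mul1r; apply: le_trans; rewrite le_eqVlt; apply/orP; left; apply/eqP.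
  apply: eq_integral => n _; congr (_%:E); have ma := atom_at_mem z.
  by rewrite -/(Ds n) cabs2_ipC// (ip_atom_at z (mD n)).
have Tz n : \int[rvec_measure R (m + m)]_z (u1 (n, z) * v1 (n, z) + u2 (n, z) * v2 (n, z)) =
    (ipL2 (Fs n k) (Ds n k)).1.
  by rewrite -[RHS](moyal (LFs n) (LDs n)).
have Ti z : \int[@counting nat R]_n (u1 (n, z) * v1 (n, z) + u2 (n, z) * v2 (n, z)) = 1.
  have ma := atom_at_mem z.
  rewrite -(atom_at_norm z) -(dual_reconstruct H mF A0 lb ub mD Dd ma).
  apply: eq_Rintegral => n _; rewrite /cdot -/(Fs n) -/(Ds n).
  rewrite (ch_reC H ma (mF n)) (ch_imC H ma (mF n)) (ch_reC H ma (mD n)) (ch_imC H ma (mD n)).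
  by rewrite mulrNN (ip_atom_at z (mF n)) (ip_atom_at z (mD n)).
have Nu : invmx M^T \in unitmx by rewrite unitmx_inv unitmx_tr.
have selE j n : selected val pts (invmx M^T) O j%:R n =
    nat_ext false (fun i => `[< in_region j i >]) n.
  rewrite /selected /inK /val /pts /in_region /nat_ext -(MQ_body O Mu).
  by case: (pickle_inv n).
split.
(* Moyal's identity bounds the squared norm of every shifted window by the mass of [W], and [dn]
   bounds that of the dual component. *)
- exists (fine (\int[rvec_measure R (m + m)]_z (W z)%:E) + A^-1) => i.
  have Di : L2c (dual i k) by exact: dual_mem.
  apply: le_trans (ipL2_re_bound (LF i) Di) _; apply: lerD; last first.
    by have := dn (pickle i); rewrite /Ds nat_ext_pickle.
  have Wf : (\int[rvec_measure R (m + m)]_z (W z)%:E)%E \is a fin_num.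
    by rewrite ge0_fin_numE//; exact: ltW.
  have WE : (((ipL2 (F i k : CFun R m) (F i k : CFun R m)).1)%:E <=
      \int[rvec_measure R (m + m)]_z (W z)%:E)%E.
    have WF := Wpt_integral_le val pts mW W0 (pickle i).
    apply: le_trans WF; rewrite -(moyal_norm (LF i)).
    rewrite le_eqVlt; apply/orP; left; apply/eqP.
    by apply: eq_integral => z _; rewrite -UE /Fs nat_ext_pickle.
  by rewrite -lee_fin (fineK Wf); exact: WE.
- have [C C0 hC] := selected_count mW W0 Wi Wpos bessel O Nu.
  exists C => // j j0.
  have cE : (\int[@counting nat R]_n (nat_ext 0 (fun i => `[< in_region j i >]%:R) n)%:E <=
      (C * volm (MQ M O j))%:E)%E.
    rewrite volm_MQ//; have := hC j j0; apply: le_trans.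
    rewrite le_eqVlt; apply/orP; left; apply/eqP; apply: eq_integral => n _.
    by rewrite selE /nat_ext; case: (pickle_inv n).
  have fS := count_finite cE; split => //.
  have E := count_fsum (fun=> 1 : R) fS; rewrite /mcount -E.
  rewrite -lee_fin; apply: (le_trans _ cE); rewrite /Rintegral.
  have Eint : (\int[@counting nat R]_n
      (nat_ext 0 (fun i => `[<in_region j i>]%:R * 1 : R) n)%:E =
      \int[@counting nat R]_n (nat_ext 0 (fun i => `[<in_region j i>]%:R : R) n)%:E)%E.
    by apply: eq_integral => n _; rewrite /nat_ext; case: (pickle_inv n) => //= i; rewrite mulr1.
  rewrite Eint; set J := (\int[_]_n _)%E.
  have J0 : (0 <= J)%E.
    by apply: integral_ge0 => n _; rewrite lee_fin /nat_ext; case: (pickle_inv n).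
  have cJ : (J <= (C * volm (MQ M O j))%:E)%E by exact: cE.
  by rewrite fineK// ge0_fin_numE//; exact: le_lt_trans cJ (ltry _).
- have L := localization_cvg mW W0 Wi Wpos bessel O Nu mu1 mu2 mv1 mv2 Ueq Vz Vi Tz Ti.
  (* The volume formula and the finiteness of the regions are established for positive [j], hence
     the shift of the index. *)
  rewrite -cvg_shiftS; rewrite -cvg_shiftS in L.
  have EE : (fun j => (\sum_(i \in in_region j.+1) diag_part i) / volm (MQ M O j.+1)) =
     (fun j => (\int[@counting nat R]_n ((selected val pts (invmx M^T) O j.+1%:R n)%:R *
        (ipL2 (Fs n k) (Ds n k)).1)) /
       (j.+1%:R ^+ (m + m) * fine (rvec_measure R (m + m) (body (invmx M^T) 0 1)))).
    apply/funext => j; rewrite volm_MQ//; congr (_ / _).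
    have [C C0 hC] := selected_count mW W0 Wi Wpos bessel O Nu.
    have cE : (\int[@counting nat R]_n (nat_ext 0 (fun i => `[< in_region j.+1 i >]%:R) n)%:E <=
        (C * (j.+1%:R ^+ (m + m) * fine (rvec_measure R (m + m) (body (invmx M^T) 0 1))))%:E)%E.
      have := hC j.+1 isT; apply: le_trans.
      rewrite le_eqVlt; apply/orP; left; apply/eqP; apply: eq_integral => n _.
      by rewrite selE /nat_ext; case: (pickle_inv n).
    rewrite -(count_fsum _ (count_finite cE)); apply: eq_Rintegral => n _.
    rewrite selE /Fs /Ds /nat_ext /diag_part; case: (pickle_inv n) => [i|] //.
    by rewrite mul0r.
  by rewrite EE; exact: L.
Qed.

End component.
End dual_frame.

(** * Averages over the common region along an ultrafilter *)

Section region_average.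
Variables (R : realType) (p : set_system nat).
Hypothesis fp : free_ultrafilter p.
Variables (N P Q vol SL SN : nat -> R) (C Cx : R).
Hypothesis N0 : forall n, 0 <= N n.
Hypothesis P0 : forall n, 0 <= P n.
Hypothesis vol0 : forall n, (0 < n)%N -> 0 < vol n.
Hypothesis PC : forall n, (0 < n)%N -> P n <= C * vol n.
Hypothesis SP : forall n, (0 < n)%N -> `|SL n| <= Cx * P n.
Hypothesis SD : forall n, (0 < n)%N -> `|SL n - SN n| <= Cx * (P n + N n - 2 * Q n).
Hypothesis QN : Q n / N n @[n --> \oo] --> (1 : R).
Hypothesis PN : P n / N n @[n --> \oo] --> (1 : R).
Hypothesis SV : SL n / vol n @[n --> \oo] --> (1 : R).

Let PF : ProperFilter p := free_ultrafilter_proper fp.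
Local Existing Instance PF.

Let pos : \forall n \near p, (0 < n)%N.
Proof. by apply: (free_ultrafilter_oo fp); exact: nbhs_infty_gt. Qed.

(** [N], [P] and [Q] are the counts in the common region, in the region of one component, and in
    their overlap. Since [P / N] and [Q / N] tend to 1 the symmetric difference is negligible, so
    [SN] may be replaced by [SL], which is about [vol]; and [vol / N] is the quotient of [P / N] by
    [P / vol]. *)
Lemma region_average : exists2 D : R, P n / vol n @[n --> p] --> D &
  (N n)^-1 * SN n @[n --> p] --> D^-1.
Proof.
(* The bound must hold at every index, and [PC] says nothing at 0, whence the maximum. *)
have [D hD] : exists D : R, P n / vol n @[n --> p] --> D.
  apply: (bounded_ulim_cvg fp (C := Num.max C `|P 0 / vol 0|)) => -[|n].
    by rewrite le_max lexx orbT.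
  rewrite le_max ger0_norm ?ler_pdivrMr ?PC ?vol0//.
  by apply: divr_ge0 => //; exact/ltW/vol0.
have Sp := cvg_free fp SV.
(* Diagonal terms of size at most [Cx] add up to about [vol], so [1 <= Cx * D]. *)
have D0 : D != 0.
  apply/eqP => Dz; have h1 : `|SL n / vol n| @[n --> p] --> (`|1| : R) by exact: cvg_norm.
  have h2 : Cx * (P n / vol n) @[n --> p] --> Cx * D by apply: cvgM => //; exact: cvg_cst.
  have : `|1 : R| <= Cx * D.
    have := ler_cvg_to h1 h2; apply; near=> n.
    have n0 : (0 < n)%N by near: n.
    have v0 := vol0 n0.
    by rewrite normrM normfV [`|vol n|]gtr0_norm// mulrA ler_wpM2r ?invr_ge0 ?(ltW v0) ?SP.
  by rewrite Dz mulr0 normr1 ler10.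
exists D => //.
have QNp := cvg_free fp QN; have PNp := cvg_free fp PN.
(* Division by 0 gives 0, while [P / N] tends to 1. *)
have Nn0 : \forall n \near p, N n != 0.
  have h := cvgr_neq0 _ PNp (oner_neq0 R); near=> n.
  have : P n / N n != 0 by near: n; exact: h.
  by apply: contraNneq => ->; rewrite invr0 mulr0.
have e0 : (N n)^-1 * (SN n - SL n) @[n --> p] --> (0 : R).
  have b0 : Cx * (P n / N n + 1 - 2 * (Q n / N n)) @[n --> p] --> (0 : R).
    rewrite -(mulr0 Cx) -[X in Cx * X](subrr (2 * 1 : R)).
    have -> : 2 * 1 - 2 * 1 = 1 + 1 - 2 * 1 :> R by ring.
    apply: cvgM; first exact: cvg_cst.
    apply: cvgB; first by apply: cvgD => //; exact: cvg_cst.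
    by apply: cvgM => //; exact: cvg_cst.
  have nb0 : - (Cx * (P n / N n + 1 - 2 * (Q n / N n))) @[n --> p] --> (0 : R).
    by rewrite -oppr0; exact: cvgN.
  apply: (squeeze_cvgr _ nb0 b0); near=> n.
  have n0 : (0 < n)%N by near: n.
  rewrite -ler_norml normrM normfV (ger0_norm (N0 n)) distrC.
  have Np : 0 < N n by rewrite lt_neqAle N0 andbT eq_sym; near: n.
  rewrite ler_pdivrMl//; apply: le_trans (SD n0) _; rewrite le_eqVlt; apply/orP; left; apply/eqP.
  by field; rewrite gt_eqF.
have VN : (P n / N n) * (P n / vol n)^-1 @[n --> p] --> (D^-1 : R).
  by rewrite -[D^-1]mul1r; apply: cvgM => //; exact: cvgV.
have main : SL n / vol n * ((P n / N n) * (P n / vol n)^-1) + (N n)^-1 * (SN n - SL n)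
    @[n --> p] --> (D^-1 : R).
  by rewrite -[D^-1]addr0; apply: cvgD => //; rewrite -[D^-1]mul1r; exact: cvgM.
apply: cvg_trans main; apply: near_eq_cvg; near=> n.
have n0 : (0 < n)%N by near: n.
have vn : vol n != 0 by rewrite gt_eqF// vol0.
have : P n / vol n != 0 by near: n; exact: (cvgr_neq0 _ hD D0).
rewrite mulf_eq0 negb_or => /andP[Pn _].
have Nn : N n != 0 by near: n.
by field; rewrite vn Pn Nn.
Unshelve. all: by end_near. Qed.

End region_average.

(** * The frame measure as a sum over components *)

Theorem theorem9p10 (R : realType) (m d : nat) (hd : (0 < d)%N)
    (I : 'I_d -> countType)
    (g : 'I_d -> CFun R m)
    (lam : forall k : 'I_d, I k -> 'rV[R]_(m + m))
    (phi : forall k : 'I_d, I k -> R)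
    (a : forall k : 'I_d, I (Ordinal hd) -> I k)
    (nrm : 'rV[R]_(m + m) -> R)
    (O : 'rV[R]_(m + m))
    (M : 'I_d -> 'M[R]_(m + m))
    (r : R -> R) :
  is_normf nrm ->
  (forall k, L2c (g k)) ->
  (forall k, is_frame (@L2c R m) (@ipL2 R m)
                (fun i : I k => gabor (g k) (phi k i) (lam k i))) ->
  (forall i, a (Ordinal hd) i = i) ->
  (forall k, bijective (a k)) ->
  is_frame (@dsum_mem R m d) (@dsum_ip R m d)
    (fun i : I (Ordinal hd) =>
       fun k : 'I_d => gabor (g k) (phi k (a k i)) (lam k (a k i))) ->
  (forall k, M k \in unitmx) ->
  (forall k,
     (fun n : nat =>
        mcount ((a k @^-1` [set s | MQ (M k) O n (lam k s)])
                 `&` [set i | MQ (M (Ordinal hd)) O n (lam (Ordinal hd) i)])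
        / mcount [set i | MQ (M (Ordinal hd)) O n (lam (Ordinal hd) i)])
       @ \oo --> (1 : R)) ->
  (forall k,
     (fun n : nat =>
        mcount [set s | MQ (M k) O n (lam k s)]
        / mcount [set i | MQ (M (Ordinal hd)) O n (lam (Ordinal hd) i)])
       @ \oo --> (1 : R)) ->
  (forall x : R, 0 <= x -> 0 <= r x) ->
  (forall (k : 'I_d) (s1 s2 : I k) (i1 i2 : I (Ordinal hd)),
     a k i1 = s1 -> a k i2 = s2 ->
     nrm (lam (Ordinal hd) i1 - lam (Ordinal hd) i2)
       <= r (nrm (lam k s1 - lam k s2))) ->
  forall p : set (set nat), free_ultrafilter p ->
    frame_measure (@dsum_mem R m d) (@dsum_ip R m d) (@zero_vec R m d)
      (fun i : I (Ordinal hd) =>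
         fun k : 'I_d => gabor (g k) (phi k (a k i)) (lam k (a k i)))
      (fun n => [set i | MQ (M (Ordinal hd)) O n (lam (Ordinal hd) i)]) p
    = \sum_(k < d) (gdensity (lam k) O (M k) p)^-1
  /\ \sum_(k < d) (gdensity (lam k) O (M k) p)^-1 <= 1.
Proof.
move=> _ Lg _ a1 abij hF Mu hQ hP _ _ p fp.
pose F (i : I (Ordinal hd)) (k : 'I_d) : CFun R m :=
  gabor (g k) (phi k (a k i)) (lam k (a k i)).
rewrite -/F in hF *.
have PF : ProperFilter (p : set_system nat) := free_ultrafilter_proper fp.
(* All components are indexed by the first index set through the bijections, so their regions become
   subsets of one type and can be compared. *)
pose pts k i := lam k (a k i).
have Fk k i : F i k = gabor (g k) (phi k (a k i)) (pts k i) by [].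
pose L k := in_region (pts k) (M k) O.
have LE k n : L k n = a k @^-1` [set s | MQ (M k) O n (lam k s)] by [].
have L1 n : [set i | MQ (M (Ordinal hd)) O n (lam (Ordinal hd) i)] = L (Ordinal hd) n.
  by apply/seteqP; split => i; rewrite /L /in_region /pts /= a1.
have cE k n : mcount [set s | MQ (M k) O n (lam k s)] = mcount (L k n) :> R.
  by rewrite LE mcount_bij.
have comp k := component_limit hF O (Lg k) (Fk k) (Mu k).
have fin k n : (0 < n)%N -> finite_set (L k n).
  by have [_ [C C0 h] _] := comp k => n0; have [] := h n n0.
have mc0 (S : set (I (Ordinal hd))) : 0 <= mcount S :> R.
  by rewrite /mcount; apply: sumr_ge0.
pose avg k n := (mcount (L (Ordinal hd) n))^-1 * \sum_(i \in L (Ordinal hd) n) diag_part F k i.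
have key k : exists2 D : R, gdensity (lam k) O (M k) p = D &
    avg k n @[n --> (p : set_system nat)] --> D^-1.
  have [[Cx hx] [C C0 hC] hlim] := comp k.
  have QN : mcount (L k n `&` L (Ordinal hd) n) / mcount (L (Ordinal hd) n)
      @[n --> \oo] --> (1 : R).
    by have := hQ k; under eq_fun do rewrite L1.
  have PN : mcount (L k n) / mcount (L (Ordinal hd) n) @[n --> \oo] --> (1 : R).
    by have := hP k; under eq_fun do rewrite cE L1.
  have [D hD hA] := region_average fp (N := fun n => mcount (L (Ordinal hd) n))
    (P := fun n => mcount (L k n)) (Q := fun n => mcount (L k n `&` L (Ordinal hd) n))
    (vol := fun n => volm (MQ (M k) O n))
    (SL := fun n => \sum_(i \in L k n) diag_part F k i)
    (SN := fun n => \sum_(i \in L (Ordinal hd) n) diag_part F k i) (C := C) (Cx := Cx)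
    (fun n => mc0 _) (fun n => mc0 _) (fun n => volm_MQ_gt0 O (Mu k) (j := n))
    (fun n n0 => (hC n n0).2)
    (fun n n0 => mcount_le (fin k n n0) hx)
    (fun n n0 => fsum_symdiff (fin k n n0) (fin (Ordinal hd) n n0) hx)
    QN PN hlim.
  exists D => //; apply: (ulim_cvg fp).
  by under eq_fun do rewrite cE.
have sumE : \sum_(k < d) avg k n @[n --> (p : set_system nat)] -->
    \sum_(k < d) (gdensity (lam k) O (M k) p)^-1.
  apply: cvg_big => [|k _]; first exact: add_continuous.
  by have [D -> ] := key k.
have pos : \forall n \near (p : set_system nat), (0 < n)%N.
  by apply: (free_ultrafilter_oo fp); exact: nbhs_infty_gt.
(* The inner product of the direct sum is the sum of those of its components, so the averages of the
   diagonal terms add up. *)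
have avgE n : (0 < n)%N -> \sum_(k < d) avg k n =
    (mcount (L (Ordinal hd) n))^-1 * \sum_(i \in L (Ordinal hd) n)
      (dsum_ip (F i) (dual F i)).1.
  move=> n0; have fL := fin (Ordinal hd) n n0.
  have E k : avg k n = (mcount (L (Ordinal hd) n))^-1 *
      \sum_(i <- finmap.enum_fset (fset_set (L (Ordinal hd) n))) diag_part F k i.
    by rewrite /avg (fsbig_finite _ _ fL).
  under eq_bigr do rewrite E.
  by rewrite -mulr_sumr exchange_big (fsbig_finite _ _ fL).
split.
  apply: (ulim_cvg fp); apply: cvg_trans sumE; apply: near_eq_cvg; near=> n.
  have n0 : (0 < n)%N by near: n.
  by rewrite avgE// L1.
apply: (cvgr_to_le sumE); near=> n.
have n0 : (0 < n)%N by near: n.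
rewrite avgE//.
have mle : \sum_(i \in L (Ordinal hd) n) (dsum_ip (F i) (dual F i)).1 <= mcount (L (Ordinal hd) n) :> R.
  rewrite /mcount !fsbig_finite; [|exact: fin..].
  by apply: ler_sum => i _; have /andP[] := dual_diag hF i.
(* If the region is empty, its count is 0 and so is the inverse of the count, and the bound holds
   trivially. *)
have := mc0 (L (Ordinal hd) n); rewrite le_eqVlt => /orP[/eqP <-|N0].
  by rewrite invr0 mul0r.
by rewrite ler_pdivrMl// mulr1.
Unshelve. all: by end_near. Qed.
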